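(* Let $d\ge1$ and let $V\in L^1_{\mathrm{loc}}(\mathbb{R}_t;\mathcal{L}(L^2(\mathbb{T}^d)))$ (for example, $V$ can be a potential in $L^1_{\mathrm{loc}}(\mathbb{R}_t;L^\infty(\mathbb{T}^d))$ acting by pointwise multiplication). For any sequence $(u_{n,0})_{n\in\mathbb{N}}$ bounded in $L^2(\mathbb{T}^d)$, let $(u_n)$ be the sequence of the unique solutions in $C^0(\mathbb{R};L^2(\mathbb{T}^d))$ of $$(i\partial_t+\Delta+V(t))u_n=0,\qquad u_n|_{t=0}=u_{n,0}.$$ Then for any $T>0$ the sequence $(u_n)$ satisfies property ($AC_T$).
   Context: $\mathbb{T}^d=\mathbb{R}^d/\mathbb{Z}^d$, $\Delta$ is the Laplace operator on $\mathbb{T}^d$, functions are complex valued, and $\mathcal{L}(L^2(\mathbb{T}^d))$ is the space of bounded linear operators on $L^2(\mathbb{T}^d)$ with the operator norm. Solutions are understood in the Duhamel sense: $u_n(t)=e^{it\Delta}u_{n,0}+\frac1i\int_0^t e^{i(t-s)\Delta}\bigl(-V(s)u_n(s)\bigr)\,ds$, where $e^{it\Delta}$ is the unitary group on $L^2(\mathbb{T}^d)$ generated by $i\Delta$. Property ($AC_T$): let $T>0$ and let $(u_n)$ be a sequence bounded in $L^2((0,T)\times\mathbb{T}^d)$. Set $\nu_n=|u_n(t,x)|^2\,dt\,dx$, a sequence of positive measures of bounded mass on $(0,T)\times\mathbb{T}^d$. The sequence $(u_n)$ satisfies property ($AC_T$) if any weak-$*$ limit $\nu$ of $(\nu_n)$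 (i.e. any Radon measure $\nu$ on $(0,T)\times\mathbb{T}^d$ which is the limit of some subsequence of $(\nu_n)$ when tested against continuous compactly supported functions on $(0,T)\times\mathbb{T}^d$) is absolutely continuous with respect to the Lebesgue measure $dt\,dx$ on $(0,T)\times\mathbb{T}^d$. *)

(* Defs.v *)
From HB Require Import structures.
From mathcomp Require Import all_boot all_order all_algebra generic_quotient.
From mathcomp Require Import complex.
From mathcomp Require Import all_classical all_reals all_analysis.
From mathcomp Require Import measurable_realfun.

Set Implicit Arguments.
Unset Strict Implicit.
Unset Printing Implicit Defensive.
Import Order.TTheory GRing.Theory Num.Theory.
Import numFieldNormedType.Exports.
Import Normc.
Local Open Scope classical_set_scope.
Local Open Scope complex_scope.
Local Open Scope ring_scope.

Lemma ReD (R : realType) (a b : R[i]) :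
  complex.Re (a + b) = complex.Re a + complex.Re b.
Proof. by case: a b => [? ?] []. Qed.

Lemma ImD (R : realType) (a b : R[i]) :
  complex.Im (a + b) = complex.Im a + complex.Im b.
Proof. by case: a b => [? ?] []. Qed.

Section square_integrable.
Context {d : measure_display} {T : measurableType d} {R : realType}.
Variable mu : {measure set T -> \bar R}.
Implicit Types (f g : T -> R[i]) (c : R[i]).

(* Complex-valued measurable functions f with |f| in L^2; [normc] is the real-valued
   modulus on R[i]. *)
Definition sqint f : Prop :=
  [/\ measurable_fun [set: T] (fun x => complex.Re (f x)),
      measurable_fun [set: T] (fun x => complex.Im (f x))
    & finite_norm mu 2%:E (fun x => normc (f x))].

Definition sqint_pred : {pred T -> R[i]} := fun f => `[< sqint f >].

Lemma measurable_normc f :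
  measurable_fun [set: T] (fun x => complex.Re (f x)) ->
  measurable_fun [set: T] (fun x => complex.Im (f x)) ->
  measurable_fun [set: T] (fun x => normc (f x)).
Proof.
move=> mr mi.
have -> : (fun x => normc (f x)) =
   (fun x => (complex.Re (f x) ^+ 2 + complex.Im (f x) ^+ 2) `^ 2^-1).
  apply/funext => x; case: (f x) => a b /=; rewrite powR12_sqrt//.
  by rewrite addr_ge0 ?sqr_ge0.
apply: (@measurableT_comp _ _ _ _ _ _ (@powR R ^~ 2^-1)) => //.
by apply: measurable_funD; apply: measurable_funX.
Qed.

Lemma le_Lnorm2 (u v : T -> R) : measurable_fun [set: T] u ->
  measurable_fun [set: T] v -> (forall x, `|u x| <= `|v x|) ->
  (Lnorm mu 2%:E (EFin \o u) <= Lnorm mu 2%:E (EFin \o v))%E.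
Proof.
move=> mu_ mv uv; rewrite unlock.
have mp (w : T -> R) : measurable_fun [set: T] w ->
    measurable_fun [set: T] (fun x => (`|(w x)%:E| `^ 2)%E).
  move=> mw; apply/measurable_EFinP.
  apply: (@measurableT_comp _ _ _ _ _ _ (@powR R ^~ 2)) => //.
  exact: measurableT_comp.
apply: gt0_ler_poweR; rewrite ?lee_fin ?invr_ge0//.
- by rewrite in_itv/= leey integral_ge0// => x _; exact: poweR_ge0.
- by rewrite in_itv/= leey integral_ge0// => x _; exact: poweR_ge0.
apply: ge0_le_integral => //.
- by move=> x _; exact: poweR_ge0.
- exact: (mp _ mu_).
- exact: (mp _ mv).
- by move=> x _ /=; rewrite lee_fin ge0_ler_powR ?nnegrE.
Qed.

Lemma normcD_le f g : sqint f -> sqint g ->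
  (Lnorm mu 2%:E (fun x => (normc (f x + g x))%:E) <=
   Lnorm mu 2%:E (fun x => (normc (f x))%:E) +
   Lnorm mu 2%:E (fun x => (normc (g x))%:E))%E.
Proof.
move=> [fr fi _] [gr gi _].
have mf := measurable_normc fr fi; have mg := measurable_normc gr gi.
apply: le_trans (minkowski_EFin mu mf mg _) => //; last by rewrite ler1n.
apply: le_Lnorm2.
- apply: measurable_normc.
    rewrite (_ : (fun x => _) = (fun x => complex.Re (f x) + complex.Re (g x))).
      exact: measurable_funD.
    by apply/funext => x; case: (f x) (g x) => [? ?] [].
  rewrite (_ : (fun x => _) = (fun x => complex.Im (f x) + complex.Im (g x))).
    exact: measurable_funD.
  by apply/funext => x; case: (f x) (g x) => [? ?] [].
- exact: measurable_funD.
move=> x /=.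
have n0 z : 0 <= normc z :> R by case: z => a b /=; exact: sqrtr_ge0.
by rewrite !ger0_norm ?addr_ge0//; exact: le_normcD.
Qed.

Lemma normc_ge0 (z : R[i]) : 0 <= normc z.
Proof. by case: z => a b; exact: sqrtr_ge0. Qed.

Lemma measurable_ReM f c :
  measurable_fun [set: T] (fun x => complex.Re (f x)) ->
  measurable_fun [set: T] (fun x => complex.Im (f x)) ->
  measurable_fun [set: T] (fun x => complex.Re (c * f x)) /\
  measurable_fun [set: T] (fun x => complex.Im (c * f x)).
Proof.
case: c => a b mr mi; split.
  rewrite (_ : (fun x => _) =
      (fun x => a * complex.Re (f x) - b * complex.Im (f x))).
    by apply: measurable_funB; apply: measurable_funM.
  by apply/funext => x; case: (f x).
rewrite (_ : (fun x => _) =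
    (fun x => a * complex.Im (f x) + b * complex.Re (f x))).
  by apply: measurable_funD; apply: measurable_funM.
by apply/funext => x; case: (f x).
Qed.

Lemma le1_2 : (1 <= 2%:E :> \bar R)%E.
Proof. by rewrite lee_fin ler1n. Qed.

Lemma LnormcZ f c : sqint f ->
  Lnorm mu 2%:E (fun x => (normc (c * f x))%:E) =
  ((normc c)%:E * Lnorm mu 2%:E (fun x => (normc (f x))%:E))%E.
Proof.
move=> [mr mi fin].
have uL : (fun x => normc (f x)) \in Lfun mu 2%:E.
  by apply/andP; split; rewrite inE//=; exact: measurable_normc.
have := LnormZ (Lfun_Sub le1_2 uL) (normc c).
rewrite ger0_norm ?normc_ge0//= => <-.
by congr Lnorm; apply/funext => x /=; rewrite normcM.
Qed.

Lemma sqint_submod_closed : submod_closed sqint_pred.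
Proof.
split=> [|c f g].
  apply/asboolP; split=> //; rewrite /finite_norm.
  rewrite (_ : _ \o _ = cst 0%E) ?Lnorm0// ?gt_eqF//.
  by apply/funext => x /=; rewrite expr0n/= addr0 sqrtr0.
move=> /asboolP f2 /asboolP g2; apply/asboolP.
have [mr mi ff] := f2; have [mr' mi' gf] := g2.
have cf2 : sqint (fun x => c * f x).
  have [cr ci] := measurable_ReM c mr mi; split => //.
  rewrite /finite_norm /comp LnormcZ// lte_mul_pinfty ?lee_fin ?normc_ge0//.
have [cr ci cff] := cf2.
split.
- rewrite (_ : (fun x => _) =
    (fun x => complex.Re (c * f x) + complex.Re (g x))).
    exact: measurable_funD.
  by apply/funext => x; exact: ReD.
- rewrite (_ : (fun x => _) =
    (fun x => complex.Im (c * f x) + complex.Im (g x))).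
    exact: measurable_funD.
  by apply/funext => x; exact: ImD.
rewrite /finite_norm.
apply: le_lt_trans (normcD_le cf2 g2) _.
by rewrite lte_add_pinfty.
Qed.

HB.instance Definition _ := GRing.isSubmodClosed.Build R[i] (T -> R[i]) sqint_pred sqint_submod_closed.

Record sqfun := SqFun { sqfun_val :> T -> R[i] ; _ : sqfun_val \in sqint_pred }.

HB.instance Definition _ := [isSub for sqfun_val].
HB.instance Definition _ := [Choice of sqfun by <:].
HB.instance Definition _ := [SubChoice_isSubLmodule of sqfun by <:].

Definition sq_ae_eq (f g : sqfun) : bool := `[< {ae mu, forall x, f x = g x} >].

Lemma sq_ae_eq_equiv : equiv_class_of sq_ae_eq.
Proof.
split=> [f|f g|g f h].
- by apply/asboolP; exact: aeW.
- by apply/asboolP/asboolP; apply: filterS => x ->.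
- by move=> /asboolP fg /asboolP gh; apply/asboolP; move: fg gh; apply: filterS2 => x -> ->.
Qed.

Canonical sq_ae_eq_canonical := EquivRelPack sq_ae_eq_equiv.

(* Classes of square-integrable functions modulo equality mu-almost everywhere.
   The lmodType operations over R[i] and the norm are added below. *)
Definition L2 : Type := {eq_quot sq_ae_eq}%qT.
HB.instance Definition _ := Choice.on L2.
HB.instance Definition _ := EqQuotient.on L2.

End square_integrable.

Section L2_normed_module.
Context {d : measure_display} {T : measurableType d} {R : realType}.
Variable mu : {measure set T -> \bar R}.
Local Notation sqfun := (sqfun mu).
Local Notation L2 := (L2 mu).
Implicit Types (f g h : sqfun) (u v w : L2).
Local Open Scope quotient_scope.

Definition L2_class (f : sqfun) : L2 := \pi_({eq_quot @sq_ae_eq _ _ _ mu}) f.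
Definition L2_repr (u : L2) : sqfun := repr (u : {eq_quot @sq_ae_eq _ _ _ mu}).
(* An element of L^2 is applied to points through a chosen representative;
   only almost-everywhere statements about [u x] are meaningful. *)
Definition L2_fun (u : L2) : T -> R[i] := L2_repr u.
Coercion L2_fun : L2 >-> Funclass.

Lemma L2_reprK u : L2_class (L2_repr u) = u.
Proof. exact: reprK. Qed.

Lemma L2_classP (f g : sqfun) :
  L2_class f = L2_class g <-> {ae mu, forall x, f x = g x}.
Proof.
split=> [/eqquotP/asboolP//|fg]; exact/eqquotP/asboolP.
Qed.

Lemma L2_class_funE (f : sqfun) : {ae mu, forall x, L2_class f x = f x}.
Proof. by apply/L2_classP; rewrite L2_reprK. Qed.

Lemma L2P (u v : L2) : {ae mu, forall x, u x = v x} -> u = v.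
Proof. by move=> uv; rewrite -[u]L2_reprK -[v]L2_reprK; exact/L2_classP. Qed.

Definition L2_zero : L2 := L2_class 0.
Definition L2_opp (u : L2) : L2 := L2_class (- L2_repr u).
Definition L2_add (u v : L2) : L2 := L2_class (L2_repr u + L2_repr v).
Definition L2_scale (c : R[i]) (u : L2) : L2 := L2_class (c *: L2_repr u).

Lemma L2_oppE f : L2_opp (L2_class f) = L2_class (- f).
Proof.
by apply/L2_classP; apply: filterS (L2_class_funE f) => x fx; exact: (congr1 -%R fx).
Qed.

Lemma L2_addE f g : L2_add (L2_class f) (L2_class g) = L2_class (f + g).
Proof.
apply/L2_classP; apply: filterS2 (L2_class_funE f) (L2_class_funE g) => x fx gx.
exact: (congr2 +%R fx gx).
Qed.

Lemma L2_scaleE c f : L2_scale c (L2_class f) = L2_class (c *: f).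
Proof. by apply/L2_classP; apply: filterS (L2_class_funE f) => x fx; exact: (congr1 (fun z => c * z) fx). Qed.

Lemma L2W (P : L2 -> Prop) : (forall f, P (L2_class f)) -> forall u, P u.
Proof. by move=> Pf u; rewrite -[u]L2_reprK. Qed.

Lemma L2_addA : associative L2_add.
Proof.
by elim/L2W => f; elim/L2W => g; elim/L2W => h; rewrite !L2_addE addrA.
Qed.
Lemma L2_addC : commutative L2_add.
Proof. by elim/L2W => f; elim/L2W => g; rewrite !L2_addE addrC. Qed.
Lemma L2_add0 : left_id L2_zero L2_add.
Proof. by elim/L2W => f; rewrite L2_addE add0r. Qed.
Lemma L2_addN : left_inverse L2_zero L2_opp L2_add.
Proof. by elim/L2W => f; rewrite L2_oppE L2_addE addNr. Qed.

HB.instance Definition _ := GRing.isZmodule.Build L2 L2_addA L2_addC L2_add0 L2_addN.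

Lemma L2_scaleA a b v : L2_scale a (L2_scale b v) = L2_scale (a * b) v.
Proof. by elim/L2W: v => f; rewrite !L2_scaleE scalerA. Qed.
Lemma L2_scale1 : left_id 1 L2_scale.
Proof. by elim/L2W => f; rewrite !L2_scaleE scale1r. Qed.
Lemma L2_scaleDr : right_distributive L2_scale +%R.
Proof.
move=> c u v; elim/L2W: u => f; elim/L2W: v => g.
by rewrite ![_ + _]L2_addE !L2_scaleE [RHS]L2_addE scalerDr.
Qed.
Lemma L2_scaleDl v : {morph L2_scale^~ v : a b / a + b}.
Proof.
by move=> a b; elim/L2W: v => f; rewrite !L2_scaleE [RHS]L2_addE scalerDl.
Qed.

HB.instance Definition _ := GRing.Zmodule_isLmodule.Build R[i] L2
  L2_scaleA L2_scale1 L2_scaleDr L2_scaleDl.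

(* The norm of a normedModType over R[i] takes its values in R[i]. *)
Definition L2_norm (u : L2) : R[i] :=
  (fine (Lnorm mu 2%:E (fun x => (normc (u x))%:E)))%:C.

Lemma sqfunP (f : sqfun) : sqint mu f.
Proof. by case: f => f /= /asboolP. Qed.

Lemma Lnorm_L2_classE f : Lnorm mu 2%:E (fun x => (normc (L2_class f x))%:E) =
  Lnorm mu 2%:E (fun x => (normc (f x))%:E).
Proof.
have mN g : measurable_fun [set: T] (fun x => (`|(normc (g x))%:E| `^ 2)%E).
  have [mr mi _] := sqfunP g; apply/measurable_EFinP.
  apply: (@measurableT_comp _ _ _ _ _ _ (@powR R ^~ 2)) => //.
  by apply: measurableT_comp => //; exact: measurable_normc.
rewrite unlock; congr (_ `^ _)%E; apply: ge0_ae_eq_integral => //.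
- exact: (mN (L2_repr (L2_class f))).
- by move=> x _; exact: poweR_ge0.
- by move=> x _; exact: poweR_ge0.
- by apply: filterS (L2_class_funE f) => x -> _.
Qed.

Lemma L2_normE f :
  L2_norm (L2_class f) = (fine (Lnorm mu 2%:E (fun x => (normc (f x))%:E)))%:C.
Proof. by rewrite /L2_norm Lnorm_L2_classE. Qed.

Lemma Lnorm_fin f : Lnorm mu 2%:E (fun x => (normc (f x))%:E) \is a fin_num.
Proof.
by rewrite ge0_fin_numE ?Lnorm_ge0//; have [] := sqfunP f.
Qed.

Lemma L2_normD u v : L2_norm (u + v) <= L2_norm u + L2_norm v.
Proof.
elim/L2W: u => f; elim/L2W: v => g.
rewrite [_ + _]L2_addE !L2_normE -rmorphD/= lecR.
rewrite -fineD ?Lnorm_fin// fine_le ?fin_numD ?Lnorm_fin//.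
  exact: (Lnorm_fin (f + g)).
exact: (normcD_le (sqfunP f) (sqfunP g)).
Qed.

Lemma L2_normZ c u : L2_norm (c *: u) = `|c| * L2_norm u.
Proof.
elim/L2W: u => f.
rewrite [_ *: _]L2_scaleE !L2_normE.
have := LnormcZ c (sqfunP f).
rewrite [X in fine X](_ : _ = Lnorm mu 2%:E (fun x => (normc (c * f x))%:E))//.
move=> ->; by rewrite fineM ?Lnorm_fin// rmorphM.

Qed.

Lemma L2_norm0_eq0 u : L2_norm u = 0 -> u = 0.
Proof.
elim/L2W: u => f; rewrite L2_normE => /complexI/eqP.
rewrite fine_eq0 ?Lnorm_fin// => /eqP f0; apply/L2_classP.
have [mr mi _] := sqfunP f.
have mN : measurable_fun [set: T] (fun x => (normc (f x))%:E).
  by apply/measurable_EFinP; exact: measurable_normc.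
have p0 : (0 < 2%:E :> \bar R)%E by rewrite lte_fin.
by apply: filterS (Lnorm_eq0_eq0 mN p0 f0) => x /= /(_ I) [] /eq0_normc.
Qed.

HB.instance Definition _ := Lmodule_isNormed.Build R[i] L2 L2_normD L2_normZ L2_norm0_eq0.
End L2_normed_module.

Section bounded_operators.
Context {R : realType}.

(* The norm of E as a real number, see [rnormE]. *)
Definition rnorm {E : normedModType R[i]} (x : E) : R := complex.Re `|x|.

Lemma rnormE (E : normedModType R[i]) (x : E) : `|x| = (rnorm x)%:C.
Proof. by rewrite /rnorm RRe_real// ger0_real. Qed.

Lemma rnorm_ge0 (E : normedModType R[i]) (x : E) : 0 <= rnorm x.
Proof. by rewrite -ler0c -rnormE. Qed.

Lemma rnormD (E : normedModType R[i]) (x y : E) :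
  rnorm (x + y) <= rnorm x + rnorm y.
Proof. by rewrite -lecR rmorphD/= -!rnormE ler_normD. Qed.

Lemma rnormZ (E : normedModType R[i]) c (x : E) :
  rnorm (c *: x) = normc c * rnorm x.
Proof. by apply: complexI; rewrite rmorphM/= -!rnormE normrZ. Qed.

Lemma rnorm0_eq0 (E : normedModType R[i]) (x : E) : rnorm x = 0 -> x = 0.
Proof. by move=> x0; apply/normr0_eq0; rewrite rnormE x0. Qed.

Lemma rnorm0 (E : normedModType R[i]) : rnorm (0 : E) = 0.
Proof. by rewrite /rnorm normr0. Qed.

Variable E : normedModType R[i].
Implicit Types (A B : E -> E) (x : E).

Definition bounded_linear A : Prop :=
  linear A /\ exists M : R, forall x, rnorm (A x) <= M * rnorm x.

Definition bounded_linear_pred : {pred E -> E} := fun A => `[< bounded_linear A >].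

Lemma bounded_linear_submod_closed : submod_closed bounded_linear_pred.
Proof.
split=> [|c A B].
  apply/asboolP; split=> [a x y|].
    by change (0 = a *: (0 : E) + 0); rewrite scaler0 addr0.
  by exists 0 => x; rewrite mul0r [leLHS]rnorm0.
move=> /asboolP[lA [M AM]] /asboolP[lB [N BN]]; apply/asboolP; split.
  move=> a x y.
  change (c *: A (a *: x + y) + B (a *: x + y) =
    a *: (c *: A x + B x) + (c *: A y + B y)).
  by rewrite lA lB !scalerDr !scalerA (mulrC c) addrACA.
exists (normc c * M + N) => x.
apply: le_trans (rnormD _ _) _; rewrite rnormZ mulrDl lerD//.
by rewrite -mulrA ler_wpM2l ?normc_ge0.
Qed.

HB.instance Definition _ := GRing.isSubmodClosed.Build R[i] (E -> E)
  bounded_linear_pred bounded_linear_submod_closed.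

(* The normed space of bounded linear operators on E, with the operator norm. *)
Record bop := Bop { bop_fun :> E -> E ; _ : bop_fun \in bounded_linear_pred }.

HB.instance Definition _ := [isSub for bop_fun].
HB.instance Definition _ := [Choice of bop by <:].
HB.instance Definition _ := [SubChoice_isSubLmodule of bop by <:].

Lemma bopP (A : bop) : bounded_linear A.
Proof. by case: A => A /= /asboolP. Qed.

Definition opnorm (A : bop) : R := sup [set rnorm (A x) | x in [set x | rnorm x <= 1]].

Lemma opnorm_has_sup (A : bop) :
  has_sup [set rnorm (A x) | x in [set x | rnorm x <= 1]].
Proof.
have [_ [M AM]] := bopP A; split.
  by exists (rnorm (A 0)), 0 => //=; rewrite rnorm0.
exists `|M| => _ [x /= x1 <-]; apply: le_trans (AM x) _.
rewrite (le_trans (ler_norm _))// normrM ler_piMr//.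
by rewrite ger0_norm// rnorm_ge0.
Qed.

Lemma opnorm_ub (A : bop) x : rnorm x <= 1 -> rnorm (A x) <= opnorm A.
Proof. by move=> x1; apply: (sup_upper_bound (opnorm_has_sup A)); exists x. Qed.

Lemma opnorm_le (A : bop) (M : R) :
  (forall x, rnorm x <= 1 -> rnorm (A x) <= M) -> opnorm A <= M.
Proof.
move=> AM; apply: ge_sup; first by have [] := opnorm_has_sup A.
by move=> _ [x /= x1 <-]; exact: AM.
Qed.

Lemma bop_linear (A : bop) : linear A.
Proof. by have [] := bopP A. Qed.

Lemma bop0 (A : bop) : A 0 = 0.
Proof.
by have := bop_linear A (-1) 0 0; rewrite scaler0 addr0 scaleN1r addNr.
Qed.

Lemma bopZ (A : bop) c x : A (c *: x) = c *: A x.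
Proof. by have := bop_linear A c x 0; rewrite !addr0 bop0 addr0. Qed.

Lemma opnormD (A B : bop) : (opnorm (A + B))%:C <= (opnorm A)%:C + (opnorm B)%:C.
Proof.
rewrite -rmorphD lecR; apply: opnorm_le => x x1.
by apply: le_trans (rnormD (A x) (B x)) _; rewrite lerD// opnorm_ub.
Qed.

Lemma opnorm_leZ c (A : bop) : opnorm (c *: A) <= normc c * opnorm A.
Proof.
apply: opnorm_le => x x1.
by rewrite [rnorm _](rnormZ c (A x)) ler_wpM2l ?normc_ge0// opnorm_ub.
Qed.

Lemma opnormZ c (A : bop) : (opnorm (c *: A))%:C = `|c| * (opnorm A)%:C.
Proof.
rewrite (_ : `|c| = (normc c)%:C)// -rmorphM; congr (_%:C).
apply/le_anti; rewrite opnorm_leZ/=.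
have [->|c0] := eqVneq c 0.
  rewrite normc0 mul0r; apply: le_trans (opnorm_ub (0 *: A) (x := 0) _).
    exact: rnorm_ge0.
  by rewrite rnorm0.
have nc0 : 0 < normc c.
  by rewrite lt_neqAle normc_ge0 andbT eq_sym; apply/contra: c0 => /eqP/eq0_normc/eqP.
rewrite -ler_pdivlMl// -normcV.
have {1}-> : A = c^-1 *: (c *: A) by rewrite scalerA mulVf// scale1r.
exact: opnorm_leZ.
Qed.

Lemma opnorm0_eq0 (A : bop) : (opnorm A)%:C = 0 -> A = 0.
Proof.
move=> /complexI A0; apply/val_inj/funext => x /=.
apply: rnorm0_eq0; apply/le_anti; rewrite rnorm_ge0 andbT.
have [->|x0] := eqVneq x 0; first by rewrite bop0 rnorm0.
have nx0 : 0 < rnorm x.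
  by rewrite lt_neqAle rnorm_ge0 andbT eq_sym; apply/contra: x0 => /eqP/rnorm0_eq0/eqP.
have : rnorm (A ((rnorm x)^-1%:C *: x)) <= 0.
  rewrite -A0 opnorm_ub// rnormZ /= expr0n addr0 sqrtr_sqr.
  by rewrite gtr0_norm ?invr_gt0// mulVf ?gt_eqF.
rewrite bopZ rnormZ pmulr_rle0//= expr0n addr0 sqrtr_sqr normr_gt0.
by rewrite invr_eq0 gt_eqF.
Qed.

HB.instance Definition _ := Lmodule_isNormed.Build R[i] bop opnormD opnormZ opnorm0_eq0.

End bounded_operators.

Section bochner.
Context {R : realType} {X : normedModType R[i]}.
Implicit Types (s F : R -> X) (D : set R) (w : X) (a b : R).
Local Notation leb := (@lebesgue_measure R).

Definition simple_function s : Prop :=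
  finite_set (range s) /\ forall x, measurable (s @^-1` [set x]).

(* Bochner measurability: almost-everywhere limit of simple functions, in norm. *)
Definition strongly_measurable D F : Prop :=
  exists2 s : nat -> R -> X, forall n, simple_function (s n) &
    {ae leb, forall t, D t -> s n t @[n --> \oo] --> F t}.

Definition bochner_integrable D F : Prop :=
  strongly_measurable D F /\ (\int[leb]_(t in D) (rnorm (F t))%:E < +oo)%E.

Definition locally_bochner_integrable F : Prop :=
  forall a b, bochner_integrable `[a, b] F.

Definition simple_integral a b s : X :=
  \sum_(x \in range s)
    (fine (leb (`[a, b] `&` s @^-1` [set x])))%:C *: x.

(* w = \int_a^b F(t) dt for a <= b. Strong measurability of F is part of the
   definition because the library integral of a nonnegative function is also
   defined (as a supremum) for non-measurable functions. *)
Definition has_bochner_integral a b F w : Prop :=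
  bochner_integrable `[a, b] F /\
  exists s : nat -> R -> X,
    [/\ forall n, simple_function (s n),
        (\int[leb]_(t in `[a, b]) (rnorm (F t - s n t))%:E)%E @[n --> \oo] --> 0%E
      & simple_integral a b (s n) @[n --> \oo] --> w].

(* w = \int_a^b F(t) dt, with \int_a^b = - \int_b^a when b < a. *)
Definition has_oriented_integral a b F w : Prop :=
  (a <= b -> has_bochner_integral a b F w) /\
  (b <= a -> has_bochner_integral b a F (- w)).

End bochner.

Section cube.
Context {R : realType}.
Local Notation GR := (measurableTypeR R).

Definition cons_tuple (d : nat) (z : GR * d.-tuple GR) : d.+1.-tuple GR :=
  [tuple of z.1 :: z.2].

Lemma measurable_cons_tuple d : measurable_fun [set: _] (@cons_tuple d).
Proof. by apply: measurable_cons. Qed.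

HB.instance Definition _ d := isMeasurableFun.Build _ _ _ _ (@cons_tuple d) (@measurable_cons_tuple d).

(* Lebesgue measure on the unit cube [0,1]^d, as an iterated product. *)
Fixpoint cube_measure (d : nat) : probability (d.-tuple GR) R :=
  match d with
  | 0 => \d_([tuple] : 0.-tuple GR)
  | d'.+1 => distribution (uniform_prob (@ltr01 R) \x cube_measure d')%E
               (@cons_tuple d')
  end.
End cube.

Section torus.
Variables (R : realType) (d : nat).
Local Notation GR := (measurableTypeR R).
Implicit Types x y : 'rV[R]_d.

Definition congr_int x y : bool := [forall i, x 0 i - y 0 i \is a Num.int].

Lemma congr_int_equiv : equiv_class_of congr_int.
Proof.
split=> [x|x y|y x z].
- by apply/forallP => i; rewrite subrr rpred0.
- by apply: eq_forallb => i; rewrite -rpredN opprB.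
- move=> /forallP xy /forallP yz; apply/forallP => i.
  by rewrite -(subrKA (y 0 i)) rpredD.
Qed.

Canonical congr_int_canonical := EquivRelPack congr_int_equiv.

(* T^d = R^d / Z^d with the quotient topology; the sigma-algebra, given below, is
   the Borel one. *)
Definition torus : Type := quotient_topology {eq_quot congr_int}%qT.
HB.instance Definition _ := Topological.on torus.
HB.instance Definition _ := Quotient.on torus.
HB.instance Definition _ := Pointed.on torus.

Definition torus_proj (x : 'rV[R]_d) : torus := \pi_(quotient_topology {eq_quot congr_int})%qT x.

End torus.

Section torus_measure.
Variables (R : realType) (d : nat).
Local Notation GR := (measurableTypeR R).

Lemma measurable_row_open (O : set 'rV[R]_d) : open O ->
  measurable [set t : d.-tuple GR | O (\row_i tnth t i)].
Proof.
move=> oO.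
pose box (k : d.-tuple rat * nat) : set (d.-tuple GR) :=
  [set t | forall i, `|ratr (tnth k.1 i) - (tnth t i : R)| < k.2.+1%:R^-1].
pose F k : set (d.-tuple GR) :=
  if `[< box k `<=` [set t | O (\row_i tnth t i)] >] then box k else set0.
have mbox k : measurable (box k).
  rewrite (_ : box k = \bigcap_(i in [set: 'I_d])
      ((fun t : d.-tuple GR => tnth t i) @^-1`
       [set y : GR | `|ratr (tnth k.1 i) - (y : R)| < k.2.+1%:R^-1])).
    apply: fin_bigcap_measurable; first exact: finite_finset.
    move=> i _; rewrite -[X in measurable X]setTI.
    apply: measurable_tnth => //.
    rewrite (_ : mkset _ = ball (ratr (tnth k.1 i) : R) k.2.+1%:R^-1)//.
    exact: measurable_ball.
  by apply/seteqP; split=> t /= tk; [move=> i _|move=> i]; exact: tk.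
rewrite (_ : mkset _ = \bigcup_k F k).
  apply: countable_bigcupT_measurable; first exact: countableP.
  move=> k; rewrite /F; case: ifP => _; last exact: measurable0.
  exact: (mbox k).
apply/seteqP; split=> [t /= Ot|t [k _]]; last first.
  by rewrite /F; case: asboolP => // kO /kO.
have /nbhs_ballP[e /= e0 eO] := open_nbhs_nbhs (conj oO Ot).
have [n ne] : exists n : nat, n.+1%:R^-1 < e / 2 :> R.
  have e20 : 0 < e / 2 by rewrite divr_gt0.
  have /filter_ex[n nP] := near_infty_natSinv_lt (PosNum e20).
  by exists n.
have q i : {q : rat | `|ratr q - (tnth t i : R)| < n.+1%:R^-1}.
  apply: cid; have n0 : 0 < n.+1%:R^-1 :> R by rewrite invr_gt0.
  have lt_t : (tnth t i : R) - n.+1%:R^-1 < (tnth t i : R) + n.+1%:R^-1.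
    by rewrite ltrD2l gtrN.
  have [q] := rat_in_itvoo lt_t; rewrite in_itv/= => /andP[q1 q2].
  by exists q; rewrite ltr_distl q1 q2.
exists ([tuple sval (q i) | i < d], n) => //; rewrite /F; case: asboolP => [_|].
  by move=> i /=; rewrite tnth_mktuple; exact: (svalP (q i)).
case=> t' /= t't; apply: eO; rewrite /ball/=; split=> [|j i]; first exact: e0.
rewrite !mxE.
rewrite /ball/=; have := t't i; rewrite tnth_mktuple => qt'.
have qt := svalP (q i).
rewrite -(subrKA (ratr (sval (q i)))); apply: le_lt_trans (ler_normD _ _) _.
rewrite (splitr e) ltrD//; last exact: lt_trans qt' ne.
by rewrite distrC; exact: lt_trans qt ne.
Qed.

End torus_measure.

Fact torus_display : measure_display. Proof. exact: default_measure_display. Qed.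

Section torus_measurable.
Variables (R : realType) (d : nat).
Local Notation GR := (measurableTypeR R).
Local Notation torus := (torus R d).

Definition borel_torus : set (set torus) := <<s @open torus >>.

Lemma borel_torus0 : borel_torus set0.
Proof. exact: sigma_algebra0. Qed.
Lemma borel_torusC A : borel_torus A -> borel_torus (~` A).
Proof. exact: sigma_algebraC. Qed.
Lemma borel_torus_bigcup (F : (set torus)^nat) :
  (forall i, borel_torus (F i)) -> borel_torus (\bigcup_i F i).
Proof. exact: sigma_algebra_bigcup. Qed.

HB.instance Definition _ := isMeasurable.Build torus_display torus
  borel_torus0 borel_torusC borel_torus_bigcup.

Definition tuple_proj (t : d.-tuple GR) : torus := torus_proj (\row_i tnth t i).

Lemma measurable_tuple_proj : measurable_fun [set: _] tuple_proj.
Proof.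
apply: (@measurability _ _ _ _ _ _ (@open torus)) => //.
move=> _ -[U oU <-]; rewrite setTI.
exact: (measurable_row_open oU).
Qed.

HB.instance Definition _ := isMeasurableFun.Build _ _ _ _ tuple_proj measurable_tuple_proj.

(* The Lebesgue measure of T^d is the image of that of the unit cube under the
   projection R^d -> R^d / Z^d. *)
Definition torus_measure : probability torus R :=
  distribution (cube_measure d) tuple_proj.

End torus_measurable.

Section torus_laplacian.
Variables (R : realType) (d : nat).

Definition partial (i : 'I_d) (f : 'rV[R]_d -> R) : 'rV[R]_d -> R :=
  'D_(delta_mx 0 i) f.

Definition iter_partial (s : seq 'I_d) (f : 'rV[R]_d -> R) : 'rV[R]_d -> R :=
  foldr partial f s.

(* C^infinity functions: every iterated partial derivative exists and is
   continuous. *)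
Definition smooth (f : 'rV[R]_d -> R) : Prop :=
  forall s : seq 'I_d, continuous (iter_partial s f) /\
    forall i x, derivable (iter_partial s f) x (delta_mx 0 i).

Definition laplacian (f : 'rV[R]_d -> R) (x : 'rV[R]_d) : R :=
  \sum_(i < d) partial i (partial i f) x.

Definition lift_Re (phi : torus R d -> R[i]) (x : 'rV[R]_d) : R :=
  complex.Re (phi (torus_proj x)).
Definition lift_Im (phi : torus R d -> R[i]) (x : 'rV[R]_d) : R :=
  complex.Im (phi (torus_proj x)).

Definition torus_smooth (phi : torus R d -> R[i]) : Prop :=
  smooth (lift_Re phi) /\ smooth (lift_Im phi).

(* The laplacian of a Z^d-periodic function is Z^d-periodic, so its value at
   the chosen representative of y does not depend on that choice. *)
Definition torus_laplacian (phi : torus R d -> R[i]) (y : torus R d) : R[i] :=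
  laplacian (lift_Re phi) (repr y) +i* laplacian (lift_Im phi) (repr y).

End torus_laplacian.

Notation L2_torus R d := (L2 (torus_measure R d)).

Section schrodinger.
Context {R : realType} {d : nat}.
Local Notation E := (L2_torus R d).
Local Notation leb := (@lebesgue_measure R).

Definition ae_represents (v : E) (phi : torus R d -> R[i]) : Prop :=
  {ae torus_measure R d, forall x, v x = phi x}.

(* The U t are isometric, and surjective by the group law, hence unitary. *)
Definition unitary_group (U : R -> bop E) : Prop :=
  [/\ forall v, U 0 v = v,
      forall s t v, U (s + t) v = U s (U t v),
      forall t v, `|U t v| = `|v|
    & forall v, continuous (fun t => U t v)].

(* The generator of U extends i * laplacian on C^infinity(T^d). As the laplacian
   is essentially self-adjoint on C^infinity(T^d), this determines U uniquely,
   and the generator is then i * laplacian with its full domain H^2(T^d). *)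
Definition generated_by_i_laplacian (U : R -> bop E) : Prop :=
  forall phi, torus_smooth phi ->
  forall v w : E, ae_represents v phi -> ae_represents w (torus_laplacian phi) ->
  (h^-1)%:C *: (U h v - v) @[h --> 0^'] --> 'i%C *: w.

Definition schrodinger_group (U : R -> bop E) : Prop :=
  unitary_group U /\ generated_by_i_laplacian U.

(* v(t) = U(t) v0 + (1/i) \int_0^t U(t-s) (- V(s) v(s)) ds for all real t. *)
Definition duhamel_solution (U V : R -> bop E) (v0 : E) (v : R -> E) : Prop :=
  continuous v /\
  forall t : R, exists2 w : E,
    has_oriented_integral 0 t (fun s => U (t - s) (- V s (v s))) w &
    v t = U t v0 + 'i%C^-1 *: w.

End schrodinger.

Definition bounded_seq (R : realType) (X : normedModType R[i]) (v : nat -> X) :=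
  exists M : R, forall n, rnorm (v n) <= M.

Section spacetime.
Context {R : realType} (d : nat) (T : R).
Local Notation GR := (measurableTypeR R).

(* dt dx on (0,T) x T^d, as a measure on R x T^d that ignores the complement of
   (0,T) x T^d. *)
Definition spacetime_measure : {measure set (GR * torus R d) -> \bar R} :=
  (mrestr (@lebesgue_measure R) (measurable_itv `]0%R, T[) \x torus_measure R d)%E.

Definition slab : set (R * torus R d) := `]0, T[ `*` [set: torus R d].

(* Continuous functions with compact support in (0,T) x T^d, extended by 0. *)
Definition test_function (phi : R * torus R d -> R) : Prop :=
  continuous phi /\
  exists K, [/\ compact K, K `<=` slab & forall z, ~ K z -> phi z = 0].

(* A Radon measure on (0,T) x T^d, extended by 0 to R x T^d. On this locally
   compact, sigma-compact metrizable space, finiteness on compact sets implies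
   the regularity of Borel measures. *)
Definition radon_on_slab (nu : {measure set (GR * torus R d) -> \bar R}) : Prop :=
  nu (~` slab) = 0%E /\ forall K, compact K -> K `<=` slab -> (nu K < +oo)%E.

(* The integral of phi against the measure |w(t,x)|^2 dt dx. *)
Definition density_test (w : L2 spacetime_measure) (phi : R * torus R d -> R) :=
  (\int[spacetime_measure]_z (phi z * normc (w z) ^+ 2)%:E)%E.

Definition weak_star_limit (w : nat -> L2 spacetime_measure)
    (nu : {measure set (GR * torus R d) -> \bar R}) : Prop :=
  exists2 s : nat -> nat, {homo s : m n / (m < n)%N} &
    forall phi, test_function phi ->
      density_test (w (s k)) phi @[k --> \oo] --> (\int[nu]_z (phi z)%:E)%E.

Definition AC_property (w : nat -> L2 spacetime_measure) : Prop :=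
  bounded_seq w /\
  forall nu : {measure set (GR * torus R d) -> \bar R},
    radon_on_slab nu -> weak_star_limit w nu -> nu `<< spacetime_measure.

(* w is the element of L^2((0,T) x T^d) defined by the curve v : R -> L^2(T^d).
   It is unique by Fubini's theorem. *)
Definition spacetime_class (v : R -> L2_torus R d) (w : L2 spacetime_measure) : Prop :=
  {ae @lebesgue_measure R, forall t, t \in `]0, T[ ->
    {ae torus_measure R d, forall x, w (t, x) = v t x}}.

End spacetime.

(* Main.v *)
(** The free flow multiplies the character of frequency k by exp(-4 pi^2 i t |k|^2) and,
    by Duhamel's formula and Gronwall's lemma, a bounded sequence of solutions stays
    uniformly close to free waves on each of finitely many short time intervals. For a
    null set A and a limit measure nu it is therefore enough to find, for each e > 0, a
    trigonometric polynomial 0 <= Q <= 1 that is e-close to 1 on A in L^1(nu) and such that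
    the integral of Q |w|^2 is at most e times the mass of w, for all free waves w.

    As trigonometric polynomials with values in [0, 1] approximate the indicator of A in
    L^1 of nu plus Lebesgue measure, Q can be taken with small mean. Expanding |w|^2, two
    frequencies k and l interact through a given Q only if the points (k, |k|^2) and
    (l, |l|^2) of the paraboloid are at bounded distance; a connected component of this
    relation whose differences span W has boundedly many points in each translate of W,
    because along a path of such steps the products k.x, for short x spanning W, stay
    bounded. By induction on the dimension, a product Q0 Q' works: Q0 decouples the
    components and handles those of smaller rank, while the others contain boundedly many
    frequencies and are handled by a Q' of small mean. *)

From HB Require Import structures.
From mathcomp Require Import all_boot all_order all_algebra generic_quotient.
From mathcomp Require Import complex finmap.
From mathcomp Require Import all_classical all_reals all_analysis.
From mathcomp Require Import measurable_realfun.
From mathcomp Require Import zify ring lra.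
Require Import Defs.

Set Implicit Arguments.
Unset Strict Implicit.
Unset Printing Implicit Defensive.
Import Order.TTheory GRing.Theory Num.Theory.
Import numFieldNormedType.Exports.
Local Open Scope classical_set_scope.
Local Open Scope ring_scope.

(** * Clusters of lattice points on the paraboloid *)

Section clusters.
Variable d : nat.
Implicit Types k l : 'rV[int]_d.

(** A weak-* limit is tested against continuous functions only, and a Lebesgue-null set may be
    dense. Its indicator is therefore replaced by a continuous weight [Q], at a price measured in
    [nu]; this is why approximation takes place in L^1 of [nu] and of Lebesgue measure at once. Of
    [V] only the norm is used, so solutions resemble free waves on short intervals only. The number
    of these intervals is fixed by the admissible error before [Q] is chosen, so that this number
    times the energy of one free wave can still be made small. A weight of small mean controls a
    wave with N frequencies up to a factor N, but the number of frequencies is unbounded. Clusters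
    remove this obstacle, since the energies of distinct clusters add without loss. They depend on
    the frequencies of the weight itself, hence no single weight does: its factors are chosen one
    after the other, one more for each dimension. Time is made periodic too, with a multiple of the
    period of the free flow that is at least T. *)

Definition dotz k l : int := \sum_i k 0 i * l 0 i.
(** Integrality of the frequencies makes bounded scalar products finite in number; spans and
    dimensions are taken over the rationals. *)
Definition ratv k : 'rV[rat]_d := map_mx intr k.
Definition dotq (x y : 'rV[rat]_d) : rat := \sum_i x 0 i * y 0 i.

Lemma ratvB k l : ratv (k - l) = ratv k - ratv l.
Proof. by apply/matrixP => i j; rewrite !mxE rmorphB. Qed.

Lemma dotqE k l : dotq (ratv k) (ratv l) = (dotz k l)%:~R.
Proof.
by rewrite /dotq /dotz rmorph_sum/=; apply: eq_bigr => i _; rewrite !mxE rmorphM.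
Qed.

Lemma dotqBl x y z : dotq (x - y) z = dotq x z - dotq y z.
Proof.
by rewrite /dotq -sumrB; apply: eq_bigr => i _; rewrite !mxE mulrBl.
Qed.

Lemma dotq_eq0 x : dotq x x = 0 -> x = 0.
Proof.
move=> x0; apply/rowP => i; rewrite mxE; apply/eqP; rewrite -sqrf_eq0 expr2.
apply: contraTT isT => xi; move/eqP: x0; rewrite /dotq (bigD1 i)//= gt_eqF//.
rewrite ltr_wpDr//.
  by apply: sumr_ge0 => j _; rewrite -expr2 sqr_ge0.
by rewrite lt_def xi -expr2 sqr_ge0.
Qed.

Lemma dotq_span x (s : seq 'rV[rat]_d) : (forall y, y \in s -> dotq x y = 0) ->
  forall y, y \in << s>>%VS -> dotq x y = 0.
Proof.
elim: s => [_ y|z s IH xs y].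
  rewrite span_nil memv0 => /eqP ->.
  by rewrite /dotq big1// => i _; rewrite mxE mulr0.
rewrite span_cons => /memv_addP[_ /vlineP[a ->]] [w ws ->].
have xw := IH (fun y ys => xs y (mem_behead (s := z :: s) ys)) w ws.
have xz : dotq x z = 0 by apply: xs; rewrite mem_head.
rewrite /dotq (eq_bigr (fun i => a * (x 0 i * z 0 i) + x 0 i * w 0 i)).
  by rewrite big_split/= -mulr_sumr -/(dotq x z) -/(dotq x w) xz xw mulr0 addr0.
by move=> i _; rewrite !mxE; ring.
Qed.

(* [near M k l]: the points [(k, |k|^2)] and [(l, |l|^2)] of the paraboloid are
   at distance at most [M]. *)
Definition near (M : nat) k l : Prop :=
  (forall i, `|k 0 i - l 0 i| <= M%:Z) /\ `|dotz k k - dotz l l| <= M%:Z.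

Lemma near_path (M : nat) (I : finType) (kappa : I -> 'rV[int]_d) (e : rel I) :
  (forall i j, e i j -> near M (kappa i) (kappa j)) ->
  forall p i, path e i p -> near (size p * M)%N (kappa i) (kappa (last i p)).
Proof.
move=> eM; elim=> [i _|j p IH i /=].
  by split=> [a|] /=; rewrite subrr normr0 mul0n.
move=> /andP[/eM[ij1 ij2] /IH[jp1 jp2]]; split => [a|].
  move: (ij1 a) (jp1 a); set x := _ - _; set y := _ - _.
  by rewrite (_ : _ - _ = x + y) ?/x ?/y//; lia.
by move: ij2 jp2; lia.
Qed.

(** The direction space of the affine hull of [kappa i] and of the points indexed by [s]. *)
Definition spread (I : finType) (kappa : I -> 'rV[int]_d) (i : I) (s : seq I) :=
  <<[seq ratv (kappa j - kappa i) | j <- s]>>%VS.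

Lemma spreadS (I : finType) (kappa : I -> 'rV[int]_d) (i : I) (s t : seq I) :
  {subset s <= t} -> (spread kappa i s <= spread kappa i t)%VS.
Proof. move=> st; apply: sub_span => x /mapP[j js ->].
by apply: (map_f (fun j => ratv (kappa j - kappa i))); exact: st. Qed.

Lemma mem_spread (I : finType) (kappa : I -> 'rV[int]_d) (i j : I) (s : seq I) :
  j \in s -> ratv (kappa j - kappa i) \in spread kappa i s.
Proof. by move=> js; apply: memv_span; apply/mapP; exists j. Qed.

Lemma spread_base (I : finType) (kappa : I -> 'rV[int]_d) (i j : I) (s : seq I) :
  i \in s -> (spread kappa i s <= spread kappa j s)%VS.
Proof.
move=> is_; apply/span_subvP => _ /mapP[l ls ->].
have -> : kappa l - kappa i = (kappa l - kappa j) - (kappa i - kappa j).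
  by rewrite opprB addrA subrK.
by rewrite ratvB rpredB// mem_spread.
Qed.

(** * Bounds on paths and on points of a component *)

Section bounds.
Variable M : nat.

(** [e] is only required to imply [near M], so that it may be restricted to the vertices of a path;
    the bounds below are uniform over all such graphs. *)
Definition cluster_graph (I : finType) (kappa : I -> 'rV[int]_d) (e : rel I) :=
  [/\ injective kappa, symmetric e & forall i j, e i j -> near M (kappa i) (kappa j)].

Definition component_spread (I : finType) (kappa : I -> 'rV[int]_d) (e : rel I) i :=
  spread kappa i (enum (connect e i)).

Definition short_paths (r N : nat) : Prop :=
  forall (I : finType) (kappa : I -> 'rV[int]_d) (e : rel I),
    cluster_graph kappa e -> forall i p, path e i p -> uniq (i :: p) ->
    (\dim (spread kappa i p) < r)%N -> (size p < N)%N.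

(** The component must span exactly [W]: a coset of [W] can contain arbitrarily many points whose
    component spans less, isolated points for instance. *)
Definition few_points (r N : nat) : Prop :=
  forall (I : finType) (kappa : I -> 'rV[int]_d) (e : rel I),
    cluster_graph kappa e -> forall k (W : {vspace 'rV[rat]_d}), (\dim W <= r)%N ->
    (#|[set i | (ratv (kappa i - k) \in W) && (component_spread kappa e i == W)]%SET| <= N)%N.

(** Either every point of the component is within [N] steps of [i], or some simple path is longer
    than [N]. In the latter case its first [N] points cannot span fewer than [r] dimensions, hence
    already span what the component spans. *)
Lemma short_paths_spread r N : short_paths r N ->
  forall (I : finType) (kappa : I -> 'rV[int]_d) (e : rel I),
  cluster_graph kappa e -> forall i, (\dim (component_spread kappa e i) <= r)%N ->
  exists2 s : seq I,
    (forall j, j \in s -> exists p, [/\ path e i p, last i p = j & (size p <= N)%N]) &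
    spread kappa i s = component_spread kappa e i.
Proof.
move=> rN I kappa e G i dr.
have [/forallP short|] := boolP [forall j in connect e i,
   [exists n : 'I_N.+1, [exists p : n.-tuple I, path e i p && (last i p == j)]]].
  exists (enum (connect e i)) => // j.
  rewrite mem_enum => /(implyP (short j))/existsP[n /existsP[p /andP[ep /eqP pj]]].
  by exists p; split=> //; rewrite size_tuple -ltnS.
rewrite negb_forall => /existsP[j]; rewrite negb_imply => /andP[ij long].
have /connectP[p0 ep0 jp0] := ij; move: jp0.
case: (shortenP ep0) => p ep up _ jp.
have Np : (N < size p)%N.
  rewrite ltnNge; apply: contra long => pN; apply/existsP.
  exists (Ordinal (n := N.+1) (m := size p) pN); apply/existsP; exists (in_tuple p).
  by rewrite ep -jp eqxx.
have etp : path e i (take N p) by move: ep; rewrite -{1}(cat_take_drop N p) cat_path => /andP[].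
have utp : uniq (i :: take N p) by apply: subseq_uniq up; rewrite /= eqxx take_subseq.
exists (take N p) => [l lp|].
  exists (take (index l (take N p)).+1 (take N p)); split.
  - by move: etp; rewrite -{1}(cat_take_drop (index l (take N p)).+1 (take N p)) cat_path => /andP[].
  - rewrite (last_nth i) size_takel; last by rewrite index_mem.
    by rewrite /= nth_take// nth_index.
  - rewrite size_takel ?index_mem//; move: lp; rewrite -index_mem size_takel//.
    exact: ltnW.
apply/eqP; rewrite eqEdim; apply/andP; split.
  apply: spreadS => l lp; rewrite mem_enum; apply/connectP.
  exists (take (index l (take N p)).+1 (take N p)).
    by move: etp; rewrite -{1}(cat_take_drop (index l (take N p)).+1 (take N p)) cat_path => /andP[].
  rewrite (last_nth i) size_takel; last by rewrite index_mem.
  by rewrite /= nth_take// nth_index.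
apply: (leq_trans dr); rewrite leqNgt; apply/negP => lt_r.
by have := rN I kappa e G i _ etp utp lt_r; rewrite size_takel ?ltnn// ltnW.
Qed.

(* A point of W + k is determined by its scalar products with a spanning family
   of W; those with short vectors joining it to its neighbours are bounded. *)
Lemma short_paths_few_points r N : short_paths r N -> exists N', few_points r N'.
Proof.
(* [N] steps move each coordinate by at most [Rr], and [B] bounds the scalar product of a point with
   such a displacement. The code [f i] records the products with all short vectors of [W], shifted
   by [B] to be natural numbers. *)
move=> rN; pose Rr := (N * M)%N; pose B := (Rr + d * Rr ^ 2)%N.
pose vec (u : {ffun 'I_d -> 'I_(Rr + Rr).+1}) : 'rV[int]_d := \row_i ((u i)%:Z - Rr%:Z).
exists #|{ffun {ffun 'I_d -> 'I_(Rr + Rr).+1} -> option 'I_(B + B).+1}|.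
move=> I kappa e G k W dW; set A := [set i | _]%SET.
pose f i : {ffun {ffun 'I_d -> 'I_(Rr + Rr).+1} -> option 'I_(B + B).+1} :=
  [ffun u => if (ratv (vec u) \in W) && (`|dotz (kappa i) (vec u)| <= B%:Z)
             then Some (inord (absz (dotz (kappa i) (vec u) + B%:Z))) else None].
suff fA : {in A &, injective f} by rewrite -(card_in_imset fA) max_card.
move=> i j; rewrite !inE => /andP[iW /eqP ci] /andP[jW /eqP cj] fij.
have [kI esym eM] := G; apply: kI; apply/eqP; rewrite -subr_eq0; apply/eqP.
suff : ratv (kappa i - kappa j) = 0.
  move=> /matrixP r0; apply/matrixP => a b; have := r0 a b.
  by rewrite !mxE => /eqP; rewrite intr_eq0 => /eqP.
have ijW : ratv (kappa i - kappa j) \in W.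
  rewrite (_ : _ - _ = (kappa i - k) - (kappa j - k)); last by rewrite opprB addrA subrK.
  by rewrite ratvB rpredB.
have dr : (\dim (component_spread kappa e i) <= r)%N by rewrite ci.
(* The difference lies in [W], so it vanishes as soon as it is orthogonal to the short vectors that
   span [W]. *)
have [s short ss] := short_paths_spread rN G dr.
apply: dotq_eq0; move: (ijW); rewrite -{1}ci -ss => /dotq_span; apply.
move=> _ /mapP[l ls ->].
have lW : ratv (kappa l - kappa i) \in W by rewrite -ci -ss mem_spread.
have [p [ep pl pN]] := short l ls.
have [n1 n2] := near_path eM ep; rewrite pl in n1 n2.
have pR : (size p * M)%:Z <= Rr%:Z by rewrite lez_nat leq_mul2r pN orbT.
have k1 a : `|(kappa l - kappa i) 0 a| <= Rr%:Z.
  by rewrite !mxE distrC (le_trans (n1 a)).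
pose u : {ffun 'I_d -> 'I_(Rr + Rr).+1} :=
  [ffun a => inord (absz ((kappa l - kappa i) 0 a + Rr%:Z))].
have vu : vec u = kappa l - kappa i.
  apply/rowP => a; rewrite [LHS]mxE ffunE inordK; last by have := k1 a; lia.
  by have := k1 a; set z := _ 0 a; lia.
have sl : `|dotz (kappa l - kappa i) (kappa l - kappa i)| <= (d * Rr ^ 2)%:Z.
  rewrite /dotz (le_trans (ler_norm_sum _ _ _))//.
  rewrite (le_trans (ler_sum (G := fun=> (Rr ^ 2)%:Z) _ _))//.
    by move=> a _; rewrite normrM expnS expn1 PoszM ler_pM.
  by rewrite sumr_const card_ord -mulr_natl natz PoszM.
(* Polarisation: along the path |k|^2 changes by a bounded amount, which bounds k.x although k
   itself is unbounded. *)
have dl : 2 * dotz (kappa i) (kappa l - kappa i) =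
    dotz (kappa l) (kappa l) - dotz (kappa i) (kappa i) -
    dotz (kappa l - kappa i) (kappa l - kappa i).
  rewrite /dotz mulr_sumr -!sumrB; apply: eq_bigr => a _; rewrite !mxE; ring.
have bi : `|dotz (kappa i) (kappa l - kappa i)| <= B%:Z.
  by move: n2 sl pR dl; rewrite /B; lia.
have := congr1 (fun g : {ffun _ -> _} => g u) fij.
rewrite !ffunE vu lW bi/=; case: ifP => // bj [].
move=> /(congr1 val); rewrite /= !inordK; [|by move: bj; lia|by move: bi; lia].
move=> eq_ij; rewrite ratvB dotqBl !dotqE; apply/eqP; rewrite subr_eq0 eqr_int.
by apply/eqP; move: eq_ij bi bj; lia.
Qed.

(** Once the edges are restricted to the vertices of the path, these form one component spanning
    exactly [spread kappa i p], so its [size p + 1] distinct points are among those that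
    [few_points] counts. *)
Lemma few_points_short_paths r N : few_points r N -> short_paths r.+1 N.
Proof.
move=> rN I kappa e [kI esym eM] i p ep up; rewrite ltnS => dp.
pose e' : rel I := fun x y => [&& x \in i :: p, y \in i :: p & e x y].
have e'sym : symmetric e' by move=> x y; rewrite /e' esym andbCA.
have G' : cluster_graph kappa e' by split=> // x y /and3P[_ _ /eM].
have ep' : path e' i p.
  apply: (@sub_in_path _ (mem (i :: p)) e e') ep; last exact/allP.
  by move=> x y xp yp exy; rewrite /e' exy; apply/and3P.
have conn x : x \in i :: p -> connect e' x =i i :: p.
  move=> xp y.
  have cx z : z \in i :: p -> connect e' i z.
    exact: (path_connect ep').
  apply/idP/idP => [/connectP[[_ ->//|y' q]]|yp].
    elim: q x y' xp => [|y'' q IH] x y' xp /=.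
      by rewrite andbT => /and3P[_ yp _] ->.
    by move=> /andP[/and3P[_ yp _] eq] yE; apply: (IH y' y'').
  by apply: (connect_trans (y := i)) (cx y yp); rewrite (sym_connect_sym e'sym) cx.
rewrite ltnNge; apply/negP => Np; move: (rN I kappa e' G' (kappa i) (spread kappa i p) dp).
rewrite leqNgt => /negP; apply.
apply: (leq_ltn_trans Np).
rewrite -[(size p).+1]/(size (i :: p)) -(card_uniqP up) subset_leq_card//.
apply/fintype.subsetP => x xp; rewrite inE; apply/andP; split.
  move: xp; rewrite inE => /predU1P[->|xp].
    by rewrite subrr (_ : ratv 0 = 0) ?mem0v//; apply/matrixP => a b; rewrite !mxE.
  by rewrite mem_spread.
have ip : (spread kappa i (i :: p) <= spread kappa i p)%VS.
  apply/span_subvP => _ /mapP[y + ->]; rewrite inE => /predU1P[->|yp].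
    by rewrite subrr (_ : ratv 0 = 0) ?mem0v//; apply/matrixP => a b; rewrite !mxE.
  by rewrite mem_spread.
have ec : {subset i :: p <= enum (connect e' x)} /\ {subset enum (connect e' x) <= i :: p}.
  by split=> y; rewrite mem_enum conn.
have [s1 s2] := ec; rewrite /component_spread eqEsubv; apply/andP; split.
  apply: subv_trans (spreadS kappa x s2) (subv_trans _ ip).
  exact: spread_base.
apply: (@subv_trans _ _ (spread kappa i (i :: p))).
  by apply: spreadS => y yp; rewrite inE yp orbT.
apply: subv_trans (spread_base _ _ _) (spreadS kappa x s1).
by rewrite mem_head.
Qed.

(** The two implications alternate, one dimension at a time, from [short_paths 0 0], which is
    vacuous because no dimension is below 0. *)
Theorem cluster_bound r : exists N, few_points r N.
Proof.
elim: r => [|r [N rN]]; first by apply: (@short_paths_few_points 0 0).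
exact: short_paths_few_points (few_points_short_paths rN).
Qed.
End bounds.
End clusters.

(** * Indicator functions as limits of powers *)

Lemma bernoulli_ineq {R : realFieldType} (x : R) n : -1 <= x -> 1 + x *+ n <= (1 + x) ^+ n.
Proof.
move=> x1; elim: n => [|n IH]; first by rewrite mulr0n addr0 expr0.
rewrite exprS; apply: (@le_trans _ _ ((1 + x) * (1 + x *+ n))).
  rewrite -[x *+ n.+1]mulr_natl -[x *+ n]mulr_natl -natr1.
  have : 0 <= n%:R * x ^+ 2 by rewrite mulr_ge0 ?sqr_ge0.
  by rewrite expr2; nra.
by rewrite ler_wpM2l//; lra.
Qed.

(** With w the square root of z, n z^n is w^n times n w^n, and Bernoulli's inequality for 1/w = 1 +
    h bounds n w^n by 1/h. *)
Lemma cvg_expr_natr {R : realType} (z : R) : 0 <= z < 1 ->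
  z ^+ n *+ n @[n --> \oo] --> 0.
Proof.
move=> /andP[z0 z1]; pose w := Num.sqrt z.
have w0 : 0 <= w by exact: sqrtr_ge0.
have w1 : w < 1 by rewrite -[ltRHS]sqrtr1 ltr_sqrt.
have wz n : z ^+ n = w ^+ n * w ^+ n by rewrite -exprMn -expr2 sqr_sqrtr.
have [w00|wp] := eqVneq w 0.
  have z00 : z = 0 by rewrite -(sqr_sqrtr z0) -/w w00 expr0n.
  rewrite z00 (_ : (fun n => _) = cst 0); first exact: cvg_cst.
  by apply/funext => -[|n]; rewrite ?mulr0n// expr0n mul0rn.
have wgt0 : 0 < w by rewrite lt_neqAle eq_sym wp.
pose h := w^-1 - 1.
have h0 : 0 < h by rewrite subr_gt0 invf_gt1.
have nw n : w ^+ n *+ n <= h^-1.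
  rewrite -[leRHS]mul1r ler_pdivlMr// mulrnAl -mulrnAr.
  rewrite -ler_pdivlMl ?exprn_gt0// mulr1 -exprVn.
  have := @bernoulli_ineq _ h n; rewrite (_ : 1 + h = w^-1) /h; last by ring.
  have {}h0 : 0 < w^-1 - 1 by [].
  move: (w^-1) h0 => v {}h0 /(_ ltac:(lra)); have := mulrn_wge0 n (ltW h0).
  by move: (_ *+ n) => a; lra.
apply: (@squeeze_cvgr _ _ _ _ (cst 0) (fun n => h^-1 * w ^+ n)).
- apply: nearW => n; rewrite mulrn_wge0 ?exprn_ge0//=.
  by rewrite wz -mulrnAl ler_wpM2r ?exprn_ge0.
- exact: cvg_cst.
- rewrite -[X in _ --> X](mulr0 h^-1); apply: cvgM; first exact: cvg_cst.
  by apply: cvg_expr; rewrite ger0_norm.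
Qed.

(* Powers of powers turn a threshold at 1/2 into an indicator function. *)
Lemma cvg_threshold {R : realType} (y : R) : 0 <= y <= 1 ->
  (1 - y ^+ n) ^+ (n * 2 ^ n) @[n --> \oo] --> ((y < 2^-1)%R%:R : R).
Proof.
move=> /andP[y0 y1]; have yn n : 0 <= y ^+ n <= 1 by rewrite exprn_ge0// exprn_ile1.
have [y2|y2] := ltP y 2^-1.
  (* Below 1/2, Bernoulli's inequality gives the lower bound 1 - n (2y)^n. *)
  apply: (@squeeze_cvgr _ _ _ _ (fun n => 1 - (2 * y) ^+ n *+ n) (cst 1)).
  - apply: nearW => n; have /andP[yn0 yn1] := yn n; apply/andP; split; last first.
      by apply: exprn_ile1; lra.
    have := @bernoulli_ineq _ (- y ^+ n) (n * 2 ^ n)%N; rewrite lerN2 => /(_ yn1).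
    by apply: le_trans; rewrite exprMn mulNrn lerD2l lerN2 -natrX mulr_natl -mulrnA mulnC.
  - rewrite -[X in _ --> X]subr0; apply: cvgB; first exact: cvg_cst.
    by apply: cvg_expr_natr; lra.
  - exact: cvg_cst.
(* From 1/2 on, (1 - y^n)^m (1 + y^n)^m <= 1 for m = n 2^n, while (1 + y^n)^m >= 1 + m y^n >= 1 +
   n. *)
apply: (@squeeze_cvgr _ _ _ _ (cst 0) harmonic).
- apply: nearW => n; have /andP[yn0 yn1] := yn n; apply/andP; split.
    by apply: exprn_ge0; lra.
  set m := (n * 2 ^ n)%N.
  have ny : n%:R <= y ^+ n *+ m.
    rewrite /m mulnC mulrnA -[_ *+ 2 ^ n]mulr_natl natrX -exprMn.
    by rewrite lerMn2r exprn_ege1 ?orbT//; lra.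
  have b := @bernoulli_ineq _ (y ^+ n) m; have {}b := b ltac:(lra).
  have p0 : 0 < (1 + y ^+ n) ^+ m by rewrite exprn_gt0//; lra.
  rewrite /= -[leRHS]mul1r ler_pdivlMr ?ltr0n// -natr1.
  apply: (@le_trans _ _ ((1 - y ^+ n) ^+ m * (1 + y ^+ n) ^+ m)).
    by apply: ler_wpM2l; [apply: exprn_ge0; lra|lra].
  by rewrite -exprMn exprn_ile1//; nra.
- exact: cvg_cst.
- exact: cvg_harmonic.
Qed.

(** * Sets whose indicator is an L^1 limit of weights *)

Section approximation.
Context {dd : measure_display} {T : measurableType dd} {R : realType}.
Variable (mu : {finite_measure set T -> \bar R}) (Q : set (T -> R)).
Hypothesis Qm : forall q, Q q -> measurable_fun [set: T] q.
Hypothesis Q01 : forall q, Q q -> forall x, 0 <= q x <= 1.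
Hypothesis Q1 : Q (cst 1).
Hypothesis QB : forall q, Q q -> Q (fun x => 1 - q x).
Hypothesis QM : forall q p, Q q -> Q p -> Q (fun x => q x * p x).

(** The L^1 closure of [Q] among functions with values in [0, 1]; this range makes multiplication
    continuous for the L^1 distance. *)
Definition L1_approx (f : T -> R) : Prop :=
  [/\ measurable_fun [set: T] f, forall x, 0 <= f x <= 1 &
   forall e : R, 0 < e -> exists2 q, Q q & (\int[mu]_x `|q x - f x|%:E < e%:E)%E].

Lemma L1_approxW q : Q q -> L1_approx q.
Proof.
move=> Qq; split; [exact: Qm|exact: Q01|move=> e e0; exists q => //].
under eq_integral do rewrite subrr normr0.
by rewrite integral0 lte_fin.
Qed.

Let mnorm (f g : T -> R) : measurable_fun [set: T] f -> measurable_fun [set: T] g ->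
  measurable_fun [set: T] (fun x => `|f x - g x|%:E).
Proof.
by move=> mf mg; apply/measurable_EFinP; apply: measurableT_comp => //; exact: measurable_funB.
Qed.

Lemma le_L1_dist (f g h : T -> R) : measurable_fun [set: T] f ->
  measurable_fun [set: T] g -> measurable_fun [set: T] h ->
  (\int[mu]_x `|f x - h x|%:E <= \int[mu]_x `|f x - g x|%:E + \int[mu]_x `|g x - h x|%:E)%E.
Proof.
move=> mf mg mh; rewrite -ge0_integralD//; [|exact: mnorm|exact: mnorm].
apply: ge0_le_integral => //; first exact: mnorm.
  by apply: emeasurable_funD; apply: mnorm.
by move=> x _; rewrite -EFinD lee_fin -(subrKA (g x)) ler_normD.
Qed.

Lemma L1_approx_norm (f : T -> R) : measurable_fun [set: T] f -> (forall x, 0 <= f x <= 1) ->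
  (forall e : R, 0 < e -> exists2 g, L1_approx g & (\int[mu]_x `|g x - f x|%:E < e%:E)%E) ->
  L1_approx f.
Proof.
move=> mf f01 H; split => // e e0; have e2 : 0 < e / 2 by rewrite divr_gt0.
have [g [mg g01 /(_ _ e2)[q Qq qg]] gf] := H _ e2.
exists q => //; apply: le_lt_trans (le_L1_dist (Qm Qq) mg mf) _.
by rewrite (splitr e) EFinD lteD.
Qed.

(** Dominated convergence: the constant 1 is an integrable bound because [mu] is finite. *)
Lemma L1_approx_lim (f_ : (T -> R)^nat) (f : T -> R) : (forall n, L1_approx (f_ n)) ->
  (forall x, f_ n x @[n --> \oo] --> f x) -> L1_approx f.
Proof.
move=> fn ff.
have mfn n : measurable_fun [set: T] (f_ n) by case: (fn n).
have fn01 n x : 0 <= f_ n x <= 1 by case: (fn n).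
have mf : measurable_fun [set: T] f by apply: measurable_fun_cvg => // x _; exact: ff.
have f01 x : 0 <= f x <= 1.
  apply/andP; split.
    by apply: (cvgr_to_ge (ff x)); apply: nearW => n; have /andP[] := fn01 n x.
  by apply: (cvgr_to_le (ff x)); apply: nearW => n; have /andP[] := fn01 n x.
apply: L1_approx_norm => // e e0.
have i1 : mu.-integrable [set: T] (EFin \o cst (1 : R)).
  exact: finite_measure_integrable_cst.
have [|||||_ + _] := @dominated_convergence _ T R mu [set: T] measurableT
  (fun n x => (f_ n x)%:E) (EFin \o f) (EFin \o cst 1).
- by move=> n; apply/measurable_EFinP.
- exact/measurable_EFinP.
- by apply: aeW => x _; apply: cvg_EFin; [exact: nearW|exact: ff].
- by [].
- by apply: aeW => x n _ /=; rewrite lee_fin; have /andP[? ?] := fn01 n x; rewrite ger0_norm.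
move=> /fine_cvgP[fin /cvgrPdist_lt/(_ _ e0) lim].
near \oo => n; exists (f_ n) => //.
have fn_ : (\int[mu]_x `|(f_ n x)%:E - (EFin \o f) x|)%E \is a fin_num by near: n.
rewrite (_ : (fun x => _) = (fun x => `|(f_ n x)%:E - (EFin \o f) x|%E))//.
rewrite -(fineK fn_) lte_fin.
have : `|0 - (fine \o [sequence (\int[mu]_x `|(f_ n x)%:E - (EFin \o f) x|)%E]_n) n| < e.
  by near: n.
by rewrite sub0r normrN /= ger0_norm// fine_ge0// integral_ge0.
Unshelve. all: by end_near. Qed.

Lemma L1_approxB f : L1_approx f -> L1_approx (fun x => 1 - f x).
Proof.
move=> [mf f01 fe]; split => [|x|e /fe[q Qq qf]].
- exact: measurable_funB.
- by have := f01 x; lra.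
exists (fun x => 1 - q x); first exact: QB.
by under eq_integral do rewrite opprB addrC subrKA distrC.
Qed.

Lemma L1_approxM f g : L1_approx f -> L1_approx g -> L1_approx (fun x => f x * g x).
Proof.
move=> [mf f01 fe] [mg g01 ge].
split => [|x|e e0].
- exact: measurable_funM.
- by have := f01 x; have := g01 x; nra.
have e2 : 0 < e / 2 by rewrite divr_gt0.
have [q Qq qf] := fe _ e2; have [p Qp pg] := ge _ e2.
exists (fun x => q x * p x); first exact: QM.
apply: (@le_lt_trans _ _ (\int[mu]_x `|q x - f x|%:E + \int[mu]_x `|p x - g x|%:E)%E).
  have mq := Qm Qq; have mp := Qm Qp.
  rewrite -ge0_integralD//; [|exact: mnorm|exact: mnorm].
  apply: ge0_le_integral => //.
  - by apply: mnorm; apply: measurable_funM.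
  - by apply: emeasurable_funD; apply: mnorm.
  move=> x _; rewrite -EFinD lee_fin.
  have -> : q x * p x - f x * g x = (q x - f x) * p x + f x * (p x - g x) by ring.
  apply: le_trans (ler_normD _ _) _; rewrite !normrM.
  have /andP[p0 p1] := Q01 Qp x; have /andP[f0 f1] := f01 x.
  rewrite (ger0_norm p0) (ger0_norm f0) lerD//.
    by rewrite ler_piMr.
  by rewrite ler_piMl.
by rewrite (splitr e) EFinD lteD.
Qed.

Definition approximable (A : set T) : Prop :=
  measurable A /\ L1_approx (fun x => (x \in A)%:R).

Lemma approximable0 : approximable set0.
Proof.
split=> //; have /L1_approxB := L1_approxW Q1.
by congr L1_approx; apply/funext => x; rewrite /= subrr in_set0.
Qed.

Lemma approximableC A : approximable A -> approximable (~` A).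
Proof.
move=> [mA /L1_approxB A1]; split; first exact: measurableC.
by move: A1; congr L1_approx; apply/funext => x; rewrite in_setC; case: (_ \in _); rewrite /= ?subr0 ?subrr.
Qed.

Lemma approximableI A B : approximable A -> approximable B -> approximable (A `&` B).
Proof.
move=> [mA A1] [mB B1]; split; first exact: measurableI.
have := L1_approxM A1 B1.
by congr L1_approx; apply/funext => x; rewrite in_setI; do 2!case: (_ \in _); rewrite /= ?mul0r ?mul1r.
Qed.

Lemma approximable_bigcup (F : (set T)^nat) : (forall n, approximable (F n)) ->
  approximable (\bigcup_n F n).
Proof.
move=> aF; pose G n := \big[setU/set0]_(i < n) F i.
have aG n : approximable (G n).
  rewrite /G; elim/big_ind: _ => [|A B aA aB|i _]; [exact: approximable0| |exact: aF].
  by rewrite -[_ `|` _]setCK setCU; apply: approximableC; apply: approximableI; exact: approximableC.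
split; first by apply: bigcup_measurable => n _; case: (aF n).
apply: (@L1_approx_lim (fun n x => (x \in G n)%:R)) => [n|x]; first by case: (aG n).
have [xF|xF] := boolP (x \in _); last first.
  rewrite (_ : (fun n => _) = cst 0); first exact: cvg_cst.
  apply/funext => n /=; rewrite memNset//= /G -bigcup_mkord => -[i _ Fi].
  by move/negP: xF; apply; rewrite inE; exists i.
move: xF; rewrite inE => -[i _ Fi]; apply: (@cvg_near_cst).
exists i.+1 => //= n /= ni; rewrite mem_set//= /G -bigcup_mkord.
by exists i.
Qed.

(** [Q] is stable under powers and complements, so the functions of [cvg_threshold] are themselves
    weights, and they converge to the indicator. *)
Lemma approximable_lt q : Q q -> approximable [set x | q x < 2^-1].
Proof.
move=> Qq; have mq := Qm Qq.
have -> : [set x | q x < 2^-1] = q @^-1` `]-oo, 2^-1[.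
  by apply/seteqP; split=> x /=; rewrite in_itv.
split; first by rewrite -[_ @^-1` _]setTI; exact: mq.
have QX p n : Q p -> Q (fun x => p x ^+ n).
  move=> Qp; elim: n => [|n IH]; first exact: Q1.
  by rewrite (_ : (fun x => _) = (fun x => p x * p x ^+ n));
    [exact: QM|apply/funext => x; rewrite exprS].
apply: (@L1_approx_lim (fun n x => (1 - q x ^+ n) ^+ (n * 2 ^ n))) => [n|x].
  by apply: L1_approxW; apply: (QX (fun x => 1 - q x ^+ n)); apply: QB; exact: QX.
have -> : (x \in q @^-1` `]-oo, 2^-1[) = (q x < 2^-1).
  by apply/idP/idP; rewrite inE /= in_itv.
exact: cvg_threshold (Q01 Qq x).
Qed.

Lemma approximable_ae A B : approximable A -> measurable B ->
  {ae mu, forall x, A x <-> B x} -> approximable B.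
Proof.
move=> [mA A1] mB AB; split => //; apply: L1_approx_norm.
- by apply: (@measurable_indic _ _ _ _ B).
- by move=> x; case: (_ \in _); rewrite ?lexx ?ler01.
move=> e e0; exists (fun x => (x \in A)%:R) => //.
rewrite (ae_eq_integral (cst 0%E))//.
- by rewrite integral0 lte_fin.
- by apply: mnorm; [exact: (@measurable_indic _ _ _ _ A)|exact: (@measurable_indic _ _ _ _ B)].
- apply: filterS AB => x ABx _ /=; congr EFin.
  suff -> : (x \in A) = (x \in B) by rewrite subrr normr0.
  by apply/idP/idP; rewrite !inE => /ABx.
Qed.

Lemma approximable_sigma (G : set (set T)) : (forall A, G A -> approximable A) ->
  <<s G >> `<=` approximable.
Proof.
move=> GA; apply: smallest_sub => //; split.
- exact: approximable0.
- by move=> A aA; rewrite setTD; exact: approximableC.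
- by move=> F aF; exact: approximable_bigcup.
Qed.

End approximation.

(** * Characters of the torus *)

Import Normc.
Local Open Scope complex_scope.

Lemma continuous_sumr (R : realType) (X : topologicalType) (I : Type) (r : seq I)
    (f : I -> X -> R) :
  (forall i, continuous (f i)) -> continuous (fun x => \sum_(i <- r) f i x).
Proof.
move=> cf; elim: r => [|i r IH].
  have -> : (fun x => \sum_(i <- [::]) f i x) = cst 0.
    by apply/funext => x; rewrite big_nil.
  exact: cst_continuous.
have -> : (fun x => \sum_(j <- i :: r) f j x) = (fun x => f i x + \sum_(j <- r) f j x).
  by apply/funext => x; rewrite big_cons.
by move=> x; apply: continuousD; [exact: cf|exact: IH].
Qed.

Section expi.
Context {R : realType}.
Implicit Types (x y : R) (w z : R[i]).

Definition expi x : R[i] := cos x +i* sin x.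

Lemma expiD x y : expi (x + y) = expi x * expi y.
Proof. by rewrite /expi cosD sinD; simpc; congr (_ +i* _); rewrite [RHS]addrC mulrC [X in _ + X]mulrC. Qed.

Lemma expi0 : expi 0 = 1.
Proof. by rewrite /expi cos0 sin0. Qed.

Lemma normc_expi x : normc (expi x) = 1.
Proof. by rewrite /= cos2Dsin2 sqrtr1. Qed.

Lemma expiN x : expi (- x) = (expi x)^*.
Proof. by rewrite /expi cosN sinN. Qed.

Lemma expi2pi (n : int) : expi (pi *+ 2 * n%:~R) = 1.
Proof.
have nn (m : nat) : expi (pi *+ 2 * m%:R) = 1.
  elim: m => [|m IH]; first by rewrite mulr0 expi0.
  by rewrite -natr1 mulrDr mulr1 expiD IH mul1r /expi cos2pi -[pi *+ 2]add0r sinD2pi sin0.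
case: n => m.
  by rewrite -pmulrn nn.
by rewrite NegzE mulrNz mulrN expiN -pmulrn nn conjc1.
Qed.

Lemma Re_mul_expi w x :
  complex.Re (w * expi x) = complex.Re w * cos x - complex.Im w * sin x.
Proof. by case: w => a b; rewrite /expi; simpc. Qed.

Lemma normRe_le w : `|complex.Re w| <= normc w.
Proof. by have := normc_ge_Re w; rewrite lecR. Qed.

Lemma continuous_Re_mul_expi w (k : R) : continuous (fun x => complex.Re (w * expi (k * x))).
Proof.
move=> x; rewrite (_ : (fun x => _) =
  (fun x => complex.Re w * cos (k * x) - complex.Im w * sin (k * x))); last first.
  by apply/funext => y; exact: Re_mul_expi.
apply: cvgB; (apply: cvgM; first exact: cvg_cst).
  apply: continuous_comp; last exact: continuous_cos.
  by apply: cvgM; [exact: cvg_cst|exact: cvg_id].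
apply: continuous_comp; last exact: continuous_sin.
by apply: cvgM; [exact: cvg_cst|exact: cvg_id].
Qed.

Lemma integral_expi (a b k C : R) w : a < b -> k != 0 -> expi (k * a) = expi (k * b) ->
  (\int[lebesgue_measure]_(x in `[a, b]) (C + complex.Re (w * expi (k * x)))%:E =
   (C * (b - a))%:E)%E.
Proof.
move=> ab k0 eab.
(* The oscillating part of this primitive takes the same value at both ends, by [eab]. *)
pose F x : R := C * x + (complex.Re w * sin (k * x) + complex.Im w * cos (k * x)) / k.
have dF x : is_derive x 1 F (C + complex.Re (w * expi (k * x))).
  rewrite Re_mul_expi /F; apply: is_derive_eq.
  by rewrite /GRing.scale/=; field.
rewrite (@continuous_FTC2 _ _ F)//.
- rewrite -EFinB /F; case: eab => -> ->; congr EFin; ring.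
- apply: continuous_subspaceT => x; apply: cvgD; first exact: cvg_cst.
  exact: continuous_Re_mul_expi.
- have cF : continuous F.
    by move=> x; apply/differentiable_continuous/derivable1_diffP; have [] := dF x.
  split.
  + by move=> x _; have [] := dF x.
  + by apply: cvg_at_right_filter; exact: cF.
  + by apply: cvg_at_left_filter; exact: cF.
- by move=> x _; rewrite derive1E; have [_ ->] := dF x.
Qed.

Lemma ge0_add_Re C w x : normc w <= C -> 0 <= C + complex.Re (w * expi x).
Proof.
move=> wC; have := normRe_le (w * expi x); rewrite normcM normc_expi mulr1.
by move=> /ler_normlP[]; lra.
Qed.

End expi.

(** * Integrals of characters over the cube *)

Section cube_integral.
Context {R : realType}.
Local Notation GR := (measurableTypeR R).

Definition phase d (tau : 'rV[int]_d) (y : 'rV[R]_d) : R :=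
  pi *+ 2 * \sum_i (tau 0 i)%:~R * y 0 i.

Lemma phaseD d (tau sigma : 'rV[int]_d) (y : 'rV[R]_d) :
  phase (tau + sigma) y = phase tau y + phase sigma y.
Proof.
rewrite /phase -mulrDr -big_split/=; congr (_ * _); apply: eq_bigr => i _.
by rewrite mxE rmorphD mulrDl.
Qed.

Lemma measurable_phase d (tau : 'rV[int]_d) :
  measurable_fun [set: d.-tuple GR] (fun t => phase tau (\row_i tnth t i)).
Proof.
apply: measurable_funM => //; apply: measurable_sum => i.
apply: measurable_funM => //.
under eq_fun do rewrite mxE.
exact: measurable_tnth.
Qed.

Lemma measurable_Re_mul_expi (dd : measure_display) (T : measurableType dd) (f : T -> R) w (C : R) :
  measurable_fun [set: T] f ->
  measurable_fun [set: T] (fun x => C + complex.Re (w * expi (f x))).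
Proof.
move=> mf; apply: measurable_funD => //.
rewrite (_ : (fun x => _) = (fun x => complex.Re (w * expi (1 * x))) \o f); last first.
  by apply/funext => x /=; rewrite mul1r.
apply: measurableT_comp => //; apply: continuous_measurable_fun.
exact: continuous_Re_mul_expi.
Qed.

(** The constant [C] keeps the integrand nonnegative, so that the nonnegative forms of Fubini's
    theorem and of the change of variables apply. Freezing the first coordinate multiplies [w] by a
    number of modulus 1, so the induction hypothesis covers the other coordinates. *)
Lemma cube_integral d (tau : 'rV[int]_d) (C : R) w : normc w <= C ->
  (\int[cube_measure d]_t (C + complex.Re (w * expi (phase tau (\row_i tnth t i))))%:E =
   (C + (tau == 0)%:R * complex.Re w)%:E)%E.
Proof.
elim: d tau C w => [|d IH] tau C w wC.
  rewrite integral_dirac//=; last first.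
    by apply/measurable_EFinP/measurable_Re_mul_expi; exact: measurable_phase.
  rewrite diracT mul1e /phase big_ord0 mulr0 expi0 mulr1.
  by rewrite (_ : tau == 0) ?mul1r//; apply/eqP/rowP; case.
rewrite ge0_integral_distribution//; last 2 first.
- by apply/measurable_EFinP/measurable_Re_mul_expi; exact: measurable_phase.
- by move=> t; rewrite lee_fin ge0_add_Re.
pose tau' : 'rV[int]_d := \row_j tau 0 (lift ord0 j).
have phE (z : GR * d.-tuple GR) : phase tau (\row_i tnth (cons_tuple z) i) =
    pi *+ 2 * (tau 0 0)%:~R * z.1 + phase tau' (\row_i tnth z.2 i).
  rewrite /phase big_ord_recl/= mxE mulrDr mulrA tnth0; congr (_ + _ * _).
  by apply: eq_bigr => i _; rewrite !mxE tnthS.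
rewrite fubini_tonelli1; last 2 first.
- apply/measurable_EFinP; apply: (@measurableT_comp _ _ _ _ _ _
    (fun t => C + complex.Re (w * expi (phase tau (\row_i tnth t i))))).
    by apply: measurable_Re_mul_expi; exact: measurable_phase.
  exact: measurable_cons_tuple.
- by move=> t; rewrite lee_fin ge0_add_Re.
transitivity (\int[uniform_prob (@ltr01 R)]_x (C + (tau' == 0)%:R *
    complex.Re (w * expi (pi *+ 2 * (tau 0 0)%:~R * x)))%:E)%E.
  apply: eq_integral => x _; rewrite -(IH tau' C (w * expi (pi *+ 2 * (tau 0 0)%:~R * x))).
    by apply: eq_integral => y _; rewrite /= phE expiD mulrA.
  by rewrite normcM normc_expi mulr1.
have [t'0|t'0] := eqVneq tau' 0; last first.
  rewrite (_ : tau == 0 = false); last first.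
    by apply: contraNF t'0 => /eqP t0; apply/eqP/rowP => j; rewrite !mxE t0 mxE.
  rewrite !mul0r !addr0; under eq_integral do rewrite mul0r addr0.
  by rewrite integral_cst// [X in (_ * X)%E]probability_setT mule1.
under eq_integral do rewrite mul1r.
rewrite integral_uniform; last 2 first.
- apply/measurable_EFinP/measurable_Re_mul_expi.
  by apply: measurable_funM => //.
- by move=> t; rewrite lee_fin ge0_add_Re.
rewrite subr0 invr1 mul1e.
have [t0|t0] := eqVneq (tau 0 0) 0.
  rewrite (_ : tau == 0); last first.
    apply/eqP/rowP => j; rewrite mxE; case: (unliftP ord0 j) => [i ->|->//].
    by have /rowP/(_ i) := t'0; rewrite !mxE.
  rewrite t0; under eq_integral do rewrite mulr0 mul0r expi0 mulr1.
  by rewrite integral_cst//= lebesgue_measure_itv/= lte01 oppr0 adde0 mule1 mul1r.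
rewrite (_ : tau == 0 = false); last by apply: contraNF t0 => /eqP t0; rewrite t0 mxE.
rewrite integral_expi ?mul0r ?addr0 ?subr0 ?mulr1//.
  by rewrite mulf_neq0 ?intr_eq0// mulrn_eq0/= gt_eqF// pi_gt0.
by rewrite mulr0 expi0 expi2pi.
Qed.
End cube_integral.

Section torus_char.
Context {R : realType} {d : nat}.
Implicit Types (tau : 'rV[int]_d).
Local Notation GR := (measurableTypeR R).

(** Computed at the chosen representative; by [torus_char_proj] every representative gives the same
    value. *)
Definition torus_char tau (x : torus R d) : R[i] := expi (phase tau (repr x)).

Lemma torus_char_proj tau y : torus_char tau (torus_proj y) = expi (phase tau y).
Proof.
have /forallP yy : congr_int (repr (torus_proj y)) y.
  by apply/eqquotP; exact: (reprK (torus_proj y)).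
rewrite /torus_char -[LHS]mulr1.
pose n i := Num.floor (y 0 i - repr (torus_proj y) 0 i).
rewrite -(expi2pi (\sum_i tau 0 i * n i)) -expiD; congr expi.
rewrite /phase -mulrDr; congr (_ * _); rewrite rmorph_sum/= -big_split/=.
apply: eq_bigr => i _; rewrite rmorphM/= -mulrDr; congr (_ * _).
rewrite /n; have /intrP[m ym] : y 0 i - repr (torus_proj y) 0 i \is a Num.int.
  by rewrite -rpredN opprB yy.
by rewrite ym floorK ?rpred_int// -ym addrC subrK.
Qed.

Lemma torus_charD tau sigma x :
  torus_char (tau + sigma) x = torus_char tau x * torus_char sigma x.
Proof. by rewrite /torus_char phaseD expiD. Qed.

Lemma torus_char0 x : torus_char 0 x = 1.
Proof.
by rewrite /torus_char /phase big1 ?mulr0 ?expi0// => i _; rewrite mxE mul0r.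
Qed.

Lemma continuous_torus_char tau w :
  continuous (fun x => complex.Re (w * torus_char tau x)).
Proof.
apply/quotient_continuous.
rewrite (_ : _ \o _ = (fun t => complex.Re (w * expi (1 * t))) \o phase tau); last first.
  by apply/funext => y; rewrite /= -[X in torus_char _ X]/(torus_proj y) torus_char_proj mul1r.
move=> y; apply: continuous_comp; last exact: continuous_Re_mul_expi.
have ci i : continuous (fun y : 'rV[R]_d => (tau 0 i)%:~R * y 0 i).
  move=> z; apply: (@continuous_comp _ _ _ (fun y : 'rV[R]_d => y 0 i)).
    exact: coord_continuous.
  exact: mulrl_continuous.
rewrite /phase; apply: (@continuous_comp _ _ _ (fun y : 'rV[R]_d => \sum_i (tau 0 i)%:~R * y 0 i)).
  exact: continuous_sumr.
exact: mulrl_continuous.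
Qed.

Lemma continuous_torus_measurable (f : torus R d -> R) : continuous f ->
  measurable_fun [set: torus R d] f.
Proof.
move=> /continuousP cf; apply: (measurability _ (RGenOpens.measurableE R)).
move=> _ [_ [a [b ->]] <-]; rewrite setTI; apply: sub_sigma_algebra; apply: cf.
exact: interval_open.
Qed.

Lemma measurable_torus_char tau w :
  measurable_fun [set: torus R d] (fun x => complex.Re (w * torus_char tau x)).
Proof. by apply: continuous_torus_measurable; exact: continuous_torus_char. Qed.

Lemma torus_integral tau (C : R) w : normc w <= C ->
  (\int[torus_measure R d]_x (C + complex.Re (w * torus_char tau x))%:E =
   (C + (tau == 0)%:R * complex.Re w)%:E)%E.
Proof.
move=> wC; rewrite ge0_integral_distribution; last 2 first.
- by apply/measurable_EFinP; apply: measurable_funD => //; exact: measurable_torus_char.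
- by move=> x; rewrite lee_fin ge0_add_Re.
rewrite -(cube_integral tau wC); apply: eq_integral => t _.
by rewrite /= /tuple_proj torus_char_proj.
Qed.

End torus_char.

(** * Space-time trigonometric polynomials *)

Lemma ge0_integral_mrestr (dd : measure_display) (T : measurableType dd) (R : realType)
    (mu : {measure set T -> \bar R}) (D : set T) (mD : measurable D) (f : T -> \bar R) :
  measurable_fun [set: T] f -> (forall x, 0 <= f x)%E ->
  (\int[mrestr mu mD]_x f x = \int[mu]_(x in D) f x)%E.
Proof.
move=> mf f0; rewrite -(setUv D) ge0_integral_setU//=; last 3 first.
- exact: measurableC.
- by rewrite setUv.
- by rewrite disj_set2E setICr.
rewrite [X in (_ + X)%E](_ : _ = 0%E) ?adde0; last first.
  apply: null_set_integral => //; [exact: measurableC|exact: measurable_funTS|].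
  by rewrite /= /mrestr setICl measure0.
apply: eq_measure_integral => A mA AD.
by rewrite /= /mrestr setIidl.
Qed.

Lemma spacetime_fubini (R : realType) (d : nat) (T : R)
    (f : measurableTypeR R * torus R d -> \bar R) :
  measurable_fun [set: _] f -> (forall z, 0 <= f z)%E ->
  (\int[spacetime_measure d T]_z f z =
   \int[lebesgue_measure]_(t in `]0%R, T[) \int[torus_measure R d]_x f (t, x))%E.
Proof.
move=> mf f0.
have foo : (lebesgue_measure `]0%R, T[ < +oo)%E.
  by rewrite lebesgue_measure_itv/=; case: ifP => _; rewrite ?ltry// -EFinB ltry.
(* Restricted Lebesgue measure is repackaged as a finite measure, for Tonelli's theorem. *)
pose m : {finite_measure set (measurableTypeR R) -> \bar R} :=
  @mfrestr _ (measurableTypeR R) R `]0%R, T[%classic lebesgue_measure (measurable_itv _) foo.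
transitivity (\int[m \x torus_measure R d]_z f z)%E.
  by apply: eq_measure_integral.
rewrite (@fubini_tonelli1 _ _ _ _ R m (torus_measure R d) f mf f0).
apply: ge0_integral_mrestr.
- exact: (@measurable_fun_fubini_tonelli_F _ _ _ _ R (torus_measure R d) f mf f0).
- by move=> t; exact: integral_ge0.
Qed.

Section space_time_characters.
Context {R : realType} {d : nat}.
(* The time frequencies are the multiples of [om], that is the period is [2 * pi / om]. *)
Variable om : R.
Local Notation freq := (int * 'rV[int]_d)%type.
Implicit Types (f g : freq) (w : R[i]) (z : R * torus R d).

Definition tchar f z : R[i] := expi (om * f.1%:~R * z.1) * torus_char f.2 z.2.

Lemma tcharD f g z : tchar (f + g) z = tchar f z * tchar g z.
Proof.
by rewrite /tchar torus_charD/= rmorphD/= mulrDr mulrDl expiD mulrACA.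
Qed.

Lemma tchar0 z : tchar 0 z = 1.
Proof. by rewrite /tchar torus_char0 mulr0 mul0r expi0 mulr1. Qed.

Lemma tcharN f z : tchar (- f) z = (tchar f z)^*.
Proof.
have H : tchar (- f) z * tchar f z = 1 by rewrite -tcharD addNr tchar0.
have c1 : (tchar f z)^* * tchar f z = 1.
  rewrite mulrC -sqr_normc (_ : `|tchar f z| = 1) ?expr1n//.
  by rewrite /tchar normrM !(_ : forall x : R, `|expi x| = 1) ?mulr1// => x;
    rewrite (_ : `|_| = (normc (expi x))%:C)// normc_expi.
have t0 : tchar f z != 0 by apply: contra_eq_neq c1 => ->; rewrite mulr0 eq_sym oner_eq0.
by apply: (mulIf t0); rewrite H c1.
Qed.

Lemma normc_tchar f z : normc (tchar f z) = 1.
Proof. by rewrite normcM !normc_expi mulr1. Qed.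

(** Separates time from space, so that continuity and measurability reduce to functions of one of
    the two variables. *)
Lemma Re_tchar w f z : complex.Re (w * tchar f z) =
  complex.Re (w * expi (om * f.1%:~R * z.1)) * complex.Re (1 * torus_char f.2 z.2) -
  complex.Re (- 'i%C * w * expi (om * f.1%:~R * z.1)) * complex.Re (- 'i%C * torus_char f.2 z.2).
Proof.
rewrite /tchar; case: w (expi _) (torus_char _ _) => [a b] [p q] [x y].
by simpc; rewrite /=; ring.
Qed.

Lemma continuous_tchar w f : continuous (fun z => complex.Re (w * tchar f z)).
Proof.
rewrite (_ : (fun z => _) = (fun z =>
  complex.Re (w * expi (om * f.1%:~R * z.1)) * complex.Re (1 * torus_char f.2 z.2) -
  complex.Re (- 'i%C * w * expi (om * f.1%:~R * z.1)) * complex.Re (- 'i%C * torus_char f.2 z.2)));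
  last by apply/funext => z; exact: Re_tchar.
have c1 v : continuous (fun z : R * torus R d => complex.Re (v * expi (om * f.1%:~R * z.1))).
  move=> z; apply: (@continuous_comp _ _ _ fst (fun t => complex.Re (v * expi (om * f.1%:~R * t)))).
    exact: cvg_fst.
  exact: continuous_Re_mul_expi.
have c2 v : continuous (fun z : R * torus R d => complex.Re (v * torus_char f.2 z.2)).
  move=> z; apply: (@continuous_comp _ _ _ snd (fun x => complex.Re (v * torus_char f.2 x))).
    exact: cvg_snd.
  exact: continuous_torus_char.
by move=> z; apply: cvgB; apply: cvgM; [exact: c1|exact: c2|exact: c1|exact: c2].
Qed.

Lemma measurable_tchar w f :
  measurable_fun [set: measurableTypeR R * torus R d] (fun z => complex.Re (w * tchar f z)).
Proof.
rewrite (_ : (fun z => _) = (fun z =>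
  complex.Re (w * expi (om * f.1%:~R * z.1)) * complex.Re (1 * torus_char f.2 z.2) -
  complex.Re (- 'i%C * w * expi (om * f.1%:~R * z.1)) * complex.Re (- 'i%C * torus_char f.2 z.2)));
  last by apply/funext => z; exact: Re_tchar.
have c1 v : measurable_fun [set: measurableTypeR R * torus R d]
    (fun z => complex.Re (v * expi (om * f.1%:~R * z.1))).
  apply: (@measurableT_comp _ _ _ _ _ _ (fun t => complex.Re (v * expi (om * f.1%:~R * t))) _ fst) => //.
  apply: continuous_measurable_fun; exact: continuous_Re_mul_expi.
have c2 v : measurable_fun [set: measurableTypeR R * torus R d]
    (fun z => complex.Re (v * torus_char f.2 z.2)).
  apply: (@measurableT_comp _ _ _ _ _ _ (fun x => complex.Re (v * torus_char f.2 x)) _ snd) => //.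
  exact: measurable_torus_char.
by apply: measurable_funB; apply: measurable_funM.
Qed.

(** Orthogonality of the time characters: by [om * T = pi *+ 2], the interval ]0, T[ is exactly one
    period. *)
Lemma spacetime_integral (T : R) : 0 < T -> om * T = pi *+ 2 ->
  forall f (C : R) w, normc w <= C ->
  (\int[spacetime_measure d T]_z (C + complex.Re (w * tchar f z))%:E =
   ((C + (f == 0%R)%:R * complex.Re w) * T)%:E)%E.
Proof.
move=> T0 omT f C w wC.
have pos z : (0 <= (C + complex.Re (w * tchar f z))%:E)%E.
  rewrite lee_fin; have := normRe_le (w * tchar f z).
  by rewrite normcM normc_tchar mulr1 => /ler_normlP[]; lra.
rewrite spacetime_fubini//; last first.
  by apply/measurable_EFinP; apply: measurable_funD => //; exact: measurable_tchar.
transitivity (\int[lebesgue_measure]_(t in `]0%R, T[)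
    (C + (f.2 == 0%R)%:R * complex.Re (w * expi (om * f.1%:~R * t)))%:E)%E.
  apply: eq_integral => t _; rewrite -torus_integral ?normcM ?normc_expi ?mulr1//.
  by apply: eq_integral => x _; rewrite /tchar /= mulrA.
have iT : (lebesgue_measure `]0%R, T[ = T%:E)%E.
  by rewrite lebesgue_measure_itv/= lte_fin T0 -EFinB subr0.
have [f20|f20] := eqVneq f.2 0; last first.
  under eq_integral do rewrite mul0r addr0.
  rewrite integral_cst//= iT (_ : f == 0 = false) ?mul0r ?addr0//.
  by apply: contraNF f20 => /eqP ->.
under eq_integral do rewrite mul1r.
have [f10|f10] := eqVneq f.1 0.
  have -> : f == 0 by apply/eqP; case: (f) f10 f20 => a b /= -> ->.
  rewrite f10; under eq_integral do rewrite mulr0 mul0r expi0 mulr1.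
  by rewrite integral_cst//= iT mul1r.
rewrite (_ : f == 0 = false); last by apply: contraNF f10 => /eqP ->.
rewrite -(@integral_itv_bndoo _ 0 T _ true false).
  rewrite integral_expi ?subr0 ?mul0r ?addr0//.
    by rewrite mulf_neq0 ?intr_eq0//; apply: contra_eq_neq omT => ->;
      rewrite mul0r eq_sym mulrn_eq0/= gt_eqF// pi_gt0.
  by rewrite mulr0 expi0 mulrAC omT expi2pi.
apply: measurable_funTS; apply/measurable_EFinP.
exact: measurable_Re_mul_expi.
Qed.

Definition trig_poly (F : R * torus R d -> R) : Prop :=
  exists s : seq (R[i] * freq), forall z, F z = \sum_(p <- s) complex.Re (p.1 * tchar p.2 z).

Lemma trig_poly_cst (c : R) : trig_poly (cst c).
Proof.
by exists [:: (c%:C, 0)] => z; rewrite big_seq1 tchar0 mulr1.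
Qed.

Lemma trig_polyD F G : trig_poly F -> trig_poly G -> trig_poly (fun z => F z + G z).
Proof. by move=> [s Fs] [t Gt]; exists (s ++ t) => z; rewrite big_cat Fs Gt. Qed.

(** Product-to-sum formula: Re a Re b is half of the sum of the real parts of a b and of a times the
    conjugate of b. *)
Lemma trig_polyM F G : trig_poly F -> trig_poly G -> trig_poly (fun z => F z * G z).
Proof.
move=> [s Fs] [t Gt].
exists ([seq (2%:R^-1%:C * p.1 * q.1, p.2 + q.2) | p <- s, q <- t] ++
        [seq (2%:R^-1%:C * p.1 * q.1^*, p.2 - q.2) | p <- s, q <- t]) => z.
rewrite Fs Gt big_cat !big_allpairs_dep/= big_distrl -big_split/=.
apply: eq_bigr => p _; rewrite big_distrr -big_split/=; apply: eq_bigr => q _.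
rewrite !tcharD tcharN; case: (tchar _ _) (tchar _ _) (p.1) (q.1) => [a b] [u v] [x y] [k l].
by simpc; rewrite /=; field.
Qed.

Lemma trig_poly_continuous F : trig_poly F -> continuous F.
Proof.
move=> [s Fs]; rewrite (_ : F = fun z => \sum_(p <- s) complex.Re (p.1 * tchar p.2 z));
  last exact/funext.
by apply: continuous_sumr => p; exact: continuous_tchar.
Qed.

Lemma trig_poly_measurable F : trig_poly F ->
  measurable_fun [set: measurableTypeR R * torus R d] F.
Proof.
move=> [s Fs]; rewrite (_ : F = fun z => \sum_(p <- s) complex.Re (p.1 * tchar p.2 z));
  last exact/funext.
by apply: measurable_sum => p; exact: measurable_tchar.
Qed.

End space_time_characters.

(** * Weights of small energy *)

Section energy.
Context {R : realType} {d : nat}.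
Variables (om T : R) (m : nat).
Hypotheses (T0 : 0 < T) (omT : om * T = pi *+ 2) (m0 : (0 < m)%N).
Local Notation freq := (int * 'rV[int]_d)%type.
Local Notation ST := (measurableTypeR R * torus R d)%type.
Local Notation mu := (spacetime_measure d T).
Local Notation trig := (@trig_poly R d om).
Implicit Types (F G Q : R * torus R d -> R).

(** Not normalised: the constant 1 has mean [T]. *)
Definition mean F : R := (\int[mu]_z F z)%R.

Lemma integrable_cst_spacetime (C : R) : mu.-integrable [set: ST] (EFin \o cst C).
Proof.
apply/integrableP; split; first by apply/measurable_EFinP; exact: measurable_cst.
rewrite (_ : (fun z => _) = (fun z => (`|C| + complex.Re (0 * tchar om 0 z))%:E)); last first.
  by apply/funext => z; rewrite mul0r /= addr0.
rewrite (spacetime_integral T0 omT) ?ltry// normc0; exact: normr_ge0.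
Qed.

Lemma spacetime_measureT : mu [set: ST] = T%:E.
Proof.
have := @spacetime_integral R d om T T0 omT 0 1 0.
rewrite normc0 ler01 => /(_ isT); under eq_integral do rewrite mul0r addr0.
by rewrite integral_cst// mul1e eqxx mul1r addr0 mul1r.
Qed.

Lemma trig_bounded F : trig F -> exists2 C, 0 <= C & forall z, `|F z| <= C.
Proof.
move=> [s Fs]; exists (\sum_(p <- s) normc p.1) => [|z].
  by rewrite sumr_ge0// => p _; exact: normc_ge0.
rewrite Fs; apply: le_trans (ler_norm_sum _ _ _) _.
apply: ler_sum => p _; apply: le_trans (normRe_le _) _.
by rewrite normcM normc_tchar mulr1.
Qed.

Lemma trig_integrable F : trig F -> mu.-integrable [set: ST] (EFin \o F).
Proof.
move=> tF; have [C C0 FC] := trig_bounded tF.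
apply: le_integrable (integrable_cst_spacetime C) => //.
  by apply/measurable_EFinP; exact: trig_poly_measurable tF.
by move=> z _ /=; rewrite lee_fin (ger0_norm C0).
Qed.

Lemma meanD F G : trig F -> trig G -> mean (fun z => F z + G z) = mean F + mean G.
Proof. by move=> tF tG; rewrite /mean RintegralD//; exact: trig_integrable. Qed.

Lemma meanZ c F : trig F -> mean (fun z => c * F z) = c * mean F.
Proof. by move=> tF; rewrite /mean RintegralZl//; exact: trig_integrable. Qed.

Lemma le_mean F G : trig F -> trig G -> (forall z, F z <= G z) -> mean F <= mean G.
Proof. by move=> tF tG FG; apply: le_Rintegral => //; exact: trig_integrable. Qed.

Lemma trig_sum (I : Type) (r : seq I) (P : pred I) (F : I -> R * torus R d -> R) :
  (forall i, P i -> trig (F i)) -> trig (fun z => \sum_(i <- r | P i) F i z).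
Proof.
move=> tF; elim: r => [|i r IH].
  rewrite (_ : (fun z => _) = cst 0); first exact: trig_poly_cst.
  by apply/funext => z; rewrite big_nil.
case: (boolP (P i)) => Pi.
  rewrite (_ : (fun z => _) = (fun z => F i z + \sum_(i <- r | P i) F i z)).
    by apply: trig_polyD => //; exact: tF.
  by apply/funext => z; rewrite big_cons Pi.
by move: IH; congr trig; apply/funext => z; rewrite big_cons (negbTE Pi).
Qed.

Lemma mean_sum (I : Type) (r : seq I) (P : pred I) (F : I -> R * torus R d -> R) :
  (forall i, P i -> trig (F i)) ->
  mean (fun z => \sum_(i <- r | P i) F i z) = \sum_(i <- r | P i) mean (F i).
Proof.
move=> tF; elim: r => [|i r IH].
  rewrite big_nil /mean; under eq_Rintegral do rewrite big_nil.
  by rewrite Rintegral_cst// mul0r.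
rewrite big_cons; case: (boolP (P i)) => Pi; last first.
  by rewrite -IH; congr mean; apply/funext => z; rewrite big_cons (negbTE Pi).
rewrite -IH -meanD; [|exact: tF|exact: trig_sum].
by congr mean; apply/funext => z; rewrite big_cons Pi.
Qed.

Lemma trig_tchar w (f : freq) : trig (fun z => complex.Re (w * tchar om f z)).
Proof. by exists [:: (w, f)] => z; rewrite big_seq1. Qed.

(** The constant [normc w] is added in order to use the nonnegative case [spacetime_integral], then
    cancelled. *)
Lemma mean_tchar w (f : freq) :
  mean (fun z => complex.Re (w * tchar om f z)) = (f == 0)%:R * complex.Re w * T.
Proof.
have := @spacetime_integral R d om T T0 omT f (normc w) w (lexx _).
have -> : (\int[mu]_z (normc w + complex.Re (w * tchar om f z))%:E =
           (mean (fun z => normc w + complex.Re (w * tchar om f z)))%:E)%E.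
  rewrite /mean /Rintegral fineK//; apply: integrable_fin_num => //.
  apply: trig_integrable; apply: trig_polyD; [exact: trig_poly_cst|exact: trig_tchar].
move=> []; rewrite meanD; [|exact: trig_poly_cst|exact: trig_tchar].
have -> : mean (cst (normc w)) = normc w * T.
  by rewrite /mean Rintegral_cst// [X in fine X]spacetime_measureT.
by rewrite mulrDl => /addrI.
Qed.

(* [tchar (wave_freq k)] is the solution exp(-4 pi^2 i t |k|^2 + 2 pi i k.x). *)
Definition wave_freq (k : 'rV[int]_d) : freq := (- (m%:Z * dotz k k), k).

Definition wave (I : finType) (kappa : I -> 'rV[int]_d) (c : I -> R[i]) z : R[i] :=
  \sum_i c i * tchar om (wave_freq (kappa i)) z.

Definition energy Q (I : finType) (kappa : I -> 'rV[int]_d) (c : I -> R[i]) : R :=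
  mean (fun z => Q z * normc (wave kappa c z) ^+ 2).

Definition cross (k l : 'rV[int]_d) (u : R[i]) z : R :=
  complex.Re (u * tchar om (wave_freq k - wave_freq l) z).

Lemma normc_sqr (w : R[i]) : normc w ^+ 2 = complex.Re (w * w^*).
Proof.
case: w => a b; rewrite /= sqr_sqrtr ?addr_ge0 ?sqr_ge0//.
by rewrite mulrN opprK !expr2.
Qed.

Lemma Re_sum (I : Type) (r : seq I) (P : pred I) (F : I -> R[i]) :
  complex.Re (\sum_(i <- r | P i) F i) = \sum_(i <- r | P i) complex.Re (F i).
Proof. by apply: (big_morph _ (@ReD R)). Qed.

Lemma wave_sqr (I : finType) (kappa : I -> 'rV[int]_d) (c : I -> R[i]) z :
  normc (wave kappa c z) ^+ 2 =
  \sum_i \sum_j cross (kappa i) (kappa j) (c i * (c j)^*) z.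
Proof.
rewrite normc_sqr /wave rmorph_sum/= big_distrlr/= Re_sum; apply: eq_bigr => i _.
rewrite Re_sum; apply: eq_bigr => j _; congr complex.Re.
by rewrite rmorphM/= tcharD tcharN mulrACA.
Qed.

Lemma trig_wave_sqr (I : finType) (kappa : I -> 'rV[int]_d) (c : I -> R[i]) :
  trig (fun z => normc (wave kappa c z) ^+ 2).
Proof.
under eq_fun do rewrite wave_sqr.
by apply: trig_sum => i _; apply: trig_sum => j _; exact: trig_tchar.
Qed.

Lemma energyE Q (I : finType) (kappa : I -> 'rV[int]_d) (c : I -> R[i]) : trig Q ->
  energy Q kappa c =
  \sum_i \sum_j mean (fun z => Q z * cross (kappa i) (kappa j) (c i * (c j)^*) z).
Proof.
move=> tQ; rewrite /energy.
have tc i j : trig (fun z => Q z * cross (kappa i) (kappa j) (c i * (c j)^*) z).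
  by apply: trig_polyM => //; exact: trig_tchar.
under [LHS]eq_Rintegral do rewrite wave_sqr mulr_sumr.
rewrite [LHS]mean_sum => [|i _].
  apply: eq_bigr => i _; rewrite -mean_sum => [|j _ //].
  by congr mean; apply/funext => z; rewrite mulr_sumr.
by under eq_fun do rewrite mulr_sumr; apply: trig_sum => j _.
Qed.

Lemma Re_tcharM a b (f g : freq) z :
  complex.Re (a * tchar om f z) * complex.Re (b * tchar om g z) =
  complex.Re (2%:R^-1%:C * a * b * tchar om (f + g) z) +
  complex.Re (2%:R^-1%:C * a * b^* * tchar om (f - g) z).
Proof.
rewrite !tcharD tcharN; case: (tchar _ _ _) (tchar _ _ _) a b => [p q] [u v] [x y] [k l].
by simpc; rewrite /=; field.
Qed.

(** [Q] has finitely many frequencies, and the mean vanishes unless [wave_freq k - wave_freq l] is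
    one of them up to sign. The time component of this difference carries the factor [m >= 1], so a
    bound for it is also one for |k|^2 - |l|^2. *)
Lemma cross_local Q : trig Q -> exists M : nat, forall k l u, ~ near M k l ->
  mean (fun z => Q z * cross k l u z) = 0.
Proof.
move=> [s Qs].
pose sz (f : freq) : nat := (absz f.1 + \sum_i absz (f.2 0 i)%R)%N.
pose M := (\sum_(p <- s) sz p.2)%N; exists M => k l u kl.
have ps p : p \in s -> (sz p.2 <= M)%N by move=> ps; rewrite /M (big_rem _ ps)/= leq_addr.
pose f := wave_freq k - wave_freq l.
have far p : p \in s -> (p.2 + f != 0) && (p.2 - f != 0).
  move=> /ps pM; rewrite -negb_or; apply/negP => /orP pf; apply: kl.
  have [f1 f2] : absz f.1 = absz p.2.1 /\ forall i, absz (f.2 0 i) = absz (p.2.2 0 i).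
    have [/eqP ->|/eqP ->] : p.2 == - f \/ p.2 == f.
      by case: pf; [rewrite addr_eq0; left|rewrite subr_eq0; right].
    - by split=> [|i]; rewrite /= ?mxE abszN.
    - by [].
  split=> [i|].
    have -> : k 0 i - l 0 i = f.2 0 i by rewrite !mxE.
    have := f2 i; have : (absz (p.2.2 0 i)%R <= M)%N.
      apply: leq_trans pM; rewrite /sz (bigD1 i)//=; lia.
    by lia.
  have : (absz f.1 <= M)%N by rewrite f1; exact: leq_trans (leq_addr _ _) pM.
  have -> : f.1 = - (m%:Z * (dotz k k - dotz l l)) by rewrite /f /= mulrBr opprB opprK addrC.
  rewrite abszN abszM absz_nat => H.
  have : (absz (dotz k k - dotz l l) <= M)%N by apply: leq_trans H; rewrite leq_pmull.
  by lia.
have -> : (fun z => Q z * cross k l u z) = (fun z => \sum_(p <- s | p \in s)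
    complex.Re (p.1 * tchar om p.2 z) * complex.Re (u * tchar om f z)).
  by apply/funext => z; rewrite Qs mulr_suml big_seq.
rewrite mean_sum => [|p _]; last by apply: trig_polyM; exact: trig_tchar.
apply: big1 => p /far/andP[n1 n2].
rewrite (_ : (fun z => _) = (fun z =>
    complex.Re (2%:R^-1%:C * p.1 * u * tchar om (p.2 + f) z) +
    complex.Re (2%:R^-1%:C * p.1 * u^* * tchar om (p.2 - f) z))); last first.
  by apply/funext => z; exact: Re_tcharM.
rewrite meanD; [|exact: trig_tchar|exact: trig_tchar].
by rewrite !mean_tchar (negbTE n1) (negbTE n2) !mul0r addr0.
Qed.

(** Indices with coefficient 0 are left isolated, so that a path only joins frequencies that occur
    in the wave. *)
Definition graph (M : nat) (I : finType) (kappa : I -> 'rV[int]_d) (c : I -> R[i]) : rel I :=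
  fun i j => [&& `[< near M (kappa i) (kappa j) >], c i != 0 & c j != 0].

Lemma near_sym M (k l : 'rV[int]_d) : near M k l <-> near M l k.
Proof. by split=> -[H1 H2]; split=> [i|]; rewrite distrC. Qed.

Lemma graph_cluster M (I : finType) (kappa : I -> 'rV[int]_d) (c : I -> R[i]) :
  injective kappa -> cluster_graph M kappa (graph M kappa c).
Proof.
move=> kI; split=> // [i j|i j /and3P[/asboolP]//].
rewrite /graph; congr andb; last exact: andbC.
by apply/asboolP/asboolP => /near_sym.
Qed.

Lemma normcD_sqr (a b : R[i]) : normc (a + b) ^+ 2 <= 2 * normc a ^+ 2 + 2 * normc b ^+ 2.
Proof.
apply: (@le_trans _ _ ((normc a + normc b) ^+ 2)).
  by rewrite ler_pXn2r ?nnegrE ?addr_ge0 ?normc_ge0 ?le_normcD.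
have := sqr_ge0 (normc a - normc b); rewrite !expr2; lra.
Qed.

Lemma sum_sqr_le (I : finType) (A : {set I}) (a : I -> R) :
  (\sum_(i in A) a i) ^+ 2 <= #|A|%:R * \sum_(i in A) a i ^+ 2.
Proof.
rewrite expr2 big_distrlr/=.
apply: (@le_trans _ _ (\sum_(i in A) \sum_(j in A) (a i ^+ 2 + a j ^+ 2) / 2)).
  apply: ler_sum => i _; apply: ler_sum => j _.
  have := sqr_ge0 (a i - a j); rewrite !expr2; lra.
rewrite (eq_bigr (fun i => a i ^+ 2 * (#|A|%:R / 2) + (\sum_(j in A) a j ^+ 2) / 2)).
  rewrite big_split/= -mulr_suml sumr_const -mulr_natl; lra.
move=> i _; rewrite -mulr_suml big_split/= sumr_const -mulr_natr; lra.
Qed.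

(** The cross terms between two components have mean 0 against [Q], so nothing is lost, however many
    components there are. *)
Lemma energy_components Q M : trig Q -> (forall k l u, ~ near M k l ->
    mean (fun z => Q z * cross k l u z) = 0) ->
  forall (I : finType) (kappa : I -> 'rV[int]_d) (e : rel I) (c : I -> R[i]),
  symmetric e ->
  (forall i j, c i != 0 -> c j != 0 -> near M (kappa i) (kappa j) -> connect e i j) ->
  energy Q kappa c = \sum_(r | fingraph.roots e r)
    energy Q kappa (fun i => if fingraph.root e i == r then c i else 0).
Proof.
move=> tQ QM I kappa e c esym ce.
pose q (c : I -> R[i]) i j := mean (fun z => Q z * cross (kappa i) (kappa j) (c i * (c j)^*) z).
have mean0 k l : mean (fun z => Q z * cross k l 0 z) = 0.
  rewrite /cross /mean; under eq_Rintegral do rewrite mul0r mulr0.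
  by rewrite Rintegral_cst// mul0r.
have q0 (c' : I -> R[i]) i j : (c' i == 0) || (c' j == 0) -> q c' i j = 0.
  by move=> /orP[] /eqP c0; rewrite /q c0 ?rmorph0 ?mul0r ?mulr0 mean0.
rewrite energyE//; under [RHS]eq_bigr do rewrite energyE//.
rewrite (partition_big (fingraph.root e) (fingraph.roots e))/= => [|i _];
  last exact: (roots_root (sym_connect_sym esym)).
apply: eq_bigr => r rr; rewrite big_mkcond/=; apply: eq_bigr => i _.
case: ifPn => ir; last by rewrite big1// => j _; rewrite mul0r mean0.
apply: eq_bigr => j _; case: ifPn => jr //.
rewrite [in RHS]rmorph0 mulr0 mean0.
have [ci|ci] := eqVneq (c i) 0; first by rewrite -/(q c i j) q0// ci eqxx.
have [cj|cj] := eqVneq (c j) 0; first by rewrite -/(q c i j) q0// cj eqxx orbT.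
apply: QM => /(ce _ _ ci cj) ij; move/negP: jr; apply.
by rewrite -(eqP ir) eq_sym (root_connect (sym_connect_sym esym)).
Qed.

Lemma component_spread_connect (I : finType) (kappa : I -> 'rV[int]_d) (e : rel I) i j :
  symmetric e -> connect e i j -> component_spread kappa e i = component_spread kappa e j.
Proof.
move=> esym; have cs := sym_connect_sym esym.
suff H i' j' : connect e i' j' -> (component_spread kappa e i' <= component_spread kappa e j')%VS.
  by move=> ij; apply/eqP; rewrite eqEsubv H// H// cs.
move=> ij; apply: subv_trans (spreadS (t := enum (connect e j')) _ _ _) (spread_base _ _ _).
  by move=> x; rewrite !mem_enum -!topredE/= (same_connect cs ij).
by rewrite mem_enum -topredE/= cs.
Qed.

Lemma le_energy Q Q' (I : finType) (kappa : I -> 'rV[int]_d) (c : I -> R[i]) :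
  trig Q -> trig Q' -> (forall z, Q z <= Q' z) -> energy Q kappa c <= energy Q' kappa c.
Proof.
move=> tQ tQ' QQ'; apply: le_mean.
- by apply: trig_polyM => //; exact: trig_wave_sqr.
- by apply: trig_polyM => //; exact: trig_wave_sqr.
- by move=> z; rewrite ler_wpM2r ?sqr_ge0.
Qed.

(** Cauchy-Schwarz at each point bounds the squared wave by a constant, which is then integrated
    against [Q]. *)
Lemma energy_few Q (I : finType) (kappa : I -> 'rV[int]_d) (c : I -> R[i]) (A : {set I}) :
  trig Q -> (forall z, 0 <= Q z) -> (forall i, i \notin A -> c i = 0) ->
  energy Q kappa c <= #|A|%:R * (\sum_i normc (c i) ^+ 2) * mean Q.
Proof.
move=> tQ Q0 cA; rewrite -meanZ//; apply: le_mean.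
- by apply: trig_polyM => //; exact: trig_wave_sqr.
- by apply: trig_polyM => //; exact: trig_poly_cst.
move=> z; rewrite mulrC ler_wpM2r//.
have cA' (F : I -> R) : (forall i, c i = 0 -> F i = 0) -> \sum_i F i = \sum_(i in A) F i.
  move=> F0; rewrite [RHS]big_mkcond/=; apply: eq_bigr => i _.
  by case: ifPn => // /cA/F0.
rewrite (cA' (fun i => normc (c i) ^+ 2)); last by move=> i ->; rewrite normc0 expr0n.
apply: le_trans (sum_sqr_le _ _).
rewrite ler_pXn2r ?nnegrE ?normc_ge0//; last by apply: sumr_ge0 => i _; exact: normc_ge0.
rewrite -(cA' (fun i => normc (c i))); last by move=> i ->; rewrite normc0.
rewrite /wave; elim: (index_enum I) => [|i r IH]; first by rewrite !big_nil normc0.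
rewrite !big_cons; apply: le_trans (le_normcD _ _) _.
by rewrite normcM normc_tchar mulr1 lerD2l.
Qed.

Lemma energyD Q (I : finType) (kappa : I -> 'rV[int]_d) (a b c : I -> R[i]) :
  trig Q -> (forall z, 0 <= Q z) -> (forall i, c i = a i + b i) ->
  energy Q kappa c <= 2 * energy Q kappa a + 2 * energy Q kappa b.
Proof.
move=> tQ Q0 cab.
have t c' : trig (fun z => Q z * normc (wave kappa c' z) ^+ 2).
  by apply: trig_polyM => //; exact: trig_wave_sqr.
have tZ c' : trig (fun z => 2 * (Q z * normc (wave kappa c' z) ^+ 2)).
  by apply: trig_polyM => //; exact: trig_poly_cst.
rewrite -!meanZ// -meanD//; apply: le_mean => [//||z].
  exact: trig_polyD.
have -> : wave kappa c z = wave kappa a z + wave kappa b z.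
  by rewrite /wave -big_split/=; apply: eq_bigr => i _; rewrite cab mulrDl.
apply: le_trans (ler_wpM2l (Q0 z) (normcD_sqr _ _)) _.
by rewrite mulrDr !(mulrCA (Q z)).
Qed.

Section small_energy.
(* [loss e Q]: replacing the indicator of the null set under study by [Q] costs at
   most [e]. *)
Variable loss : R -> (R * torus R d -> R) -> Prop.
Definition unit_trig Q : Prop := trig Q /\ forall z, 0 <= Q z <= 1.
Hypothesis loss_mono : forall a b Q, a <= b -> loss a Q -> loss b Q.
Hypothesis lossM : forall a b Q Q', unit_trig Q -> unit_trig Q' -> loss a Q -> loss b Q' ->
  loss (a + b) (fun z => Q z * Q' z).
Hypothesis loss_mean : forall e, 0 < e -> exists Q, [/\ unit_trig Q, loss e Q & mean Q <= e].

(** The condition [\dim W < r] is impossible for [r = 0] and always true for [r = d + 1]. The order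
    of the choices is essential: [Q0] comes from the induction, it determines the range [M] of
    interactions, [M] determines the number [N] of frequencies, and [Q1] has a mean that is small
    compared with 1/N. The offset [k] is free because each component has its own base point. *)
Theorem small_energy (r : nat) (e : R) : 0 < e -> exists Q, [/\ unit_trig Q, loss e Q &
  forall (I : finType) (kappa : I -> 'rV[int]_d) (c : I -> R[i]) k (W : {vspace 'rV[rat]_d}),
    injective kappa -> (\dim W < r)%N ->
    (forall i, c i != 0 -> ratv (kappa i - k) \in W) ->
    energy Q kappa c <= e * \sum_i normc (c i) ^+ 2].
Proof.
elim: r e => [|r IH] e e0; first by have [Q [? ? ?]] := loss_mean e0; exists Q.
have e4 : 0 < e / 4 by rewrite divr_gt0.
have [Q0 [[tQ0 Q001] lQ0 sQ0]] := IH _ e4.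
have [M QM] := cross_local tQ0.
have [N fewN] := cluster_bound d M r.
(* [N * del <= e / 4] serves for the energy of at most [N] frequencies, [del <= e / 4] for the
   loss. *)
pose del := e / 4 / N.+1%:R.
have del0 : 0 < del by rewrite divr_gt0// ltr0n.
have dele : del <= e / 4 by rewrite ler_pdivrMr ?ltr0n// ler_peMr ?(ltW e4)// ler1n.
have [Q1 [[tQ1 Q101] lQ1 mQ1]] := loss_mean del0.
have tQ := trig_polyM tQ0 tQ1.
exists (fun z => Q0 z * Q1 z); split.
- split=> // z; have := Q001 z; have := Q101 z; nra.
- by apply: loss_mono (lossM _ _ lQ0 lQ1) => //; lra.
move=> I kappa c k W kI dW cW.
pose e' := graph M kappa c; have G := graph_cluster M c kI.
have [_ esym _] := G.
(* [A] collects the frequencies whose component spans all of [W]; [cn] keeps their coefficients and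
   [cf] the others. *)
pose A := [set i | (ratv (kappa i - k) \in W) && (component_spread kappa e' i == W)]%SET.
have AN : (#|A| <= N)%N by apply: fewN G _ _ _.
pose cn i := if i \in A then c i else 0; pose cf i := if i \in A then 0 else c i.
pose S := \sum_i normc (c i) ^+ 2.
have S0 : 0 <= S by apply: sumr_ge0 => i _; exact: sqr_ge0.
have Scn : \sum_i normc (cn i) ^+ 2 <= S.
  by apply: ler_sum => i _; rewrite /cn; case: ifP => // _; rewrite normc0 expr0n sqr_ge0.
have Scf : \sum_i normc (cf i) ^+ 2 <= S.
  by apply: ler_sum => i _; rewrite /cf; case: ifP => // _; rewrite normc0 expr0n sqr_ge0.
(* As [Q0 <= 1], the product is at most [Q1], and few frequencies are left; for [cf] below, the
   product is bounded by [Q0] instead. *)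
have en : energy (fun z => Q0 z * Q1 z) kappa cn <= e / 4 * S.
  apply: (@le_trans _ _ (energy Q1 kappa cn)).
    by apply: le_energy => // z; have := Q001 z; have := Q101 z; nra.
  apply: (@le_trans _ _ (#|A|%:R * (\sum_i normc (cn i) ^+ 2) * mean Q1)).
    apply: energy_few => // [z|i]; first by case/andP: (Q101 z).
    by rewrite /cn => /negbTE ->.
  apply: (@le_trans _ _ (N%:R * S * del)).
    rewrite ler_pM ?mulr_ge0 ?sumr_ge0// => [i _||]; first exact: sqr_ge0.
      rewrite (_ : 0 = mean (cst 0)); last by rewrite /mean Rintegral_cst// mul0r.
      by apply: le_mean => //; [exact: trig_poly_cst|move=> z; case/andP: (Q101 z)].
    by rewrite ler_pM ?sumr_ge0 ?ler_nat// => i _; exact: sqr_ge0.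
  rewrite mulrAC ler_wpM2r// /del mulrA ler_pdivrMr ?ltr0n// mulrC.
  by rewrite ler_wpM2l ?(ltW e4)// ler_nat.
have ef : energy (fun z => Q0 z * Q1 z) kappa cf <= e / 4 * S.
  apply: (@le_trans _ _ (energy Q0 kappa cf)).
    by apply: le_energy => // z; have := Q001 z; have := Q101 z; nra.
  apply: (@le_trans _ _ (e / 4 * \sum_i normc (cf i) ^+ 2)); last by rewrite ler_wpM2l ?(ltW e4).
  rewrite (energy_components tQ0 QM esym); last first.
    move=> i j; rewrite /cf; case: ifP => [|_]; first by rewrite eqxx.
    case: ifP => [|_]; first by rewrite eqxx.
    by move=> ci cj ij; apply: connect1; apply/and3P; split=> //; exact/asboolP.
  rewrite [X in _ <= _ * X](partition_big (fingraph.root e') (fingraph.roots e'))/= => [|i _]; last exact: (roots_root (sym_connect_sym esym)).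
  have en0 (b : I -> R[i]) : (forall i, b i = 0) -> energy Q0 kappa b <= 0.
    move=> b0; have := @energy_few Q0 I kappa b finset.set0 tQ0 _ (fun i _ => b0 i).
    by rewrite cards0 !mul0r; apply => z; case/andP: (Q001 z).
  rewrite mulr_sumr; apply: ler_sum => rho rr.
  pose b i := if fingraph.root e' i == rho then cf i else 0.
  have -> : \sum_(i | fingraph.root e' i == rho) normc (cf i) ^+ 2 = \sum_i normc (b i) ^+ 2.
    by rewrite big_mkcond; apply: eq_bigr => i _; rewrite /b; case: ifP; rewrite ?normc0 ?expr0n.
  rewrite -/b.
  have cc := sym_connect_sym esym.
  have conn i : b i != 0 -> [/\ connect e' rho i, i \notin A & c i != 0].
    rewrite /b /cf; case: ifP => [/eqP ri|]; last by rewrite eqxx.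
    case: ifPn => [|iA]; first by rewrite eqxx.
    by move=> ci; split=> //; rewrite cc -ri connect_root.
  (* A root with coefficient 0 is isolated, so its component contributes nothing. *)
  have [crho|crho] := eqVneq (c rho) 0.
    have b0 i : b i = 0.
      apply/eqP; apply: contraT => /conn[/connectP[p rp lp] _ ci].
      case: p rp lp => [_ /= ir|j p /= /andP[/and3P[_ + _] _]]; last by rewrite crho eqxx.
      by rewrite ir crho eqxx in ci.
    rewrite big1 ?mulr0 => [|i _]; last by rewrite b0 normc0 expr0n.
    exact: en0.
  have compW : (component_spread kappa e' rho <= W)%VS.
    apply/span_subvP => _ /mapP[j + ->]; rewrite mem_enum => /connectP[p rp ->].
    have cj : c (last rho p) != 0.
      elim: p rho rp crho {rr b conn} => //= j' p IHp rho' /andP[/and3P[_ _ cj'] jp] _.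
      exact: IHp jp cj'.
    rewrite (_ : _ - _ = (kappa (last rho p) - k) - (kappa rho - k)).
      by rewrite ratvB rpredB// cW.
    by rewrite opprB addrA subrK.
  (* The frequencies of a component that spans [W] belong to [A], where [cf] vanishes. *)
  have [spW|spW] := eqVneq (component_spread kappa e' rho) W.
    have b0 i : b i = 0.
      apply/eqP; apply: contraT => /conn[ri /negP iA ci]; exfalso; apply: iA.
      by rewrite inE cW//= -(component_spread_connect kappa esym ri) spW.
    rewrite big1 ?mulr0 => [|i _]; last by rewrite b0 normc0 expr0n.
    exact: en0.
  (* Any other component lies in a coset, based at [kappa rho], of a proper subspace of [W], which
     is the case of the induction hypothesis. *)
  apply: (sQ0 _ _ _ (kappa rho) (component_spread kappa e' rho)) => //.
    rewrite ltnNge; apply: contra spW => rs; rewrite eqEdim compW.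
    by apply: leq_trans rs; rewrite -ltnS.
  by move=> i /conn[ri _ _]; apply: mem_spread; rewrite mem_enum.
apply: le_trans (energyD (Q := fun z => Q0 z * Q1 z) (a := cn) (b := cf) _ _ _ _) _ => //.
- by move=> z; have := Q001 z; have := Q101 z; nra.
- by move=> i; rewrite /cn /cf; case: ifP; rewrite ?addr0 ?add0r.
by move: en ef; rewrite -/S; lra.
Qed.
End small_energy.
End energy.

(** * Density of trigonometric weights *)

Section cosine.
Context {R : realType}.

Lemma cos_sub (u v : R) : cos (u - v) - cos (u + v) = 2 * sin u * sin v.
Proof. by rewrite cosB cosD; ring. Qed.

Lemma ltr_cos_pi2 (a b : R) : 0 <= a <= 2^-1 -> 0 <= b <= 2^-1 ->
  (cos (pi *+ 2 * a) < cos (pi *+ 2 * b)) = (b < a).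
Proof.
move=> /andP[a0 a1] /andP[b0 b1]; have p0 := pi_gt0 R.
rewrite ltr_cos ?in_itv/=; last 2 first.
- have := mulr_ge0 (ltW p0) b0; have : 0 <= pi * (2^-1 - b) by rewrite mulr_ge0 ?(ltW p0)//; lra.
  by rewrite -mulr_natr; lra.
- have := mulr_ge0 (ltW p0) a0; have : 0 <= pi * (2^-1 - a) by rewrite mulr_ge0 ?(ltW p0)//; lra.
  by rewrite -mulr_natr; lra.
by rewrite ltr_pM2l// mulrn_wgt0.
Qed.

Lemma cos2pi_int (x : R) (n : int) : cos (pi *+ 2 * (x - n%:~R)) = cos (pi *+ 2 * x).
Proof.
have := expiD (pi *+ 2 * (x - n%:~R)) (pi *+ 2 * n%:~R).
by rewrite expi2pi mulr1 -mulrDr subrK => -[].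
Qed.

(** The witness is an integer nearest to [s], and the cosine decreases on a half period. Superlevel
    sets of cosines are thus small arcs of the circle. *)
Lemma cos_dist_int (s r : R) : 0 < r < 2^-1 -> cos (pi *+ 2 * r) < cos (pi *+ 2 * s) ->
  exists n : int, `|s - n%:~R| < r.
Proof.
move=> /andP[r0 r1]; pose n := Num.floor (s + 2^-1); rewrite -(cos2pi_int s n) => c.
exists n; have /andP[n1 n2] : n%:~R <= s + 2^-1 < (n + 1)%:~R by exact: floor_itv.
move: n2; rewrite rmorphD/= => n2.
have ns : `|s - n%:~R| <= 2^-1 by rewrite ler_norml; lra.
rewrite -ltr_cos_pi2 ?normr_ge0 ?ns//; last by rewrite (ltW r0) (ltW r1).
move: c; have [_|_] := ger0P (s - n%:~R) => //.
by rewrite -[cos (pi *+ 2 * (s - _))]cosN -mulrN.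
Qed.

Lemma dist_cos_lt (s r : R) : 0 < r < 2^-1 -> `|s| < r -> cos (pi *+ 2 * r) < cos (pi *+ 2 * s).
Proof.
move=> /andP[r0 r1] sr.
have : cos (pi *+ 2 * r) < cos (pi *+ 2 * `|s|).
  by rewrite ltr_cos_pi2 ?normr_ge0//=; lra.
by have [_|_] := ger0P s => //; rewrite mulrN cosN.
Qed.

End cosine.

Section trig_approximation.
Context {R : realType} {d : nat}.
Variables (om T : R).
Hypotheses (T0 : 0 < T) (omT : om * T = pi *+ 2).
Local Notation ST := (measurableTypeR R * torus R d)%type.
Local Notation unit_trig := (@unit_trig R d om).
Variable (mu : {finite_measure set ST -> \bar R}).
Hypothesis mu_slab : mu (~` slab T) = 0%E.
Local Notation appr := (approximable mu unit_trig).

Lemma unit_trig_measurable q : unit_trig q -> measurable_fun [set: ST] q.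
Proof. by move=> [tq _]; exact: trig_poly_measurable tq. Qed.

Lemma unit_trig_bounds q : unit_trig q -> forall x, 0 <= q x <= 1.
Proof. by case. Qed.

Lemma unit_trig1 : unit_trig (cst 1).
Proof. by split; [exact: trig_poly_cst|move=> z /=; rewrite ler01 lexx]. Qed.

Lemma unit_trigB q : unit_trig q -> unit_trig (fun z => 1 - q z).
Proof.
move=> [tq q01]; split=> [|z]; last by have := q01 z; lra.
rewrite (_ : (fun z => _) = (fun z => cst 1 z + cst (-1) z * q z)).
  apply: trig_polyD; first exact: trig_poly_cst.
  by apply: trig_polyM => //; exact: trig_poly_cst.
by apply/funext => z /=; rewrite mulN1r.
Qed.

Lemma unit_trigM q p : unit_trig q -> unit_trig p -> unit_trig (fun z => q z * p z).
Proof.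
move=> [tq q01] [tp p01]; split=> [|z]; first exact: trig_polyM.
by have := q01 z; have := p01 z; nra.
Qed.

Lemma appr0 : appr set0.
Proof. exact: (approximable0 mu unit_trig_measurable unit_trig_bounds unit_trig1 unit_trigB). Qed.

Lemma apprC A : appr A -> appr (~` A).
Proof. exact: (@approximableC _ _ _ mu unit_trig unit_trigB A). Qed.

Lemma apprI A B : appr A -> appr B -> appr (A `&` B).
Proof. exact: (@approximableI _ _ _ mu unit_trig unit_trig_measurable unit_trig_bounds unit_trigM A B). Qed.

Lemma appr_bigcup (F : (set ST)^nat) : (forall n, appr (F n)) -> appr (\bigcup_n F n).
Proof. exact: (@approximable_bigcup _ _ _ mu unit_trig unit_trig_measurable unit_trig_bounds unit_trig1 unit_trigB unit_trigM F). Qed.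

Lemma appr_bigcup_count (I : countType) (F : I -> set ST) :
  (forall i, appr (F i)) -> appr (\bigcup_i F i).
Proof.
move=> aF; pose G n := if choice.unpickle n is Some i then F i else set0.
rewrite (_ : \bigcup_i F i = \bigcup_n G n); last first.
  apply/seteqP; split=> [z [i _ Fi]|z [n _]].
    by exists (choice.pickle i) => //; rewrite /G choice.pickleK.
  by rewrite /G; case: choice.unpickle => // i Fi; exists i.
by apply: appr_bigcup => n; rewrite /G; case: choice.unpickle => [i|]; [exact: aF|exact: appr0].
Qed.

Lemma appr_bigcap_fin (I : finType) (F : I -> set ST) :
  (forall i, appr (F i)) -> appr [set z | forall i, F i z].
Proof.
move=> aF; rewrite (_ : mkset _ = ~` \bigcup_i (~` F i)).
  by apply: apprC; apply: appr_bigcup_count => i; exact: apprC.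
apply/seteqP; split=> [z Fz [i _]|z nF i]; first by apply; exact: Fz.
by apply: contrapT => nFi; apply: nF; exists i.
Qed.

Lemma appr_cos_gt (f : int * 'rV[int]_d) (a b : R) :
  appr [set z | cos b < complex.Re (expi a * tchar om f z)].
Proof.
(* Two numbers of modulus at most 1 differ by at most 2, so after division by 4 the weight stays in
   [0, 1]; it is below 1/2 exactly on the given set. *)
have q2 : unit_trig (fun z => 2^-1 - (complex.Re (expi a * tchar om f z) - cos b) / 4).
  split=> [|z].
    rewrite (_ : (fun z => _) = (fun z => cst (2^-1 + cos b / 4) z +
        cst (- 4^-1) z * complex.Re (expi a * tchar om f z))).
      apply: trig_polyD; first exact: trig_poly_cst.
      by apply: trig_polyM; [exact: trig_poly_cst|exists [:: (expi a, f)] => z; rewrite big_seq1].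
    by apply/funext => z /=; lra.
  have := normRe_le (expi a * tchar om f z); rewrite normcM normc_expi normc_tchar mulr1.
  by move=> /ler_normlP[]; have := cos_le1 b; have := cos_geN1 b; lra.
have := approximable_lt mu unit_trig_measurable unit_trig_bounds unit_trig1 unit_trigB unit_trigM q2.
congr approximable; apply/seteqP; split=> z /=; lra.
Qed.

Lemma appr_preimage (X : Type) (f : ST -> X) (G : set (set X)) :
  (forall B, G B -> appr (f @^-1` B)) -> forall B, <<s G >> B -> appr (f @^-1` B).
Proof.
move=> GB; apply: smallest_sub => //; split.
- by rewrite /mkset preimage_set0; exact: appr0.
- by move=> A aA; rewrite setTD preimage_setC; exact: apprC.
- by move=> F aF; rewrite /mkset preimage_bigcup; exact: appr_bigcup.
Qed.

(** Half-lines generate the Borel sets. On the slab time runs through one period, so t < x describes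
    an arc of centre x/2 and half-length x/2, a superlevel set of a cosine; outside the slab [mu]
    vanishes. *)
Lemma appr_time (B : set (measurableTypeR R)) : measurable B -> appr (fst @^-1` B).
Proof.
rewrite [measurable](RGenInftyO.measurableE R) => mB.
apply: (@appr_preimage _ fst) mB => _ [x ->].
have mx : measurable (fst @^-1` `]-oo, x[ : set ST).
  by rewrite -[_ @^-1` _]setTI; exact: measurable_fst.
have p0 := pi_gt0 R.
have slab_ae (A : set ST) : appr A -> (forall z, slab T z -> A z <-> z.1 < x) ->
    appr (fst @^-1` `]-oo, x[).
  move=> aA Ax; apply: (@approximable_ae _ _ _ mu unit_trig unit_trig_measurable A _ aA mx).
  exists (~` slab T); split => //.
    apply: measurableC; apply: measurableX => //.
  move=> z /= nz sz; apply: nz; rewrite /= in_itv/=; exact: Ax.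
have [x0|x0] := leP x 0.
  apply: slab_ae appr0 _ => z [+ _]; rewrite /= in_itv/= => /andP[z0 _].
  by split=> // zx; have := lt_trans zx (le_lt_trans x0 z0); rewrite ltxx.
have [xT|xT] := leP T x.
  apply: slab_ae (apprC appr0) _ => z [+ _]; rewrite /= in_itv/= => /andP[_ zT].
  by split=> [_|_ []]; exact: lt_le_trans zT xT.
have om0 : 0 < om by rewrite -(pmulr_lgt0 _ T0) omT mulrn_wgt0.
apply: slab_ae (appr_cos_gt (1, 0) (- (om * x / 2)) (om * x / 2)) _ => z sz.
have /andP[z0 zT] : 0 < z.1 < T by case: sz => + _; rewrite /= in_itv.
have zt a : complex.Re (expi a * tchar om (1, 0) z) = cos (a + om * z.1).
  rewrite /tchar [X in _ * (_ * X)](_ : _ = 1) ?mulr1; last exact: torus_char0.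
  by rewrite -expiD.
suff : cos (om * x / 2) < cos (- (om * x / 2) + om * z.1) <-> z.1 < x by rewrite -zt.
(* The difference of the two cosines is -2 sin u sin v with u in ]0, pi[ and v in ]-pi, pi[, hence
   has the sign of -v. *)
set u := om * z.1 / 2; set v := om * (z.1 - x) / 2.
have -> : - (om * x / 2) + om * z.1 = u + v by rewrite /u /v; field.
have -> : om * x / 2 = u - v by rewrite /u /v; field.
rewrite -subr_gt0 (_ : _ - _ = - (2 * sin u * sin v)); last by rewrite -cos_sub; ring.
have u0 : 0 < sin u.
  apply: sin_gt0_pi; rewrite divr_gt0 ?mulr_gt0//= ltr_pdivrMr// mulr_natr -omT.
  by rewrite ltr_pM2l.
have vpi : - pi < v < pi.
  rewrite /v; have : om * (z.1 - x) < om * T by rewrite ltr_pM2l//; lra.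
  have : om * (- T) < om * (z.1 - x) by rewrite ltr_pM2l//; lra.
  by rewrite mulrN omT -mulr_natr; lra.
have [zx|zx] := ltP z.1 x.
  have v0 : v < 0 by rewrite /v ltr_pdivrMr// mul0r pmulr_rlt0//; lra.
  have : 0 < sin (- v) by apply: sin_gt0_pi; lra.
  rewrite sinN; split=> // _; nra.
have v0 : 0 <= v by rewrite /v divr_ge0// mulr_ge0// ?(ltW om0)//; lra.
have : 0 <= sin v by apply: sin_ge0_pi; lra.
split=> //; nra.
Qed.

(** An open set of the torus is a countable union of boxes with rational centres, and a box is a
    finite intersection of arcs, one for each coordinate. *)
Lemma appr_torus (B : set (torus R d)) : measurable B -> appr (snd @^-1` B).
Proof.
apply: (@appr_preimage _ snd) => U oU.
(* The shift by 3 keeps the radius below 1/2, as [cos_dist_int] requires. *)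
pose rad (n : nat) : R := n.+3%:R^-1.
have rad0 n : 0 < rad n < 2^-1.
  by rewrite invr_gt0 ltr0n ltf_pV2 ?posrE ?ltr0n// ltr_nat.
pose C (k : d.-tuple rat * nat) : set ST := [set z | forall i : 'I_d,
  cos (pi *+ 2 * rad k.2) <
  complex.Re (expi (- (pi *+ 2 * ratr (tnth k.1 i))) * tchar om (0, delta_mx 0 i) z)].
have CE k z : C k z <-> forall i, cos (pi *+ 2 * rad k.2) <
    cos (pi *+ 2 * (repr z.2 0 i - ratr (tnth k.1 i))).
  have phE i : phase (delta_mx 0 i) (repr z.2) = pi *+ 2 * repr z.2 0 i.
    congr (_ * _); rewrite (bigD1 i)//= mxE !eqxx mul1r big1 ?addr0// => j ji.
    by rewrite mxE eqxx/= (negbTE ji) mul0r.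
  have E i : complex.Re (expi (- (pi *+ 2 * ratr (tnth k.1 i))) * tchar om (0, delta_mx 0 i) z) =
      cos (pi *+ 2 * (repr z.2 0 i - ratr (tnth k.1 i))).
    rewrite /tchar [X in expi X * torus_char _ _](_ : _ = 0); last by rewrite /= mulr0 mul0r.
    rewrite expi0 mul1r /torus_char -expiD phE.
    by rewrite mulrBr addrC.
  by split=> H i; have := H i; rewrite E.
pose F k := if `[< C k `<=` snd @^-1` U >] then C k else set0.
have -> : snd @^-1` U = \bigcup_k F k.
  apply/seteqP; split=> [z Uz|z [k _]]; last by rewrite /F; case: asboolP => // CU Cz; exact: CU.
  have : nbhs (repr z.2) (@torus_proj R d @^-1` U).
    apply: open_nbhs_nbhs; split=> //=.
    by rewrite /torus_proj (reprK z.2).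
  move=> /nbhs_ballP[e /= e0 eU].
  have [n ne] : exists n : nat, rad n < e / 2.
    have e20 : 0 < e / 2 by rewrite divr_gt0.
    have /filter_ex[n nP] := near_infty_natSinv_lt (PosNum e20).
    by exists n; apply: le_lt_trans nP; rewrite /rad lef_pV2 ?posrE ?ltr0n// ler_nat; lia.
  have q i : {q : rat | `|repr z.2 0 i - ratr q| < rad n}.
    apply: cid; have /andP[r0 _] := rad0 n.
    have [q] := rat_in_itvoo (ltr_pwDr r0 (lexx (repr z.2 0 i))).
    rewrite in_itv/= => /andP[q1 q2]; exists q; rewrite ltr_norml; lra.
  pose k := ([tuple sval (q i) | i < d], n).
  have kz : C k z.
    by apply/CE => i; apply: dist_cos_lt => //=; rewrite tnth_mktuple; exact: (svalP (q i)).
  exists k => //; rewrite /F; case: asboolP => // -[] z' /CE z'k /=.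
  have m i : {m : int | `|repr z'.2 0 i - ratr (sval (q i)) - m%:~R| < rad n}.
    by apply: cid; apply: cos_dist_int => //; have := z'k i; rewrite tnth_mktuple.
  have -> : z'.2 = torus_proj (repr z'.2 - \row_i (sval (m i))%:~R).
    rewrite -[LHS](reprK z'.2); apply/eqquotP/forallP => i.
    by rewrite !mxE opprB addrC subrK intr_int.
  apply: eU; split=> // a i; rewrite ord1 !mxE /ball/=.
  have := svalP (q i); have := svalP (m i); set q' : R := ratr _; set m' : R := _%:~R.
  by rewrite !ltr_norml; lra.
apply: appr_bigcup_count => k; rewrite /F; case: asboolP => _; last exact: appr0.
by apply: appr_bigcap_fin => i; exact: appr_cos_gt.
Qed.

Lemma appr_measurable (A : set ST) : measurable A -> appr A.
Proof.
rewrite measurable_prod_measurableType; apply: (@approximable_sigma _ _ _ mu unit_trig unit_trig_measurable unit_trig_bounds unit_trig1 unit_trigB unit_trigM).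
move=> _ [B mB [C mC <-]]; rewrite (_ : B `*` C = fst @^-1` B `&` snd @^-1` C)//.
by apply: apprI; [exact: appr_time|exact: appr_torus].
Qed.

End trig_approximation.

(** * Density of trigonometric polynomials in L^2 *)

Section L2_facts.
Context {dd : measure_display} {X : measurableType dd} {R : realType}.
Variable mu : {measure set X -> \bar R}.

Lemma L2_measurable (u : L2 mu) : measurable_fun [set: X] (fun x => normc (u x)).
Proof. by have [mr mi _] := sqfunP (L2_repr u); exact: measurable_normc mr mi. Qed.

Lemma Lnorm2E (f : X -> R) : (forall x, 0 <= f x) ->
  (Lnorm mu 2%:E (EFin \o f) `^ 2 = \int[mu]_x (f x ^+ 2)%:E)%E.
Proof.
move=> f0; rewrite unlock -poweRrM mulVf ?pnatr_eq0// poweRe1; last first.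
  by apply: integral_ge0 => x _; exact: poweR_ge0.
by apply: eq_integral => x _; rewrite /= ger0_norm// -powR_mulrn.
Qed.

Lemma L2_norm_sqr (u : L2 mu) : (\int[mu]_x (normc (u x) ^+ 2)%:E = (rnorm u ^+ 2)%:E)%E.
Proof.
rewrite -Lnorm2E; last by move=> x; exact: normc_ge0.
have -> : Lnorm mu 2%:E (EFin \o (fun x => normc (u x))) = (rnorm u)%:E.
  by rewrite /rnorm /= fineK//; exact: (Lnorm_fin (L2_repr u)).
by rewrite poweR_EFin powR_mulrn// rnorm_ge0.
Qed.

Lemma L2_class_norm_sqr (f : sqfun mu) :
  (\int[mu]_x (normc (f x) ^+ 2)%:E = (rnorm (L2_class f) ^+ 2)%:E)%E.
Proof.
rewrite -L2_norm_sqr; apply: ge0_ae_eq_integral => //.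
- have [mr mi _] := sqfunP f; apply/measurable_EFinP; apply: measurable_funX.
  exact: measurable_normc.
- by apply/measurable_EFinP; apply: measurable_funX; exact: L2_measurable.
- by move=> x _; rewrite lee_fin sqr_ge0.
- by move=> x _; rewrite lee_fin sqr_ge0.
- by apply: filterS (L2_class_funE f) => x ->.
Qed.

Lemma sqint_of_sqr (f : X -> R[i]) :
  measurable_fun [set: X] (fun x => complex.Re (f x)) ->
  measurable_fun [set: X] (fun x => complex.Im (f x)) ->
  (\int[mu]_x (normc (f x) ^+ 2)%:E < +oo)%E -> sqint mu f.
Proof.
move=> mr mi fin; split => //; rewrite /finite_norm.
rewrite ltNge leye_eq; apply/negP => /eqP Ly; move: fin.
by rewrite -Lnorm2E ?Ly ?poweRyr// => x; exact: normc_ge0.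
Qed.

Lemma L2_addr (u v : L2 mu) : {ae mu, forall x, L2_fun (u + v) x = u x + v x}.
Proof.
exact: (L2_class_funE (L2_repr u + L2_repr v)).
Qed.

Lemma L2_scaler (c : R[i]) (u : L2 mu) : {ae mu, forall x, L2_fun (c *: u) x = c * u x}.
Proof.
exact: (L2_class_funE (c *: L2_repr u)).
Qed.

Lemma L2_zeror : {ae mu, forall x, L2_fun (0 : L2 mu) x = 0}.
Proof. exact: (L2_class_funE (0 : sqfun mu)). Qed.

Lemma L2_sqr_ae (u : L2 mu) (f : X -> R[i]) :
  measurable_fun [set: X] (fun x => complex.Re (f x)) ->
  measurable_fun [set: X] (fun x => complex.Im (f x)) ->
  {ae mu, forall x, u x = f x} ->
  (\int[mu]_x (normc (f x) ^+ 2)%:E = (rnorm u ^+ 2)%:E)%E.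
Proof.
move=> mr mi uf; rewrite -L2_norm_sqr; apply: ge0_ae_eq_integral => //.
- by apply/measurable_EFinP; apply: measurable_funX; exact: measurable_normc.
- by apply/measurable_EFinP; apply: measurable_funX; exact: L2_measurable.
- by move=> x _; rewrite lee_fin sqr_ge0.
- by move=> x _; rewrite lee_fin sqr_ge0.
- by apply: filterS uf => x ->.
Qed.

End L2_facts.

(** * Real trigonometric polynomials in L^2 of the torus *)

Section real_density.
Import HBNNSimple.
Context {R : realType} {d : nat}.
Local Notation X := (torus R d).
Local Notation mu := (torus_measure R d).
Implicit Types f g h : X -> R.

Definition torus_trig f : Prop :=
  exists s : seq (R[i] * 'rV[int]_d), forall x, f x = \sum_(p <- s) complex.Re (p.1 * torus_char p.2 x).

Lemma torus_trig_measurable f : torus_trig f -> measurable_fun [set: X] f.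
Proof.
move=> [s fs]; rewrite (_ : f = fun x => \sum_(p <- s) complex.Re (p.1 * torus_char p.2 x));
  last exact/funext.
by apply: measurable_sum => p; exact: measurable_torus_char.
Qed.

Lemma torus_trigD f g : torus_trig f -> torus_trig g -> torus_trig (fun x => f x + g x).
Proof. by move=> [s fs] [t gt]; exists (s ++ t) => x; rewrite big_cat fs gt. Qed.

Lemma torus_trigZ c f : torus_trig f -> torus_trig (fun x => c * f x).
Proof.
move=> [s fs]; exists [seq (c%:C * p.1, p.2) | p <- s] => x.
rewrite big_map fs mulr_sumr; apply: eq_bigr => p _ /=; rewrite -mulrA.
by case: (p.1 * _) => a b; simpc.
Qed.

(** The square of the L^2 distance; the inequality (x + y)^2 <= 2 x^2 + 2 y^2 then takes the place
    of the triangle inequality. *)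
Definition L2dist f g : \bar R := (\int[mu]_x ((f x - g x) ^+ 2)%:E)%E.

Lemma measurable_sqrB f g : measurable_fun [set: X] f -> measurable_fun [set: X] g ->
  measurable_fun [set: X] (fun x => ((f x - g x) ^+ 2)%:E).
Proof. by move=> mf mg; apply/measurable_EFinP; apply: measurable_funX; exact: measurable_funB. Qed.

Lemma L2dist_le (a b p q r s : X -> R) :
  measurable_fun [set: X] a -> measurable_fun [set: X] b ->
  measurable_fun [set: X] p -> measurable_fun [set: X] q ->
  measurable_fun [set: X] r -> measurable_fun [set: X] s ->
  (forall x, (a x - b x) ^+ 2 <= 2 * (p x - q x) ^+ 2 + 2 * (r x - s x) ^+ 2) ->
  (L2dist a b <= 2%:E * L2dist p q + 2%:E * L2dist r s)%E.
Proof.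
move=> ma mb mp mq mr ms H; rewrite /L2dist -!ge0_integralZl//; last 4 first.
- exact: measurable_sqrB.
- by move=> x _; rewrite lee_fin sqr_ge0.
- exact: measurable_sqrB.
- by move=> x _; rewrite lee_fin sqr_ge0.
rewrite -ge0_integralD//; last 4 first.
- by move=> x _; rewrite -EFinM lee_fin mulr_ge0 ?sqr_ge0.
- by apply: measurable_funeM; exact: measurable_sqrB.
- by move=> x _; rewrite -EFinM lee_fin mulr_ge0 ?sqr_ge0.
- by apply: measurable_funeM; exact: measurable_sqrB.
apply: ge0_le_integral => //.
- by move=> x _; rewrite lee_fin sqr_ge0.
- exact: measurable_sqrB.
- by apply: emeasurable_funD; apply: measurable_funeM; exact: measurable_sqrB.
- by move=> x _; rewrite -!EFinM -EFinD lee_fin; exact: H.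
Qed.

Definition L2_approx f : Prop :=
  measurable_fun [set: X] f /\
  forall e : R, 0 < e -> exists2 g, torus_trig g & (L2dist f g < e%:E)%E.

Lemma L2_approxD f g : L2_approx f -> L2_approx g -> L2_approx (fun x => f x + g x).
Proof.
move=> [mf fe] [mg ge]; split; first exact: measurable_funD.
move=> e e0; have e4 : 0 < e / 4 by rewrite divr_gt0.
have [f' tf' ff'] := fe _ e4; have [g' tg' gg'] := ge _ e4.
exists (fun x => f' x + g' x); first exact: torus_trigD.
have mf' := torus_trig_measurable tf'; have mg' := torus_trig_measurable tg'.
apply: (@le_lt_trans _ _ (2%:E * L2dist f f' + 2%:E * L2dist g g')%E).
  apply: L2dist_le => //; [exact: measurable_funD|exact: measurable_funD|].
  move=> x; have := sqr_ge0 ((f x - f' x) - (g x - g' x)); rewrite !expr2; lra.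
have -> : e%:E = (2%:E * (e / 4)%:E + 2%:E * (e / 4)%:E)%E by rewrite -!EFinM -EFinD; congr EFin; lra.
by apply: lteD; rewrite lte_pmul2l.
Qed.

Lemma L2_approx_lim f : measurable_fun [set: X] f ->
  (forall e : R, 0 < e -> exists2 g, L2_approx g & (L2dist f g < e%:E)%E) -> L2_approx f.
Proof.
move=> mf H; split=> // e e0; have e4 : 0 < e / 4 by rewrite divr_gt0.
have [g [mg ge] fg] := H _ e4; have [g' tg' gg'] := ge _ e4.
exists g' => //; have mg' := torus_trig_measurable tg'.
apply: (@le_lt_trans _ _ (2%:E * L2dist f g + 2%:E * L2dist g g')%E).
  apply: L2dist_le => //.
  move=> x; have := sqr_ge0 ((f x - g x) - (g x - g' x)); rewrite !expr2; lra.
have -> : e%:E = (2%:E * (e / 4)%:E + 2%:E * (e / 4)%:E)%E by rewrite -!EFinM -EFinD; congr EFin; lra.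
by apply: lteD; rewrite lte_pmul2l.
Qed.

Lemma L2_approxZ c f : L2_approx f -> L2_approx (fun x => c * f x).
Proof.
move=> [mf fe]; split; first exact: measurable_funM.
move=> e e0; have c0 : 0 < c ^+ 2 + 1 by rewrite ltr_wpDl ?sqr_ge0.
have [g tg fg] := fe (e / (c ^+ 2 + 1)) (divr_gt0 e0 c0).
exists (fun x => c * g x); first exact: torus_trigZ.
have mg := torus_trig_measurable tg.
apply: (@le_lt_trans _ _ ((c ^+ 2 + 1)%:E * L2dist f g)%E).
  rewrite /L2dist -ge0_integralZl//; last 3 first.
  - exact: measurable_sqrB.
  - by move=> x _; rewrite lee_fin sqr_ge0.
  - by rewrite lee_fin ltW.
  apply: ge0_le_integral => //.
  - by move=> x _; rewrite lee_fin sqr_ge0.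
  - by apply: measurable_sqrB; exact: measurable_funM.
  - by apply: measurable_funeM; exact: measurable_sqrB.
  - move=> x _; rewrite -EFinM lee_fin -mulrBr exprMn ler_wpM2r ?sqr_ge0//; lra.
have -> : e%:E = ((c ^+ 2 + 1)%:E * (e / (c ^+ 2 + 1))%:E)%E.
  by rewrite -EFinM; congr EFin; field; rewrite gt_eqF.
by rewrite lte_pmul2l.
Qed.

Local Notation ST := (measurableTypeR R * torus R d)%type.

Definition time_slice (t : R) (x : torus R d) : ST := (t, x).

Lemma measurable_time_slice t : measurable_fun [set: torus R d] (time_slice t).
Proof. by apply: measurable_fun_pair => //; exact: measurable_cst. Qed.

HB.instance Definition _ t := isMeasurableFun.Build _ _ _ _ (time_slice t) (measurable_time_slice t).

Lemma torus_trig_slice om (F : R * torus R d -> R) t : trig_poly om F ->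
  torus_trig (fun x => F (t, x)).
Proof.
move=> [s Fs]; exists [seq (p.1 * expi (om * p.2.1%:~R * t), p.2.2) | p <- s] => x.
by rewrite big_map Fs; apply: eq_bigr => p _; rewrite /tchar mulrA.
Qed.

(** The space-time result is reused with the torus measure placed at time 1/2 of the slab of length
    1. The error is at most 1 in modulus, so its square is bounded by the error itself and L^1
    closeness suffices. *)
Lemma L2_approx_indic (A : set X) : measurable A -> L2_approx (\1_A).
Proof.
move=> mA; split; first exact: measurable_indic.
move=> e e0.
pose nu : {finite_measure set ST -> \bar R} := distribution mu (time_slice 2%:R^-1).
have nu0 : nu (~` slab 1) = 0%E.
  rewrite /nu /= /distribution /pushforward (_ : _ @^-1` _ = set0) ?measure0//.
  apply/seteqP; split=> // x /=; apply; split=> //=; rewrite in_itv/=; lra.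
have om1 : pi *+ 2 * 1 = pi *+ 2 :> R by rewrite mulr1.
have mTA : measurable ([set: measurableTypeR R] `*` A) by exact: measurableX.
have [_ [_ _ /(_ _ e0)[q [tq q01] qA]]] := appr_measurable ltr01 om1 nu0 mTA.
exists (fun x => q (2%:R^-1, x)); first exact: torus_trig_slice tq.
have mq := trig_poly_measurable tq.
apply: le_lt_trans qA; rewrite ge0_integral_distribution//; last first.
  apply/measurable_EFinP; apply: measurableT_comp => //; apply: measurable_funB => //.
  exact: (@measurable_indic _ _ _ _ ([set: measurableTypeR R] `*` A)).
apply: ge0_le_integral => //.
- by move=> x _; rewrite lee_fin sqr_ge0.
- apply: measurable_sqrB; first exact: measurable_indic.
  exact: torus_trig_measurable (torus_trig_slice _ tq).
- apply: measurableT_comp; last exact: measurable_time_slice.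
  apply/measurable_EFinP; apply: measurableT_comp => //; apply: measurable_funB => //.
  exact: (@measurable_indic _ _ _ _ ([set: measurableTypeR R] `*` A)).
move=> x _ /=; rewrite lee_fin indicE.
have -> : (time_slice 2%:R^-1 x \in [set: measurableTypeR R] `*` A) = (x \in A).
  by apply/idP/idP; rewrite !inE /=; [case|split].
have := q01 (2%:R^-1, x); rewrite -[q (time_slice _ _)]/(q (2%:R^-1, x)).
move: (q _) => y /andP[y0 y1]; case: (x \in A) => /=.
  by rewrite ler0_norm ?subr_le0//; nra.
by rewrite !(sub0r, subr0) ger0_norm//; nra.
Qed.

Lemma L2_approx_nnsfun (h : {nnsfun X >-> R}) : L2_approx h.
Proof.
suff : L2_approx (fun x => \sum_(y \in range h) (y * \1_(h @^-1` [set y]) x)).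
  by congr L2_approx; apply/funext => x; rewrite -fimfunE.
have -> : (fun x => \sum_(y \in range h) (y * \1_(h @^-1` [set y]) x)) =
    (fun x => \sum_(y <- finmap.enum_fset (fset_set (range h))) (y * \1_(h @^-1` [set y]) x)).
  by apply/funext => x; rewrite fsbig_finite.
elim: (finmap.enum_fset _) => [|y s IH].
  rewrite (_ : (fun x => _) = (fun x => 0 * \1_(set0 : set X) x)).
    by apply: L2_approxZ; apply: L2_approx_indic.
  by apply/funext => x; rewrite big_nil mul0r.
rewrite (_ : (fun x => _) = (fun x => y * \1_(h @^-1` [set y]) x +
   \sum_(y <- s) (y * \1_(h @^-1` [set y]) x))); last by apply/funext => x; rewrite big_cons.
by apply: L2_approxD => //; apply: L2_approxZ; apply: L2_approx_indic.
Qed.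

(** Simple functions h_n increase to f, and dominated convergence applies because (f - h_n)^2 <=
    f^2. *)
Lemma L2_approx_ge0 f : measurable_fun [set: X] f -> (forall x, 0 <= f x) ->
  (\int[mu]_x (f x ^+ 2)%:E < +oo)%E -> L2_approx f.
Proof.
move=> mf f0 fin; apply: L2_approx_lim => // e e0.
have mf' : measurable_fun [set: X] (EFin \o f) by apply/measurable_EFinP.
have f0' x : [set: X] x -> (0 <= (EFin \o f) x)%E by move=> _; rewrite lee_fin.
pose h := nnsfun_approx measurableT mf'.
have hf n x : h n x <= f x.
  by rewrite -lee_fin /h nnsfun_approxE; exact: le_approx.
have h0 n x : 0 <= h n x by [].
have [|||||_ _ lim] := @dominated_convergence _ X R mu [set: X] measurableT
  (fun n x => ((f x - h n x) ^+ 2)%:E) (cst 0%E) (fun x => (f x ^+ 2)%:E).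
- by move=> n; apply: measurable_sqrB.
- by [].
- apply: aeW => x _; apply: cvg_EFin; first exact: nearW.
  have hx : h n x @[n --> \oo] --> f x.
    by have /fine_cvgP[_] := cvg_nnsfun_approx measurableT mf' f0' (I : [set: X] x).
  rewrite (_ : fine \o _ = fun n => (f x - h n x) * (f x - h n x)); last first.
    by apply/funext => n /=; rewrite expr2.
  have : (f x - h n x) * (f x - h n x) @[n --> \oo] --> (f x - f x) * (f x - f x).
    by apply: cvgM; apply: cvgB => //; exact: cvg_cst.
  by rewrite subrr mulr0.
- apply/integrableP; split; first by apply/measurable_EFinP; apply: measurable_funX.
  by under eq_integral do rewrite abse_EFin ger0_norm ?sqr_ge0//.
- apply: aeW => x n _; rewrite /= lee_fin ger0_norm ?sqr_ge0//.
  by rewrite ler_pXn2r ?nnegrE ?subr_ge0 ?hf// gerBl.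
rewrite integral0 in lim.
have /fine_cvgP[fin' /cvgrPdist_lt/(_ _ e0) lim'] := lim.
near \oo => n; exists (h n); first exact: L2_approx_nnsfun.
have fn : (\int[mu]_x ((f x - h n x) ^+ 2)%:E)%E \is a fin_num by near: n.
rewrite /L2dist -(fineK fn) lte_fin.
have : `|0 - (fine \o (fun n => \int[mu]_x ((f x - h n x) ^+ 2)%:E)%E) n| < e by near: n.
rewrite sub0r normrN ger0_norm// fine_ge0// integral_ge0// => x _.
by rewrite lee_fin sqr_ge0.
Unshelve. all: by end_near. Qed.

Lemma L2_approx_all f : measurable_fun [set: X] f ->
  (\int[mu]_x (f x ^+ 2)%:E < +oo)%E -> L2_approx f.
Proof.
move=> mf fin.
have -> : f = fun x => Num.max (f x) 0 + -1 * Num.max (- f x) 0.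
  by apply/funext => x; rewrite /Num.max; case: ifP; case: ifP; lra.
have fle g : measurable_fun [set: X] g -> (forall x, g x = f x \/ g x = - f x) ->
    L2_approx (fun x => Num.max (g x) 0).
  move=> mg gf; apply: L2_approx_ge0.
  - by apply: measurable_maxr.
  - by move=> x; rewrite le_max lexx orbT.
  - apply: le_lt_trans fin; apply: ge0_le_integral => //.
    + by move=> x _; rewrite lee_fin sqr_ge0.
    + by apply/measurable_EFinP; apply: measurable_funX; apply: measurable_maxr.
    + by apply/measurable_EFinP; apply: measurable_funX.
    + move=> x _; rewrite lee_fin; have := sqr_ge0 (f x).
      have [g0|g0] := leP (g x) 0; first by rewrite expr0n.
      by case: (gf x) => ->; rewrite ?sqrrN.
apply: L2_approxD; first by apply: fle => // x; left.
by apply: L2_approxZ; apply: fle => [|x]; [exact: measurableT_comp|right].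
Qed.

End real_density.

(** * Finite sums of characters as elements of L^2 *)

Section character_sums.
Context {R : realType} {d : nat}.
Local Notation X := (torus R d).
Local Notation mu := (torus_measure R d).
Local Notation E := (L2_torus R d).

Lemma ReM1 (z : R[i]) : complex.Re (1 * z) = complex.Re z.
Proof. by rewrite mul1r. Qed.

Lemma Im_Re (z : R[i]) : complex.Im z = complex.Re (- 'i%C * z).
Proof. by case: z => a b; simpc. Qed.

Lemma measurable_torus_charRe tau : measurable_fun [set: X] (fun x => complex.Re (torus_char tau x)).
Proof. by under eq_fun do rewrite -ReM1; exact: measurable_torus_char. Qed.

Lemma measurable_torus_charIm tau : measurable_fun [set: X] (fun x => complex.Im (torus_char tau x)).
Proof. by under eq_fun do rewrite Im_Re; exact: measurable_torus_char. Qed.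

Lemma sqint_torus_char tau : sqint mu (@torus_char R d tau).
Proof.
apply: sqint_of_sqr; [exact: measurable_torus_charRe|exact: measurable_torus_charIm|].
under eq_integral do rewrite normc_expi expr1n.
by rewrite integral_cst// mul1e [X in (X < _)%E]probability_setT ltry.
Qed.

Definition torus_char_sq tau : sqfun mu := SqFun (introT (asboolP _) (sqint_torus_char tau)).

Definition torus_char_class tau : E := L2_class (torus_char_sq tau).

Lemma torus_char_classE tau : {ae mu, forall x, torus_char_class tau x = torus_char tau x}.
Proof. exact: (L2_class_funE (torus_char_sq tau)). Qed.

Definition char_sum (I : finType) (kappa : I -> 'rV[int]_d) (c : I -> R[i]) (x : X) : R[i] :=
  \sum_i c i * torus_char (kappa i) x.

Definition char_sum_class (I : finType) (kappa : I -> 'rV[int]_d) (c : I -> R[i]) : E :=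
  \sum_i c i *: torus_char_class (kappa i).

Lemma char_sum_classE (I : finType) (kappa : I -> 'rV[int]_d) (c : I -> R[i]) :
  {ae mu, forall x, char_sum_class kappa c x = char_sum kappa c x}.
Proof.
rewrite /char_sum_class /char_sum; elim: (index_enum I) => [|i s IH].
  by apply: filterS (L2_zeror mu) => x; rewrite !big_nil.
rewrite big_cons.
apply: filterS3 IH (L2_addr (c i *: torus_char_class (kappa i)) (\sum_(i <- s) c i *: torus_char_class (kappa i)))
  (filterI (L2_scaler (c i) (torus_char_class (kappa i))) (torus_char_classE (kappa i))) => x IHx Dx [Sx cx].
by rewrite big_cons Dx Sx cx IHx.
Qed.

(** Terms of equal frequency are grouped, since Parseval's identity and the cluster bounds require
    [kappa] to be injective. *)
Lemma seq_char_sum (s : seq (R[i] * 'rV[int]_d)) :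
  exists (I : finType) (kappa : I -> 'rV[int]_d) (c : I -> R[i]), injective kappa /\
    forall x, \sum_(p <- s) p.1 * torus_char p.2 x = char_sum kappa c x.
Proof.
pose K := undup [seq p.2 | p <- s].
exists 'I_(size K), (fun i : 'I_(size K) => nth 0 K i),
  (fun i : 'I_(size K) => \sum_(p <- s | p.2 == nth 0 K i) p.1); split.
  move=> i j /eqP; rewrite nth_uniq ?undup_uniq// => /eqP ij; exact: val_inj.
move=> x; rewrite /char_sum.
transitivity (\sum_(k <- K) (\sum_(p <- s | p.2 == k) p.1) * torus_char k x); last first.
  by rewrite (big_nth 0) big_mkord.
under [RHS]eq_bigr do rewrite mulr_suml big_mkcond.
rewrite exchange_big/= big_seq [RHS]big_seq; apply: eq_bigr => p ps.
rewrite -big_mkcond/= (eq_bigl (pred1 p.2)) => [|k]; last by rewrite /= eq_sym.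
rewrite (eq_bigr (fun=> p.1 * torus_char p.2 x)) => [|k /eqP -> //].
rewrite -big_filter filter_pred1_uniq ?undup_uniq ?mem_undup ?map_f//.
by rewrite big_seq1.
Qed.

Lemma conj_average (w a z : R[i]) :
  w * 2%:R^-1%:C * a * z + w * 2%:R^-1%:C * Num.conj a * Num.conj z = w * (complex.Re (a * z))%:C.
Proof.
have cE (u : R[i]) : Num.conj u = complex.Re u -i* complex.Im u by case: u.
rewrite !cE; case: w a z => [w1 w2] [a b] [u v].
by apply/eqP; rewrite eq_complex; apply/andP; split; apply/eqP => /=; field.
Qed.

Lemma char_sum_dense (v : E) (e : R) : 0 < e ->
  exists (I : finType) (kappa : I -> 'rV[int]_d) (c : I -> R[i]),
    injective kappa /\ rnorm (v - char_sum_class kappa c) < e.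
Proof.
move=> e0; have e2 : 0 < e ^+ 2 / 2 by rewrite divr_gt0// exprn_gt0.
have [mr mi _] := sqfunP (L2_repr v).
have fin : (\int[mu]_x (normc (v x) ^+ 2)%:E < +oo)%E by rewrite L2_norm_sqr ltry.
have nE (z : R[i]) : normc z ^+ 2 = complex.Re z ^+ 2 + complex.Im z ^+ 2.
  by case: z => a b; rewrite /= sqr_sqrtr// addr_ge0 ?sqr_ge0.
have fin' (f : X -> R) : measurable_fun [set: X] f ->
    (forall x, f x ^+ 2 <= normc (v x) ^+ 2) -> (\int[mu]_x (f x ^+ 2)%:E < +oo)%E.
  move=> mf fv; apply: le_lt_trans fin; apply: ge0_le_integral => //.
  - by move=> x _; rewrite lee_fin sqr_ge0.
  - by apply/measurable_EFinP; apply: measurable_funX.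
  - by apply/measurable_EFinP; apply: measurable_funX; exact: L2_measurable.
  - by move=> x _; rewrite lee_fin.
have [_ /(_ _ e2)[g [s gs] vg]] : L2_approx (fun x => complex.Re (v x)).
  by apply: L2_approx_all => //; apply: fin' => // x; rewrite nE lerDl sqr_ge0.
have [_ /(_ _ e2)[h [t ht] vh]] : L2_approx (fun x => complex.Im (v x)).
  by apply: L2_approx_all => //; apply: fin' => // x; rewrite nE lerDr sqr_ge0.
(* [half w r] writes w times the real polynomial given by [r] as a complex sum: each real part is
   the half-sum of a character term and its conjugate, of frequency [- p.2]. *)
pose half (w : R[i]) (r : seq (R[i] * 'rV[int]_d)) :=
  [seq (w * 2%:R^-1%:C * p.1, p.2) | p <- r] ++ [seq (w * 2%:R^-1%:C * p.1^*, - p.2) | p <- r].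
have halfE w r x : \sum_(p <- half w r) p.1 * torus_char p.2 x =
    w * (\sum_(p <- r) complex.Re (p.1 * torus_char p.2 x))%:C.
  rewrite big_cat !big_map/= -big_split rmorph_sum/= mulr_sumr; apply: eq_bigr => p _.
  have -> : torus_char (- p.2) x = (torus_char p.2 x)^*.
    rewrite /torus_char (_ : phase (- p.2) _ = - phase p.2 (repr x)) ?expiN//.
    rewrite /phase -mulrN -sumrN; congr (_ * _); apply: eq_bigr => i _.
    by rewrite !mxE rmorphN mulNr.
  exact: conj_average.
have [I [kappa [c [kI cE]]]] := seq_char_sum (half 1 s ++ half 'i%C t).
have {}cE x : char_sum kappa c x = g x +i* h x.
  by rewrite -cE big_cat/= !halfE -gs -ht mul1r; simpc.
exists I, kappa, c; split => //.
pose f x : R[i] := (complex.Re (v x) - g x) +i* (complex.Im (v x) - h x).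
have mg : measurable_fun [set: X] g by apply: torus_trig_measurable; exists s.
have mh : measurable_fun [set: X] h by apply: torus_trig_measurable; exists t.
have vf : {ae mu, forall x, (v - char_sum_class kappa c : E) x = f x}.
  have := L2_addr v (- char_sum_class kappa c).
  rewrite -scaleN1r; have := L2_scaler (-1) (char_sum_class kappa c).
  have := char_sum_classE kappa c.
  apply: filterS3 => x H1 H2 H3; rewrite H3 H2 H1 cE /f.
  by case: (v x) => a b; simpc.
rewrite -(ltr_pXn2r (n := 2)) ?nnegrE ?rnorm_ge0 ?ltW// -lte_fin.
have mf1 : measurable_fun [set: X] (fun x => complex.Re (f x)) by exact: measurable_funB.
have mf2 : measurable_fun [set: X] (fun x => complex.Im (f x)) by exact: measurable_funB.
rewrite -(L2_sqr_ae mf1 mf2 vf); under eq_integral do rewrite nE EFinD.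
rewrite ge0_integralD//; last 4 first.
- by move=> x _; rewrite lee_fin sqr_ge0.
- by apply/measurable_EFinP; apply: measurable_funX.
- by move=> x _; rewrite lee_fin sqr_ge0.
- by apply/measurable_EFinP; apply: measurable_funX.
by rewrite [e ^+ 2]splitr EFinD; apply: lteD.
Qed.

End character_sums.

(** * Derivatives of plane waves *)

Section smooth_characters.
Context {R : realType} {d : nat}.
Implicit Types (k : 'rV[int]_d) (w : R[i]).

Definition plane_wave k w (y : 'rV[R]_d) : R := complex.Re (w * expi (phase k y)).

Lemma phase_shift k (y : 'rV[R]_d) i h :
  phase k (h *: delta_mx 0 i + y) = pi *+ 2 * (k 0 i)%:~R * h + phase k y.
Proof.
rewrite /phase -mulrA -mulrDr; congr (_ * _).
rewrite (bigD1 i)//= [in RHS](bigD1 i)//= !mxE !eqxx/= addrA; congr (_ + _).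
  by rewrite mulr1 mulrDr.
by apply: eq_bigr => j ji; rewrite !mxE eqxx/= (negbTE ji) mulr0 add0r.
Qed.

Lemma is_derive_circle w (l h : R) : is_derive h 1 (fun h => complex.Re (w * expi (l * h)))
  (complex.Re (w * ('i%C * l%:C) * expi (l * h))).
Proof.
case: w => a b.
rewrite (_ : (fun h => _) = (fun h => a * cos (l * h) - b * sin (l * h))); last first.
  by apply/funext => t.
apply: is_derive_eq.
by rewrite /expi; simpc => /=; rewrite /GRing.scale/=; ring.
Qed.

Lemma is_derive_plane_wave k w y i : is_derive y (delta_mx 0 i) (plane_wave k w)
  (plane_wave k (w * ('i%C * (pi *+ 2 * (k 0 i)%:~R)%:C)) y).
Proof.
pose l : R := pi *+ 2 * (k 0 i)%:~R.
pose v := w * expi (phase k y).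
have D := is_derive_circle v l 0.
(* Along a coordinate line the difference quotients are those at 0 of an exponential of one variable
   with frequency [l]. *)
have E : (fun h : R => h^-1 *: ((plane_wave k w \o shift y) (h *: delta_mx 0 i) - plane_wave k w y)) =
  (fun h : R => h^-1 *: (((fun h => complex.Re (v * expi (l * h))) \o shift 0) (h *: 1) -
     complex.Re (v * expi (l * 0)))).
  apply/funext => h; rewrite /comp /shift /plane_wave/= phase_shift -/l addr0 [h *: 1]mulr1.
  by rewrite mulr0 expi0 mulr1 /v expiD; congr (_ *: (complex.Re _ - _)); ring.
have [D1 D2] := D; apply: DeriveDef.
  by rewrite /derivable E.
rewrite /derive E [LHS]D2 mulr0 expi0 mulr1 /plane_wave /v.
by rewrite -/l; congr complex.Re; ring.
Qed.
End smooth_characters.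

(** * The free flow *)

Lemma cvg_rnorm {R : realType} {E : normedModType R[i]} {T : Type} {F : set_system T}
    {FF : Filter F} (f : T -> E) (y : E) (e : R) : f @ F --> y -> 0 < e ->
  \forall t \near F, rnorm (y - f t) < e.
Proof.
move=> /cvgrPdist_lt fy e0; have ec : 0 < e%:C by rewrite ltcR.
by apply: filterS (fy _ ec) => t; rewrite rnormE ltcR.
Qed.

(** D(t) <= n D(t/n), and D(t/n) is at most e |t/n| for large n. This takes the place of a
    uniqueness theorem for differential equations in [flow_char]. *)
Lemma subadditive_little {R : realType} (D : R -> R) : (forall s t, D (s + t) <= D s + D t) ->
  (forall e, 0 < e -> \forall h \near 0^', D h <= e * `|h|) -> forall t, D t <= 0.
Proof.
move=> DD D0.
have Dn t n : D (n.+1%:R * t) <= n.+1%:R * D t.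
  elim: n => [|n IH]; first by rewrite !mul1r.
  by rewrite -natr1 !mulrDl !mul1r; apply: le_trans (DD _ _) _; rewrite lerD2r.
have H t : t != 0 -> D t <= 0.
  move=> t0; apply/ler_addgt0Pr => e e0; rewrite add0r; have t0' : 0 < `|t| by rewrite normr_gt0.
  have /= [r /= r0 Hr] := D0 _ (divr_gt0 e0 t0').
  pose n := Num.bound (`|t| / r).
  have nt : `|t| / n.+1%:R < r.
    rewrite ltr_pdivrMr// -ltr_pdivrMl// mulrC.
    apply: lt_le_trans (archi_boundP _) _; first by rewrite divr_ge0 ?ltW.
    by rewrite ler_nat.
  have := Dn (n.+1%:R^-1 * t) n; rewrite mulrA mulfV// mul1r => /le_trans; apply.
  have {}Hr := Hr (n.+1%:R^-1 * t); rewrite -ler_pdivlMl//.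
  apply: le_trans (Hr _ _) _; last 2 first.
  - by rewrite mulf_neq0.
  - by rewrite normrM mulrCA divfK ?gt_eqF// gtr0_norm.
  - by rewrite /ball_/= sub0r normrN normrM gtr0_norm// mulrC.
move=> t; have [->|] := eqVneq t 0; last exact: H.
rewrite -{1}(subrr 1); apply: le_trans (DD _ _) _.
have N1 : - 1 != 0 :> R by rewrite oppr_eq0 oner_neq0.
by have := lerD (H 1 (oner_neq0 _)) (H (-1) N1); rewrite addr0.
Qed.

Section laplacian_of_characters.
Context {R : realType} {d : nat}.
Implicit Types (k : 'rV[int]_d) (w : R[i]).

Lemma continuous_plane_wave k w : continuous (@plane_wave R d k w).
Proof.
move=> y; rewrite /plane_wave.
apply: (@continuous_comp _ _ _ (phase k) (fun x => complex.Re (w * expi x))).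
  apply: (@continuous_comp _ _ _ (fun y : 'rV[R]_d => \sum_i (k 0 i)%:~R * y 0 i)).
    apply: continuous_sumr => i z; apply: (@continuous_comp _ _ _ (fun y : 'rV[R]_d => y 0 i)).
      exact: coord_continuous.
    exact: mulrl_continuous.
  exact: mulrl_continuous.
have := @continuous_Re_mul_expi R w 1 (phase k y).
by under eq_fun do rewrite mul1r; exact.
Qed.

Lemma partial_plane_wave k w i : partial i (@plane_wave R d k w) =
  plane_wave k (w * ('i%C * (pi *+ 2 * (k 0 i)%:~R)%:C)).
Proof. by apply/funext => y; apply: derive_val; exact: is_derive_plane_wave. Qed.

Lemma smooth_plane_wave k w : smooth (@plane_wave R d k w).
Proof.
move=> s.
have [w' ->] : exists w', iter_partial s (plane_wave k w) = @plane_wave R d k w'.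
  elim: s => [|i s [w' IH]]; first by exists w.
  by eexists; rewrite /= IH partial_plane_wave.
split; first exact: continuous_plane_wave.
by move=> i x; apply: ex_derive; exact: is_derive_plane_wave.
Qed.

Lemma lift_Re_torus_char k : lift_Re (@torus_char R d k) = plane_wave k 1.
Proof. by apply/funext => y; rewrite /lift_Re torus_char_proj /plane_wave mul1r. Qed.

Lemma lift_Im_torus_char k : lift_Im (@torus_char R d k) = plane_wave k (- 'i%C).
Proof. by apply/funext => y; rewrite /lift_Im torus_char_proj /plane_wave Im_Re. Qed.

Lemma torus_smooth_char k : torus_smooth (@torus_char R d k).
Proof.
by split; rewrite ?lift_Re_torus_char ?lift_Im_torus_char; exact: smooth_plane_wave.
Qed.

(** Minus the eigenvalue of the laplacian on the character of frequency [k]. *)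
Definition dispersion k : R := (pi *+ 2) ^+ 2 * (dotz k k)%:~R.

Lemma laplacian_plane_wave k w y : laplacian (plane_wave k w) y = - dispersion k * plane_wave k w y.
Proof.
rewrite /laplacian.
under eq_bigr do rewrite !partial_plane_wave.
rewrite /dispersion /dotz rmorph_sum/= mulr_sumr -sumrN mulr_suml.
apply: eq_bigr => i _; rewrite rmorphM/= /plane_wave.
set l := (k 0 i)%:~R; set z := expi _.
by case: w z => [a b] [u v]; simpc => /=; ring.
Qed.

Lemma torus_laplacian_char k y :
  torus_laplacian (torus_char k) y = (- dispersion k)%:C * torus_char k y.
Proof.
rewrite /torus_laplacian lift_Re_torus_char lift_Im_torus_char !laplacian_plane_wave.
rewrite /plane_wave /torus_char -Im_Re mul1r.
by apply/eqP; rewrite eq_complex; apply/andP; split; apply/eqP => /=; ring.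
Qed.
End laplacian_of_characters.

Section operators.
Context {R : realType} {X : normedModType R[i]}.

Lemma bopD (A : bop X) u v : A (u + v) = A u + A v.
Proof. by have := bop_linear A 1 u v; rewrite !scale1r. Qed.

Lemma bopB (A : bop X) u v : A (u - v) = A u - A v.
Proof. by rewrite addrC -scaleN1r bop_linear scaleN1r addrC. Qed.

Lemma rnormN (u : X) : rnorm (- u) = rnorm u.
Proof. by rewrite /rnorm normrN. Qed.

Lemma rnormB (u v : X) : rnorm (u - v) <= rnorm u + rnorm v.
Proof. by rewrite -(rnormN v) rnormD. Qed.

Lemma normcR (a : R) : normc a%:C = `|a|.
Proof. by rewrite /= expr0n addr0 sqrtr_sqr. Qed.

(** With y = U(h) u and c = exp(iah), the defect of u splits into the error of the difference
    quotient of U and the Taylor error of the exponential. *)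
Lemma difference_quotient (h : R[i]) (b c : R[i]) (y u : X) : h != 0 ->
  y - c *: u = - (h *: (b *: u - h^-1 *: (y - u))) - (c - 1 - h * b) *: u.
Proof.
move=> h0; rewrite scalerBr !scalerA mulfV// scale1r !scalerBl scale1r !opprB.
by rewrite addrA subrK addrA subrK.
Qed.

(** With D(t) = U(t) u - exp(iat) u this reads D(s + t) = U(s) D(t) + exp(iat) D(s); as U(s) is
    isometric, the norm of D is subadditive. *)
Lemma operator_cocycle (A : bop X) (b c : R[i]) (z y u : X) : A y = z ->
  z - (b * c) *: u = A (y - c *: u) + c *: (A u - b *: u).
Proof.
by move=> <-; rewrite bopB bopZ scalerBr scalerA addrA subrK mulrC.
Qed.
End operators.

Section flow.
Context {R : realType} {d : nat}.
Local Notation E := (L2_torus R d).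
Variable U : R -> bop E.
Hypothesis hU : schrodinger_group U.
Implicit Types (k : 'rV[int]_d).

Lemma U_iso t v : rnorm (U t v) = rnorm v.
Proof. by have [[_ _ H _] _] := hU; rewrite /rnorm H. Qed.

Lemma near_expi a e : 0 < e -> \forall h \near (0 : R)^',
  normc (expi (a * h) - 1 - (h * a)%:C * 'i%C) <= e * `|h|.
Proof.
move=> e0; have e20 : 0 < e / 2 by rewrite divr_gt0.
have H w : \forall h \near (0 : R)^',
    `|complex.Re (w * (expi (a * h) - 1 - (h * a)%:C * 'i%C))| <= e / 2 * `|h|.
  have [D1 D2] := is_derive_circle w a 0.
  have /cvgrPdist_lt/(_ _ e20) : (fun h : R => h^-1 *: (((fun h => complex.Re (w * expi (a * h))) \o shift 0) (h *: 1) -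
     complex.Re (w * expi (a * 0)))) @ 0^' --> complex.Re (w * ('i%C * a%:C)).
    suff -> : complex.Re (w * ('i%C * a%:C)) =
      'D_1 (fun h => complex.Re (w * expi (a * h))) (0 : R) by exact: D1.
    by rewrite D2 mulr0 expi0 mulr1.
  rewrite !near_withinE; apply: filterS => h /= Hh h0; have {}Hh := Hh h0.
  rewrite -ler_pdivrMr ?normr_gt0//; apply: le_trans (ltW Hh).
  rewrite -normfV -normrM -normrN le_eqVlt; apply/orP; left; apply/eqP; congr (`|_|).
  rewrite addr0 [h *: 1]mulr1 mulr0 expi0 [_ *: _]mulrC.
  case: w (expi (a * h)) {Hh D1 D2} => [u v] [x y]; simpc => /=; by field.
have H2 := H (- 'i%C); have H1 := H 1; apply: filterS2 H1 H2 => h.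
rewrite -Im_Re ReM1 => hx hy.
apply: (@le_trans _ _ (e / 2 * `|h| + e / 2 * `|h|)); last by rewrite -mulrDl -splitr.
apply: le_trans (lerD hx hy); case: (_ - _ - _) => x y /=.
rewrite -(ler_pXn2r (n := 2)) ?nnegrE ?sqrtr_ge0 ?addr_ge0 ?normr_ge0//.
rewrite sqr_sqrtr ?addr_ge0 ?sqr_ge0// sqrrD !real_normK ?num_real//.
by rewrite -addrA [in leRHS](addrC (_ *+ 2)) addrA lerDl mulrn_wge0// mulr_ge0.
Qed.

(** The hypothesis on the generator gives the derivative at time 0 only. The group law makes the
    norm of the defect [D] subadditive, and a subadditive function that is o(h) at 0 is at most
    0. *)
Lemma flow_char k t : U t (torus_char_class k) = expi (- dispersion k * t) *: torus_char_class k.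
Proof.
have [[U0 UD _ _] gen] := hU.
pose a := - dispersion k : R.
pose D t := U t (torus_char_class k) - expi (a * t) *: torus_char_class k.
suff : rnorm (D t) <= 0.
  move=> D0; apply/eqP; rewrite -subr_eq0; apply/eqP/rnorm0_eq0/le_anti.
  by rewrite rnorm_ge0 andbT.
apply: (@subadditive_little _ (fun t => rnorm (D t))) => [r s|e e0].
  rewrite /D UD mulrDr expiD (operator_cocycle _ _ _ erefl).
  by apply: le_trans (rnormD _ _) _; rewrite U_iso rnormZ normc_expi mul1r addrC.
have ae : ae_represents (a%:C *: torus_char_class k) (torus_laplacian (torus_char k)).
  apply: filterS2 (L2_scaler a%:C (torus_char_class k)) (torus_char_classE k) => x H1 H2.
  by rewrite torus_laplacian_char H1 H2.
have := gen _ (torus_smooth_char k) (torus_char_class k) _ (torus_char_classE k) ae.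
have e2 : 0 < e / 2 by rewrite divr_gt0.
pose N : R := rnorm (torus_char_class k : E) + 1.
have N0 : 0 < N by rewrite ltr_wpDl ?rnorm_ge0.
move=> /cvg_rnorm /(_ e2) H1.
have H2 := near_expi a (divr_gt0 e2 N0).
rewrite !near_withinE in H1 H2 *.
apply: filterS2 H1 H2 => h H1 H2 h0; have {}H1 := H1 h0; have {}H2 := H2 h0.
rewrite /D (@difference_quotient _ _ h%:C ('i%C * a%:C)); last first.
  by apply: contra h0 => /eqP/complexI ->.
apply: le_trans (rnormB _ _) _; rewrite rnormN !rnormZ normcR.
have -> : e * `|h| = `|h| * (e / 2) + e / 2 / N * `|h| * N.
  by field; rewrite gt_eqF.
apply: lerD; first by rewrite ler_wpM2l// ltW// -scalerA -fmorphV.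
apply: ler_pM; rewrite ?normc_ge0 ?rnorm_ge0//; last by rewrite lerDl.
by move: H2; rewrite rmorphM mulrA mulrAC.
Qed.

Section waves.
Variables (I : finType) (kappa : I -> 'rV[int]_d) (c : I -> R[i]).

Lemma flow_char_sum t : U t (char_sum_class kappa c) =
  char_sum_class kappa (fun i => c i * expi (- dispersion (kappa i) * t)).
Proof.
rewrite /char_sum_class; elim: (index_enum I) => [|i s IH]; first by rewrite !big_nil bop0.
by rewrite !big_cons bopD IH bopZ flow_char scalerA.
Qed.

Variables (om T : R) (m : nat).
Hypotheses (T0 : 0 < T) (omT : om * T = pi *+ 2) (omm : om * m%:R = (pi *+ 2) ^+ 2).

(** [omm] turns the integer time frequency -m |k|^2 of [wave_freq] into the dispersion 4 pi^2
    |k|^2. *)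
Lemma flow_wave t : {ae torus_measure R d, forall x,
  L2_fun (U t (char_sum_class kappa c)) x = wave om m kappa c (t, x)}.
Proof.
rewrite flow_char_sum; apply: filterS (char_sum_classE kappa (fun i => c i * expi (- dispersion (kappa i) * t))) => x ->.
rewrite /char_sum /wave; apply: eq_bigr => i _; rewrite /tchar mulrA; congr (_ * expi _ * _).
by rewrite /wave_freq rmorphN rmorphM /dispersion -omm pmulrn/=; ring.
Qed.

Lemma flow_wave_section Q t : trig_poly om Q -> (forall z, 0 <= Q z) ->
  (\int[torus_measure R d]_x (Q (t, x) * normc (L2_fun (U t (char_sum_class kappa c)) x) ^+ 2)%:E =
   \int[torus_measure R d]_x (Q (t, x) * normc (wave om m kappa c (t, x)) ^+ 2)%:E)%E.
Proof.
move=> tQ Q0; have tW := trig_polyM tQ (trig_wave_sqr om m kappa c).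
have mW : measurable_fun [set: measurableTypeR R * torus R d]
    (fun z => (Q z * normc (wave om m kappa c z) ^+ 2)%:E).
  by apply/measurable_EFinP; exact: trig_poly_measurable tW.
apply: ge0_ae_eq_integral => //.
- apply/measurable_EFinP; apply: measurable_funM; last first.
    by apply: measurable_funX; exact: L2_measurable.
  by have := measurableT_comp (trig_poly_measurable tQ) (measurable_time_slice t).
- by have := measurableT_comp mW (measurable_time_slice t).
- by move=> x _; rewrite lee_fin mulr_ge0// sqr_ge0.
- by move=> x _; rewrite lee_fin mulr_ge0// sqr_ge0.
- by apply: filterS (flow_wave t) => x -> _.
Qed.

Lemma energy_flowE Q : trig_poly om Q -> (forall z, 0 <= Q z) ->
  (\int[lebesgue_measure]_(t in `]0%R, T[) \int[torus_measure R d]_x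
     (Q (t, x) * normc (L2_fun (U t (char_sum_class kappa c)) x) ^+ 2)%:E =
   (energy om T m Q kappa c)%:E)%E.
Proof.
move=> tQ Q0.
have tW := trig_polyM tQ (trig_wave_sqr om m kappa c).
have mW : measurable_fun [set: measurableTypeR R * torus R d]
    (fun z => (Q z * normc (wave om m kappa c z) ^+ 2)%:E).
  by apply/measurable_EFinP; exact: trig_poly_measurable tW.
rewrite /energy /mean /Rintegral fineK; last first.
  by apply: integrable_fin_num => //; exact: (trig_integrable T0 omT tW).
rewrite spacetime_fubini//; last by move=> z; rewrite lee_fin mulr_ge0// sqr_ge0.
by apply: eq_integral => t _; exact: flow_wave_section.
Qed.

(** Parseval's identity is read off the space-time orthogonality with weight 1: the flow is
    isometric, so both sides are merely multiplied by [T]. *)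
Lemma rnorm_char_sum : injective kappa ->
  rnorm (char_sum_class kappa c) ^+ 2 = \sum_i normc (c i) ^+ 2.
Proof.
move=> kI.
have E1 : energy om T m (cst 1) kappa c = (\sum_i normc (c i) ^+ 2) * T.
  rewrite energyE//; last exact: trig_poly_cst.
  rewrite mulr_suml; apply: eq_bigr => i _; rewrite (bigD1 i)//= big1 ?addr0 => [|j ji].
    under eq_fun do rewrite mul1r.
    by rewrite mean_tchar// subrr eqxx mul1r normc_sqr.
  under eq_fun do rewrite mul1r.
  have kij : (wave_freq m (kappa i) - wave_freq m (kappa j) == 0) = false; last first.
    by rewrite mean_tchar// kij !mul0r.
  by apply/negbTE; apply: contra ji; rewrite subr_eq0 xpair_eqE => /andP[_]; rewrite (inj_eq kI) eq_sym.
have := @energy_flowE (cst 1) (trig_poly_cst _ _) (fun=> ler01).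
rewrite E1; under eq_integral do [under eq_integral do rewrite mul1r]; rewrite /=.
under eq_integral do rewrite L2_norm_sqr U_iso.
rewrite integral_cst//= lebesgue_measure_itv/= lte_fin T0 sube0 -EFinM => -[] /mulIf; apply.
by rewrite gt_eqF.
Qed.
End waves.
End flow.

(** * Bochner integrals *)

Section lower_integral.
Import HBNNSimple.

(* [g] need not be measurable: the library integral is then a lower integral. *)
Lemma ge0_le_lower_integral (dd : measure_display) (T : measurableType dd) (R : realType)
    (mu : {measure set T -> \bar R}) (D : set T) (f g : T -> \bar R) :
  (forall x, D x -> 0 <= f x)%E -> (forall x, D x -> f x <= g x)%E ->
  (\int[mu]_(x in D) f x <= \int[mu]_(x in D) g x)%E.
Proof.
move=> f0 fg; have g0 x : D x -> (0 <= g x)%E by move=> Dx; exact: le_trans (f0 _ Dx) (fg _ Dx).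
rewrite !ge0_integralE//; apply: ereal_sup_le => _ [h hf <-]; exists h => // x; apply: le_trans (hf x) _; rewrite !patchE; case: ifPn => //.
by rewrite inE; exact: fg.
Qed.

End lower_integral.

Section finite_measurable.
Context {R : realType}.
Local Notation leb := (@lebesgue_measure R).

(** [simple_function] with values in any choice type, so that two simple functions can be treated on
    the joint partition defined by their pair. *)
Definition fin_meas {Y : choiceType} (p : R -> Y) : Prop :=
  finite_set (range p) /\ forall y, measurable (p @^-1` [set y]).

Definition level_measure {Y : choiceType} (D : set R) (p : R -> Y) (y : Y) : R :=
  fine (leb (D `&` p @^-1` [set y])).

Lemma fin_meas_preimage (Y : choiceType) (p : R -> Y) (B : set Y) : fin_meas p ->
  measurable (p @^-1` B).
Proof.
move=> [pf pm].
rewrite (_ : p @^-1` B = \bigcup_(y in range p `&` B) (p @^-1` [set y])).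
  by apply: fin_bigcup_measurable => //; apply: finite_setI; left.
apply/seteqP; split => [t Bt|t [y [_ By] ty]]; last by rewrite /= ty.
by exists (p t) => //; split => //; exists t.
Qed.

Lemma fin_meas_pair (Y Z : choiceType) (p : R -> Y) (q : R -> Z) :
  fin_meas p -> fin_meas q -> fin_meas (fun t => (p t, q t)).
Proof.
move=> [pf pm] [qf qm]; split.
  apply: sub_finite_set (finite_setX pf qf) => _ [t _ <-].
  by split; exists t.
move=> [y z]; rewrite (_ : _ @^-1` _ = p @^-1` [set y] `&` q @^-1` [set z]).
  exact: measurableI.
by apply/seteqP; split => t /= [-> ->].
Qed.

Lemma fin_meas_comp (Y Z : choiceType) (p : R -> Y) (phi : Y -> Z) :
  fin_meas p -> fin_meas (fun t => phi (p t)).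
Proof.
move=> pm; split.
  have [pf _] := pm; have := finite_image phi pf; by rewrite image_comp.
by move=> z; exact: (fin_meas_preimage (phi @^-1` [set z]) pm).
Qed.

Lemma fin_meas_measurable (p : R -> R) : fin_meas p -> measurable_fun [set: measurableTypeR R] p.
Proof. by move=> pm _ B mB; rewrite setTI; exact: fin_meas_preimage. Qed.

Lemma level_measure_ge0 (Y : choiceType) D (p : R -> Y) y : 0 <= level_measure D p y.
Proof. exact: fine_ge0. Qed.

Lemma integral_fin_meas (Y : choiceType) (p : R -> Y) (f : Y -> R) (D : set (measurableTypeR R)) :
  fin_meas p -> (forall y, 0 <= f y) -> measurable D -> (leb D < +oo)%E ->
  (\int[leb]_(t in D) (f (p t))%:E =
   (\sum_(y <- fset_set (range p)) f y * level_measure D p y)%:E)%E.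
Proof.
move=> pm f0 mD Doo; have [pf p1] := pm.
transitivity (\int[leb]_(t in D) \sum_(y <- fset_set (range p)) (f y * \1_(p @^-1` [set y]) t)%:E)%E.
  apply: eq_integral => t _; rewrite sumEFin; congr _%:E.
  rewrite (bigD1_seq (p t))//=; last first.
    by rewrite in_fset_set//; apply: mem_set; exists t.
  rewrite indicE mem_set// mulr1 big1 ?addr0// => y yt.
  by rewrite indicE memNset ?mulr0//= => ty; rewrite ty eqxx in yt.
rewrite ge0_integral_sum//; last 2 first.
- move=> y; apply/measurable_EFinP; apply: measurable_funM => //.
  by apply: measurable_funTS; apply: measurable_indic; exact: (fin_meas_preimage [set y] pm).
- by move=> y t _; rewrite lee_fin mulr_ge0.
rewrite -sumEFin; apply: eq_bigr => y _.
under eq_integral do rewrite EFinM.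
rewrite ge0_integralZl_EFin//; last first.
  apply/measurable_EFinP; apply: measurable_funTS; apply: measurable_indic.
  exact: (fin_meas_preimage [set y] pm).
rewrite integral_indic//; last exact: (fin_meas_preimage [set y] pm).
rewrite EFinM /level_measure fineK; first by rewrite setIC.
by rewrite ge0_fin_numE//; apply: le_lt_trans Doo; apply: measureIl => //; exact: (fin_meas_preimage [set y] pm).
Qed.

Lemma itv_lty (a b : R) : (leb `[a, b] < +oo)%E.
Proof. by rewrite lebesgue_measure_itv/=; case: ifP => _; rewrite ?ltry// -EFinB ltry. Qed.

Lemma level_measure_comp (Y Z : choiceType) (p : R -> Y) (phi : Y -> Z) (D : set (measurableTypeR R)) z :
  fin_meas p -> measurable D -> (leb D < +oo)%E ->
  level_measure D (fun t => phi (p t)) z =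
  \sum_(y <- fset_set (range p) | phi y == z) level_measure D p y.
Proof.
move=> pm mD Doo; apply: EFin_inj.
have mz := fin_meas_preimage [set z] (fin_meas_comp phi pm).
rewrite /level_measure fineK; last first.
  by rewrite ge0_fin_numE//; apply: le_lt_trans Doo; exact: measureIl.
rewrite setIC -integral_indic//.
have := integral_fin_meas (f := fun y => (phi y == z)%:R) pm (fun=> ler0n _ _) mD Doo.
under [in LHS]eq_integral => t _.
  rewrite (_ : (phi (p t) == z)%:R = \1_((fun t => phi (p t)) @^-1` [set z]) t); last first.
    rewrite indicE; congr (nat_of_bool _)%:R; by apply/idP/idP; rewrite inE => /eqP.
  over.
move=> ->; congr _%:E; rewrite [RHS]big_mkcond; apply: eq_bigr => y _.
by case: ifP; rewrite ?mul1r ?mul0r.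
Qed.

(** Evaluates a simple integral on a partition finer than the one given by its own values. *)
Lemma simple_integral_comp (X : normedModType R[i]) (Y : choiceType) (p : R -> Y) (phi : Y -> X) a b :
  fin_meas p -> simple_integral a b (fun t => phi (p t)) =
  \sum_(y <- fset_set (range p)) (level_measure `[a, b] p y)%:C *: phi y.
Proof.
move=> pm; have [pf _] := pm; have [cf _] := fin_meas_comp phi pm.
rewrite /simple_integral fsbig_finite//.
rewrite (partition_big_imfset _ phi)/=.
have -> : fset_set (range (fun t => phi (p t))) = [fset phi y | y in fset_set (range p)]%fset.
  rewrite -fset_set_image//; congr fset_set; by rewrite image_comp.
apply: eq_bigr => x _.
rewrite -/(level_measure _ _ _) level_measure_comp//; last exact: itv_lty.
rewrite rmorph_sum/= scaler_suml; apply: eq_bigr => y /eqP -> //.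
Qed.
End finite_measurable.

(** * Comparison of two Bochner integrals *)

Section bochner_estimate.
Context {R : realType} {X : normedModType R[i]}.
Local Notation leb := (@lebesgue_measure R).
Local Notation GR := (measurableTypeR R).
Implicit Types (F : R -> X) (D : set R).

Lemma rnormP (x : X) (r : R) : (`|x| < r%:C) = (rnorm x < r).
Proof. by rewrite rnormE ltcR. Qed.

Lemma cvg_of_rnorm {T : Type} {G : set_system T} {FG : Filter G} (f : T -> X) (y : X) :
  (forall e, 0 < e -> \forall t \near G, rnorm (y - f t) < e) -> f @ G --> y.
Proof.
move=> H; apply/cvgrPdist_lt => -[e e']; rewrite ltcE/= => /andP[/eqP -> e0].
by apply: filterS (H _ e0) => t; rewrite rnormP.
Qed.

Lemma rnorm_dist (x y : X) : `|rnorm x - rnorm y| <= rnorm (x - y).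
Proof.
rewrite ler_norml; apply/andP; split; last by rewrite lerBlDr -{1}(subrK y x) rnormD.
by rewrite lerBrDr addrC lerBlDr -(rnormN (x - y)) opprB -{1}(subrK x y) [leRHS]addrC rnormD.
Qed.

Lemma cvg_rnorm_val (f : nat -> X) (y : X) : f @ \oo --> y -> rnorm (f n) @[n --> \oo] --> rnorm y.
Proof.
move=> fy; apply/cvgrPdist_lt => e e0; apply: filterS (cvg_rnorm fy e0) => n.
exact/le_lt_trans/rnorm_dist.
Qed.

(** Outside [N] the norm is a limit of measurable functions; the indicator removes [N], where
    nothing is known about [F]. *)
Lemma strongly_measurable_norm F (D : set GR) : measurable D -> strongly_measurable D F ->
  exists N : set GR, [/\ measurable N, leb N = 0%E &
    measurable_fun [set: GR] (fun t => rnorm (F t) * \1_(D `\` N) t)].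
Proof.
move=> mD [s ss [N [mN N0 sN]]]; exists N; split => //.
have mDN : measurable (D `\` N) by exact: measurableD.
apply: (@measurable_fun_cvg _ _ _ _ (fun n t => rnorm (s n t) * \1_(D `\` N) t)) => [n|t _].
  apply: measurable_funM; last exact: measurable_indic.
  by apply: fin_meas_measurable; apply: fin_meas_comp; exact: ss.
rewrite indicE; have [tDN|tDN] := pselect ((D `\` N) t); last first.
  rewrite memNset//; by rewrite mulr0; under eq_fun do rewrite mulr0; exact: cvg_cst.
rewrite mem_set// mulr1; under eq_fun do rewrite mulr1.
case: tDN => Dt Nt; apply: cvg_rnorm_val.
by apply: contrapT => nt; apply: Nt; apply: sN => /(_ Dt).
Qed.

Lemma strongly_measurableB F s D : strongly_measurable D F -> simple_function s ->
  strongly_measurable D (fun t => F t - s t).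
Proof.
move=> [f sf fF] ss; exists (fun n t => f n t - s t) => [n|].
  exact: (fin_meas_comp (fun q => q.1 - q.2) (fin_meas_pair (sf n) ss)).
by apply: (@filterS _ _ (ae_filter_ringOfSetsType leb)) fF => t fF Dt; apply: cvgB; [exact: fF|exact: cvg_cst].
Qed.

Lemma rnorm_sum (I : Type) (r : seq I) (f : I -> X) :
  rnorm (\sum_(i <- r) f i) <= \sum_(i <- r) rnorm (f i).
Proof.
elim: r => [|i r IH]; first by rewrite !big_nil rnorm0.
by rewrite !big_cons; apply: le_trans (rnormD _ _) _; rewrite lerD2l.
Qed.

Lemma simple_integral_diff (s s' : R -> X) (a b b' : R) : a <= b -> b <= b' ->
  simple_function s -> simple_function s' ->
  ((rnorm (simple_integral a b' s' - simple_integral a b s))%:E <=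
   \int[leb]_(t in `[a, b]) (rnorm (s' t - s t))%:E +
   \int[leb]_(t in `]b, b']) (rnorm (s' t))%:E)%E.
Proof.
move=> ab bb' ss ss'.
pose p t := (s' t, s t); have pm : fin_meas p := fin_meas_pair ss' ss.
have oo : (leb `]b, b'] < +oo)%E.
  by rewrite lebesgue_measure_itv/=; case: ifP => _; rewrite ?ltry// -EFinB ltry.
rewrite (integral_fin_meas (f := fun q => rnorm (q.1 - q.2)) pm)//; last 2 first.
- by move=> q; exact: rnorm_ge0.
- exact: itv_lty.
rewrite (integral_fin_meas (f := fun q => rnorm q.1) pm)//; last by move=> q; exact: rnorm_ge0.
rewrite -[s']/(fun t => (p t).1) -[s]/(fun t => (p t).2).
rewrite (simple_integral_comp (fun q => q.1) _ _ pm) (simple_integral_comp (fun q => q.2) _ _ pm).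
rewrite -EFinD lee_fin -sumrB -big_split/=; apply: le_trans (rnorm_sum _ _) _.
apply: ler_sum => q _.
have -> : level_measure `[a, b'] p q = level_measure `[a, b] p q + level_measure `]b, b'] p q.
  have mq := fin_meas_preimage [set q] pm.
  rewrite /level_measure -fineD; last 2 first.
  - by rewrite ge0_fin_numE//; apply: le_lt_trans (itv_lty a b); exact: measureIl.
  - by rewrite ge0_fin_numE//; apply: le_lt_trans oo; exact: measureIl.
  rewrite -measureU; last 3 first.
  - exact: measurableI.
  - exact: measurableI.
  - apply/seteqP; split => t //= -[[]]; rewrite !in_itv/= => /andP[_ tb] _ [/andP[]].
    by rewrite ltNge tb.
  rewrite -setIUl; congr (fine (leb (_ `&` _))).
  apply/seteqP; split => t /=; rewrite !in_itv/=; last first.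
    case=> /andP[at_ tb]; first by rewrite at_ (le_trans tb).
    by rewrite tb (le_trans ab (ltW _)).
  by move=> /andP[-> ->]; case: (leP t b) => tb; [left|right].
rewrite rmorphD/= scalerDl -addrA [_ + - _]addrC addrA -scalerBr.
apply: le_trans (rnormD _ _) _; rewrite !rnormZ !normcR !ger0_norm ?level_measure_ge0//.
by rewrite ![level_measure _ _ _ * _]mulrC.
Qed.

Lemma bochner_le (a b b' : R) F w w' (g : R -> R) : a <= b -> b <= b' ->
  has_bochner_integral a b F w -> has_bochner_integral a b' F w' ->
  measurable_fun [set: GR] g -> (forall t, 0 <= g t) ->
  {ae leb, forall t, t \in `[a, b'] -> rnorm (F t) <= g t} ->
  ((rnorm (w' - w))%:E <= \int[leb]_(t in `]b, b']) (g t)%:E)%E.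
Proof.
move=> ab bb' [_ [s [ss sF sw]]] [[mF _] [s' [ss' sF' sw']]] mg g0 Fg.
have mD : measurable (`[a, b'] : set GR) by exact: measurable_itv.
(* A measurable [h] that equals |F - f| almost everywhere and is nowhere above it, so that bounds on
   the lower integral of |F - f| pass to [h]. *)
have H (f : R -> X) : simple_function f -> exists h : R -> R, [/\ measurable_fun [set: GR] h,
    forall t, 0 <= h t, {ae leb, forall t, t \in `[a, b'] -> rnorm (F t - f t) = h t} &
    forall t, h t <= rnorm (F t - f t)].
  move=> sf; have [N [mN N0 mh]] := strongly_measurable_norm mD (strongly_measurableB mF sf).
  exists (fun t => rnorm (F t - f t) * \1_(`[a, b'] `\` N) t); split => //.
  - by move=> t; rewrite mulr_ge0 ?rnorm_ge0.
  - exists N; split => // t /= H; apply: contrapT => nt; apply: H => tD.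
    by rewrite indicE mem_set ?mulr1.
  - by move=> t; rewrite ler_piMr ?rnorm_ge0// indicE lern1 leq_b1.
(* Five errors: one for each of [w] and [w'], two on [a, b] from [s n] and [s' n], one on ]b, b']
   from [s' n]. *)
apply/lee_addgt0Pr => e e0; have e5 : 0 < e / 5 by rewrite divr_gt0.
have small (u : nat -> \bar R) : u @ \oo --> 0%E -> \forall n \near \oo, (u n < (e / 5)%:E)%E.
  move=> u0; apply: (u0 [set y | (y < (e / 5)%:E)%E]).
  by apply: open_nbhs_nbhs; split; [exact: open_ereal_lt_ereal|rewrite /= lte_fin].
have [n [n1 n2 n3 n4]] : exists n, [/\ rnorm (w - simple_integral a b (s n)) < e / 5,
    rnorm (w' - simple_integral a b' (s' n)) < e / 5,
    (\int[leb]_(t in `[a, b]) (rnorm (F t - s n t))%:E < (e / 5)%:E)%E &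
    (\int[leb]_(t in `[a, b']) (rnorm (F t - s' n t))%:E < (e / 5)%:E)%E].
  have F1 : \forall n \near \oo, rnorm (w - simple_integral a b (s n)) < e / 5 by exact: cvg_rnorm sw e5.
  have F2 : \forall n \near \oo, rnorm (w' - simple_integral a b' (s' n)) < e / 5 by exact: cvg_rnorm sw' e5.
  have F3 := small _ sF; have F4 := small _ sF'.
  move: F1 F2 F3 F4 => [N1 _ H1] [N2 _ H2] [N3 _ H3] [N4 _ H4].
  by exists (N1 + N2 + N3 + N4)%N; split; [apply: H1|apply: H2|apply: H3|apply: H4] => /=; lia.
have [h [mh h0 hE hF]] := H _ (ss n); have [h' [mh' h0' hE' hF']] := H _ (ss' n).
have mD1 : measurable (`[a, b] : set GR) by exact: measurable_itv.
have mD2 : measurable (`]b, b'] : set GR) by exact: measurable_itv.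
have D1 : `[a, b]%classic `<=` `[a, b']%classic.
  by move=> t /=; rewrite !in_itv/= => /andP[-> tb]; exact: le_trans tb bb'.
have D2 : `]b, b']%classic `<=` `[a, b']%classic.
  by move=> t /=; rewrite !in_itv/= => /andP[bt ->]; rewrite andbT; exact: le_trans ab (ltW bt).
have I1 : (\int[leb]_(t in `[a, b]) (h t)%:E <= (e / 5)%:E)%E.
  apply: le_trans (ltW n3); apply: ge0_le_lower_integral => t _; rewrite lee_fin//.
have I2 (D : set GR) : measurable D -> D `<=` `[a, b']%classic ->
    (\int[leb]_(t in D) (h' t)%:E <= (e / 5)%:E)%E.
  move=> mD' DD; apply: le_trans (ltW n4).
  apply: (@le_trans _ _ (\int[leb]_(t in `[a, b']) (h' t)%:E)%E).
    apply: ge0_subset_integral => //; first by apply/measurable_EFinP; exact: measurable_funTS.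
    by move=> t _; rewrite lee_fin.
  by apply: ge0_le_lower_integral => t _; rewrite lee_fin.
have J1 : (\int[leb]_(t in `[a, b]) (rnorm (s' n t - s n t))%:E <= (e / 5)%:E + (e / 5)%:E)%E.
  apply: le_trans (leeD I1 (I2 _ mD1 D1)).
  rewrite -ge0_integralD//; last 4 first.
  - by move=> t _; rewrite lee_fin.
  - by apply/measurable_EFinP; exact: measurable_funTS.
  - by move=> t _; rewrite lee_fin.
  - by apply/measurable_EFinP; exact: measurable_funTS.
  apply: ae_ge0_le_integral => //.
  - by move=> t _; rewrite lee_fin rnorm_ge0.
  - apply/measurable_EFinP; apply: measurable_funTS; apply: fin_meas_measurable.
    exact: (fin_meas_comp (fun q => rnorm (q.1 - q.2)) (fin_meas_pair (ss' n) (ss n))).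
  - by move=> t _; rewrite adde_ge0 ?lee_fin.
  - by apply/measurable_EFinP; apply: measurable_funTS; exact: measurable_funD.
  apply: (@filterS2 _ _ (ae_filter_ringOfSetsType leb)) hE hE' => t ht ht' tD.
  have {}tD := D1 _ tD.
  rewrite -EFinD lee_fin -ht// -ht'//.
  by rewrite -[_ - s n t](subrKA (F t)) addrC -(rnormN (F t - s' n t)) opprB rnormD.
have J2 : (\int[leb]_(t in `]b, b']) (rnorm (s' n t))%:E <=
    (e / 5)%:E + \int[leb]_(t in `]b, b']) (g t)%:E)%E.
  apply: le_trans (leeD (I2 _ mD2 D2) (lexx _)).
  rewrite -ge0_integralD//; last 4 first.
  - by move=> t _; rewrite lee_fin.
  - by apply/measurable_EFinP; exact: measurable_funTS.
  - by move=> t _; rewrite lee_fin.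
  - by apply/measurable_EFinP; exact: measurable_funTS.
  apply: ae_ge0_le_integral => //.
  - by move=> t _; rewrite lee_fin rnorm_ge0.
  - apply/measurable_EFinP; apply: measurable_funTS; apply: fin_meas_measurable.
    exact: (fin_meas_comp rnorm (ss' n)).
  - by move=> t _; rewrite adde_ge0 ?lee_fin.
  - by apply/measurable_EFinP; apply: measurable_funTS; exact: measurable_funD.
  apply: (@filterS2 _ _ (ae_filter_ringOfSetsType leb)) Fg hE' => t ht ht' tD.
  have {}tD := D2 _ tD.
  rewrite -EFinD lee_fin -ht'//; apply: le_trans (lerD (lexx _) (ht tD)).
  by rewrite -(rnormN (F t - s' n t)) opprB -{1}(subrK (F t) (s' n t)) rnormD.
have := le_trans (simple_integral_diff ab bb' (ss n) (ss' n)) (leeD J1 J2).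
set I' := simple_integral a b' _; set I := simple_integral a b _ => II.
have /le_trans : ((rnorm (w' - w))%:E <= (e / 5)%:E + (e / 5)%:E + (rnorm (I' - I))%:E)%E.
  rewrite -!EFinD lee_fin.
  rewrite -(subrKA I' w' (- w)) -(subrKA I I' (- w)) -(opprB w I).
  have := rnormD (w' - I') (I' - I - (w - I)); have := rnormB (I' - I) (w - I).
  by move: n1 n2; rewrite -/I -/I'; lra.
apply; apply: le_trans (leeD (lexx _) II) _.
rewrite addeA [leLHS]addeA [leRHS]addeC; apply: leeD => //.
by rewrite -!EFinD lee_fin -addrA; lra.
Qed.
End bochner_estimate.

(** * Duhamel solutions *)

Section bochner_operators.
Context {R : realType} {X : normedModType R[i]}.
Implicit Types (A : bop X) (F : R -> X).

Lemma rnorm_bop A x : rnorm (A x) <= rnorm A * rnorm x.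
Proof.
have -> : rnorm A = opnorm A by [].
have [->|x0] := eqVneq x 0; first by rewrite bop0 rnorm0 mulr0.
have nx0 : 0 < rnorm x.
  by rewrite lt_neqAle rnorm_ge0 andbT eq_sym; apply: contra x0 => /eqP/rnorm0_eq0/eqP.
have := opnorm_ub A (x := (rnorm x)^-1%:C *: x).
rewrite bopZ !rnormZ normcR gtr0_norm ?invr_gt0// mulVf ?gt_eqF// => /(_ (lexx _)).
by rewrite mulrC ler_pdivrMr.
Qed.

Lemma bop_sum A (I : Type) (r : seq I) (f : I -> X) :
  A (\sum_(i <- r) f i) = \sum_(i <- r) A (f i).
Proof. by elim: r => [|i r IH]; rewrite ?big_nil ?bop0// !big_cons bopD IH. Qed.

Lemma cvg_bop A (f : nat -> X) x : f @ \oo --> x -> A (f n) @[n --> \oo] --> A x.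
Proof.
move=> fx; apply: cvg_of_rnorm => e e0.
have A0 : 0 < rnorm A + 1 by rewrite ltr_wpDl ?rnorm_ge0.
have H : \forall n \near \oo, rnorm (x - f n) < e / (rnorm A + 1).
  by apply: cvg_rnorm fx _; rewrite divr_gt0.
apply: filterS H => n; rewrite ltr_pdivlMr// => H; rewrite -bopB.
apply: le_lt_trans (rnorm_bop _ _) _; apply: le_lt_trans H.
by rewrite mulrC ler_wpM2l ?rnorm_ge0// lerDl.
Qed.

(** Used to take [U (- t)] inside Duhamel's integral. *)
Lemma bochner_isometry A a b F w : (forall x, rnorm (A x) = rnorm x) ->
  has_bochner_integral a b F w -> has_bochner_integral a b (fun t => A (F t)) (A w).
Proof.
move=> iso [[[f sf fF] Foo] [s [ss sF sw]]]; split; first split.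
- exists (fun n t => A (f n t)) => [n|]; first exact: (fin_meas_comp A (sf n)).
  apply: (@filterS _ _ (ae_filter_ringOfSetsType lebesgue_measure)) fF => t fF Dt.
  by apply: cvg_bop; exact: fF.
- by under eq_integral do rewrite iso.
exists (fun n t => A (s n t)); split.
- by move=> n; exact: (fin_meas_comp A (ss n)).
- by under eq_fun do under eq_integral do rewrite -bopB iso.
under eq_fun => n.
  rewrite (simple_integral_comp A _ _ (ss n)).
  rewrite (_ : \sum_(y <- _) _ = A (simple_integral a b (s n))); last first.
    rewrite (simple_integral_comp id _ _ (ss n)) bop_sum.
    by apply: eq_bigr => y _; rewrite bopZ.
  over.
exact: cvg_bop.
Qed.

Lemma continuous_rnorm (v : R -> X) : continuous v -> continuous (fun t => rnorm (v t)).
Proof.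
move=> cv t; apply/cvgrPdist_lt => e e0.
have H : \forall s \near t, rnorm (v t - v s) < e by exact: cvg_rnorm (cv t) e0.
by apply: filterS H => s; exact/le_lt_trans/rnorm_dist.
Qed.
End bochner_operators.

Section duhamel.
Context {R : realType} {d : nat}.
Local Notation E := (L2_torus R d).
Local Notation leb := (@lebesgue_measure R).
Local Notation GR := (measurableTypeR R).
Variables (U V : R -> bop E) (T : R).
Hypotheses (hU : schrodinger_group U) (hV : locally_bochner_integrable V) (T0 : 0 < T).

(** [m] is a measurable version of the norm of V on [0, T], set to 0 elsewhere; it can then be used
    in integrals of measurable functions. *)
Lemma operator_norm_profile : exists m : R -> R, [/\ measurable_fun [set: GR] m,
  forall t, 0 <= m t, {ae leb, forall t, t \in `[0, T] -> rnorm (V t) = m t} &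
  leb.-integrable [set: GR] (EFin \o m)].
Proof.
have [mV Voo] := hV 0 T.
have mD : measurable (`[0, T] : set GR) by exact: measurable_itv.
have [N [mN N0 mm]] := strongly_measurable_norm mD mV.
exists (fun t => rnorm (V t) * \1_(`[0, T] `\` N) t); split => //.
- by move=> t; rewrite mulr_ge0 ?rnorm_ge0.
- exists N; split => // t /= H; apply: contrapT => nt; apply: H => tD.
  by rewrite indicE mem_set ?mulr1.
apply/integrableP; split; first exact/measurable_EFinP.
apply: le_lt_trans Voo; rewrite [leRHS]integral_mkcond.
apply: ge0_le_lower_integral => t _ //=; rewrite patchE.
rewrite ger0_norm ?mulr_ge0 ?rnorm_ge0// indicE.
have [tD|tD] := pselect ((`[0, T] `\` N) t).
  by rewrite mem_set// mulr1 mem_set//; case: tD.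
by rewrite memNset// mulr0; case: ifP; rewrite // lee_fin rnorm_ge0.
Qed.

Variable m : R -> R.
Hypotheses (mm : measurable_fun [set: GR] m) (m0 : forall t, 0 <= m t)
  (Vm : {ae leb, forall t, t \in `[0, T] -> rnorm (V t) = m t})
  (im : leb.-integrable [set: GR] (EFin \o m)).

(** Absolute continuity of the integral; [K] depends on [m] and [e] only, hence is common to all
    solutions. *)
Lemma small_partition (e : R) : 0 < e -> exists2 K : nat, (0 < K)%N & forall a b, a <= b ->
  b - a <= T / K%:R -> (\int[leb]_(t in `]a, b]) (m t)%:E <= e%:E)%E.
Proof.
move=> e0; have [r [r0 H]] := integral_normr_continuous im e0.
pose n := Num.bound (T / r); exists n.+1 => // a b ab bK.
have mD : measurable (`]a, b] : set GR) by exact: measurable_itv.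
have ltr : (leb `]a, b] < r%:E)%E.
  rewrite lebesgue_measure_itv/=; case: ifP => // _; rewrite -EFinB lte_fin.
  apply: le_lt_trans bK _; rewrite ltr_pdivrMr ?ltr0n// -ltr_pdivrMl//  mulrC.
  apply: lt_trans (archi_boundP _) _; first by rewrite divr_ge0 ?ltW.
  by rewrite ltr_nat.
have := H _ mD ltr; under eq_Rintegral do rewrite ger0_norm//.
move/ltW; rewrite -lee_fin /Rintegral fineK//.
by apply: integrable_fin_num => //; exact: integrableS im.
Qed.

Section solution.
Variables (v0 : E) (v : R -> E).
Hypothesis hv : duhamel_solution U V v0 v.

Lemma measurable_solution : measurable_fun [set: GR] (fun t => rnorm (v t)).
Proof. by apply: continuous_measurable_fun; apply: continuous_rnorm; case: hv. Qed.

(** Interaction picture: after applying [U (- t)] the integrand no longer depends on [t], so the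
    values at two times can be compared. *)
Lemma duhamel_bochner t : 0 <= t -> exists2 w : E,
  has_bochner_integral 0 t (fun s => U (- s) (- V s (v s))) w &
  U (- t) (v t) = v0 + 'i%C^-1 *: w.
Proof.
move=> t0; have [_ /(_ t)[w [+ _] ->]] := hv; move=> /(_ t0) Hw.
have [[U0 UD _ _] _] := hU.
exists (U (- t) w); last by rewrite bopD bopZ -UD addNr U0.
have := bochner_isometry (U_iso hU (- t)) Hw.
rewrite (_ : (fun s => _) = (fun s => U (- s) (- V s (v s)))) //.
by apply/funext => s; rewrite -UD addKr.
Qed.

(** At t = 0 both orientations apply, so [w] and [- w] are integrals over the same degenerate
    interval, hence equal. *)
Lemma initial_value : v 0 = v0.
Proof.
have [_ /(_ 0)[w [+ +] ->]] := hv; move=> /(_ (lexx _)) H1 /(_ (lexx _)) H2.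
have [[U0 _ _ _] _] := hU; rewrite U0.
have : ((rnorm (- w - w))%:E <= \int[leb]_(s in `]0%R, 0%R]) (m s * rnorm (v s))%:E)%E.
  apply: (bochner_le (lexx _) (lexx _) H1 H2).
  - by apply: measurable_funM => //; exact: measurable_solution.
  - by move=> s; rewrite mulr_ge0 ?rnorm_ge0.
  apply: (@filterS _ _ (ae_filter_ringOfSetsType leb)) Vm => s Vs s0.
  rewrite (U_iso hU) rnormN -Vs ?rnorm_bop//.
  by move: s0; rewrite !in_itv/= => /andP[-> /le_trans]; apply; exact: ltW.
rewrite set_itvoc0 integral_set0 lee_fin => w0.
have /eqP : - w - w = 0 by apply/rnorm0_eq0/le_anti; rewrite w0 rnorm_ge0.
rewrite -opprD oppr_eq0 -mulr2n -scaler_nat scaler_eq0 pnatr_eq0/= => /eqP ->.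
by rewrite scaler0 addr0.
Qed.

Lemma duhamel_diff t' t : 0 <= t' -> t' <= t -> t <= T ->
  ((rnorm (U (- t) (v t) - U (- t') (v t')))%:E <=
   \int[leb]_(s in `]t', t]) (m s * rnorm (v s))%:E)%E.
Proof.
move=> t'0 t't tT; have [w' Hw' ->] := duhamel_bochner t'0.
have [w Hw ->] := duhamel_bochner (le_trans t'0 t't).
have -> : rnorm (v0 + 'i%C^-1 *: w - (v0 + 'i%C^-1 *: w')) = rnorm (w - w').
  rewrite opprD addrACA subrr add0r -scalerBr rnormZ normcV.
  by rewrite (_ : normc 'i%C = 1) ?invr1 ?mul1r//= expr0n expr1n add0r sqrtr1.
apply: (bochner_le t'0 t't Hw' Hw) => //.
- by apply: measurable_funM => //; exact: measurable_solution.
- by move=> s; rewrite mulr_ge0 ?rnorm_ge0.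
apply: (@filterS _ _ (ae_filter_ringOfSetsType leb)) Vm => s Vs st.
rewrite (U_iso hU) rnormN -Vs ?rnorm_bop//.
by move: st; rewrite !in_itv/= => /andP[-> /le_trans]; apply.
Qed.

Lemma duhamel_le t' t S e : 0 <= t' -> t' <= t -> t <= T -> 0 <= S ->
  (forall s, t' <= s <= t -> rnorm (v s) <= S) ->
  (\int[leb]_(s in `]t', t]) (m s)%:E <= e%:E)%E ->
  rnorm (U (- t) (v t) - U (- t') (v t')) <= e * S.
Proof.
move=> t'0 t't tT S0 vS me; rewrite -lee_fin.
apply: le_trans (duhamel_diff t'0 t't tT) _.
apply: (@le_trans _ _ (S%:E * \int[leb]_(s in `]t', t]) (m s)%:E)%E); last first.
  by rewrite mulrC EFinM; apply: lee_wpmul2l.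
rewrite -ge0_integralZl_EFin//; last 2 first.
- by move=> s _; rewrite lee_fin.
- by apply/measurable_EFinP; exact: measurable_funTS.
apply: ge0_le_integral => //.
- by move=> s _; rewrite lee_fin mulr_ge0 ?rnorm_ge0.
- apply/measurable_EFinP; apply: measurable_funTS.
  by apply: measurable_funM => //; exact: measurable_solution.
- by apply: measurable_funeM; apply/measurable_EFinP; exact: measurable_funTS.
move=> s /=; rewrite in_itv/= => /andP[ts st]; rewrite -EFinM lee_fin mulrC ler_wpM2r//.
by apply: vS; rewrite (ltW ts).
Qed.

(** Gronwall's lemma in discrete form: on a step where m has integral at most 1/2, the maximum S of
    the norm satisfies S <= |v(a)| + S/2, so each of the [K] steps at most doubles the norm. *)
Lemma solution_bound (K : nat) : (0 < K)%N -> (forall a b, a <= b ->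
    b - a <= T / K%:R -> (\int[leb]_(t in `]a, b]) (m t)%:E <= (2%:R^-1)%:E)%E) ->
  forall t, 0 <= t <= T -> rnorm (v t) <= 2 ^+ K * rnorm v0.
Proof.
move=> K0 HK.
have H i : (i <= K)%N -> forall t, 0 <= t <= T / K%:R * i%:R -> rnorm (v t) <= 2 ^+ i * rnorm v0.
  elim: i => [|i IH] iK t.
    by rewrite mulr0 -eq_le => /eqP <-; rewrite expr0 mul1r initial_value.
  pose a := T / K%:R * i%:R; pose b := T / K%:R * i.+1%:R.
  have TK0 : 0 < T / K%:R by rewrite divr_gt0// ltr0n.
  have a0 : 0 <= a by rewrite mulr_ge0// ltW.
  have ab : a <= b by rewrite ler_pM2l// ler_nat.
  have bT : b <= T.
    by rewrite /b mulrAC ler_pdivrMr ?ltr0n// ler_pM2l// ler_nat.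
  move=> /andP[t0 tb].
  have va := IH (ltnW iK) a; rewrite a0 lexx in va; have {}va := va isT.
  have [ta|at_] := leP t a.
    apply: le_trans (IH (ltnW iK) t _) _; first by rewrite t0.
    by rewrite ler_wpM2r ?rnorm_ge0// exprS ler_peMl ?exprn_ge0 ?ler1n.
  have cv : {within `[a, b], continuous (fun s => rnorm (v s))}.
    by apply: continuous_subspaceT; apply: continuous_rnorm; case: hv.
  have [c cab cmax] := EVT_max ab cv; have := cab; rewrite in_itv/= => /andP[ac cb].
  have vt : rnorm (v t) <= rnorm (v c) by apply: cmax; rewrite in_itv/= tb ltW.
  apply: le_trans vt _.
  have := duhamel_le (S := rnorm (v c)) (e := 2%:R^-1) a0 ac (le_trans cb bT) (rnorm_ge0 _).
  have h1 s : a <= s <= c -> rnorm (v s) <= rnorm (v c).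
    by move=> /andP[as_ sc]; apply: cmax; rewrite in_itv/= as_ (le_trans sc cb).
  have h2 : (\int[leb]_(s in `]a, c]) (m s)%:E <= (2%:R^-1)%:E)%E.
    apply: HK => //; rewrite lerBlDr; apply: le_trans cb _.
    by rewrite /b /a -natr1 mulrDr mulr1 addrC.
  move=> /(_ h1 h2).
  have := rnormD (U (- c) (v c) - U (- a) (v a)) (U (- a) (v a)).
  rewrite subrK !(U_iso hU) exprS -mulrA.
  by move: va; lra.
move=> t tT; apply: (H K (leqnn K)).
by rewrite divfK// pnatr_eq0 -lt0n.
Qed.
End solution.

(** [C] and [K] do not depend on [n], which makes a single weight usable for the whole sequence. *)
Lemma solutions_modulus (u0 : nat -> E) (u : nat -> R -> E) : bounded_seq u0 ->
  (forall n, duhamel_solution U V (u0 n) (u n)) ->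
  exists2 C, forall n t, 0 <= t <= T -> rnorm (u n t) <= C &
  forall e, 0 < e -> exists2 K : nat, (0 < K)%N & forall n a t, 0 <= a -> a <= t -> t <= T ->
    t - a <= T / K%:R -> rnorm (u n t - U (t - a) (u n a)) <= e.
Proof.
move=> [M uM] hu; have h2 : 0 < 2%:R^-1 :> R by rewrite invr_gt0.
have [K K0 HK] := small_partition h2.
have C n t : 0 <= t <= T -> rnorm (u n t) <= 2 ^+ K * M.
  move=> tT; apply: le_trans (solution_bound (hu n) K0 HK tT) _.
  by rewrite ler_wpM2l ?exprn_ge0.
exists (2 ^+ K * M) => // e e0.
have M0 : 0 <= 2 ^+ K * M by apply: le_trans (C 0%N 0 _); rewrite ?rnorm_ge0 ?lexx ?ltW.
(* The summand 1 avoids a division by zero when the bound is 0. *)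
have e1 : 0 < e / (2 ^+ K * M + 1) by rewrite divr_gt0// ltr_wpDl.
have [L L0 HL] := small_partition e1; exists L => // n a t a0 at_ tT taL.
have [[U0 UD _ _] _] := hU.
have -> : rnorm (u n t - U (t - a) (u n a)) = rnorm (U (- t) (u n t) - U (- a) (u n a)).
  have -> : U (- a) (u n a) = U (- t) (U (t - a) (u n a)) by rewrite -UD addKr.
  by rewrite -bopB (U_iso hU).
apply: le_trans (duhamel_le (hu n) a0 at_ tT M0 _ (HL _ _ at_ taL)) _.
  by move=> s /andP[as_ st]; apply: C; rewrite (le_trans a0 as_) (le_trans st tT).
rewrite mulrAC ler_pdivrMr ?ltr_wpDl//.
by apply: ler_wpM2l; [exact: ltW|rewrite lerDl].
Qed.
End duhamel.

(** * Curves in L^2(T^d) as functions on space-time *)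

Lemma nneseries_lty_cvg0 {R : realType} (a : nat -> R) : (forall n, 0 <= a n) ->
  (\sum_(n <oo) (a n)%:E < +oo)%E -> a @ \oo --> 0.
Proof.
move=> a0 aoo; apply: cvg_series_cvg_0; apply: nondecreasing_is_cvgn.
  apply/nondecreasing_seqP => n; rewrite /series/= big_nat_recr//= lerDl//.
have S0 : (0 <= \sum_(n <oo) (a n)%:E)%E by apply: nneseries_ge0 => n _ _; rewrite lee_fin.
exists (fine (\sum_(n <oo) (a n)%:E)%E) => _ [n _ <-].
rewrite -lee_fin fineK ?ge0_fin_numE// /series/= -sumEFin.
by apply: nneseries_lim_ge => k _ _; rewrite lee_fin.
Qed.

(** The bounds sum to at most 1, so the series of the [g n] is integrable, hence finite almost
    everywhere, and its terms tend to 0. *)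
Lemma ae_cvg0_summable (dd : measure_display) (X : measurableType dd) (R : realType)
    (mu : {measure set X -> \bar R}) (g : nat -> X -> R) :
  (forall n, measurable_fun [set: X] (g n)) -> (forall n x, 0 <= g n x) ->
  (forall n, \int[mu]_x (g n x)%:E <= (1 / (2 ^ n.+1)%:R)%:E)%E ->
  {ae mu, forall x, g n x @[n --> \oo] --> 0}.
Proof.
move=> mg g0 gi.
have mgE n : measurable_fun [set: X] (fun x => (g n x)%:E) by exact/measurable_EFinP.
pose S x := (\sum_(n <oo) (g n x)%:E)%E.
have S0 x : (0 <= S x)%E by apply: nneseries_ge0 => n _ _; rewrite lee_fin.
have iS : mu.-integrable [set: X] S.
  apply/integrableP; split.
    apply: (@ge0_emeasurable_sum _ _ _ _ (fun n x => (g n x)%:E) xpredT) => // n x _ _.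
    by rewrite lee_fin.
  under eq_integral do rewrite gee0_abs//.
  rewrite integral_nneseries//; last by move=> n x _; rewrite lee_fin.
  apply: (@le_lt_trans _ _ 1%E); last exact: ltry.
  apply: le_trans (epsilon_trick0 xpredT ler01).
  apply: lee_nneseries => [n *|n *]; last exact: gi.
  by apply: integral_ge0 => x _; rewrite lee_fin.
apply: filterS (integrable_ae measurableT iS) => x /(_ I); rewrite ge0_fin_numE// => Sx.
exact: nneseries_lty_cvg0.
Qed.

Lemma segment_uniform {R : realType} {E : normedModType R[i]} (v : R -> E) (a b e : R) :
  continuous v -> 0 < e -> exists2 r, 0 < r & forall t s, t \in `[a, b] -> `|t - s| < r ->
    rnorm (v t - v s) < e.
Proof.
move=> cv e0; have e2 : 0 < e / 2 by rewrite divr_gt0.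
have /compact_near_coveringP cab := @segment_compact R a b.
have : \forall r \near 0^'+, `[a, b]%classic `<=` (fun t => forall s, `|t - s| < r -> rnorm (v t - v s) < e).
  apply: cab => x _.
  have [r /= r0 Hr] : \forall s \near x, rnorm (v x - v s) < e / 2 by exact: cvg_rnorm (cv x) e2.
  have r2 : 0 < r / 2 by rewrite divr_gt0.
  exists (ball x (r / 2), [set y | y < r / 2]) => /=.
    by split; [exact: nbhsx_ballx|exact: nbhs_right_lt].
  move=> [t q] /= [xt qr] s ts.
  have h1 : rnorm (v x - v t) < e / 2.
    by apply: Hr; rewrite /=; apply: lt_le_trans xt _; lra.
  have h2 : rnorm (v x - v s) < e / 2.
    apply: Hr => /=; rewrite -(subrKA t) (splitr r).
    by apply: le_lt_trans (ler_normD _ _) _; apply: ltrD => //; exact: lt_trans ts qr.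
  rewrite -(subrKA (v x)) -(opprB (v x) (v t)) (splitr e).
  by apply: le_lt_trans (rnormD _ _) _; rewrite rnormN ltrD.
move=> H; near (0 : R)^'+ => r; exists r => [|t s tab]; first by near: r; exact: nbhs_right_gt.
have /(_ _ tab) : `[a, b]%classic `<=` (fun t => forall s, `|t - s| < r -> rnorm (v t - v s) < e).
  by near: r; exact: H.
exact.
Unshelve. all: by end_near. Qed.

Section curves.
Context {R : realType} {d : nat}.
Local Notation E := (L2_torus R d).
Local Notation leb := (@lebesgue_measure R).
Local Notation GR := (measurableTypeR R).
Local Notation ST := (measurableTypeR R * torus R d)%type.
Variables (T : R) (v : R -> E).
Hypotheses (T0 : 0 < T) (cv : continuous v).

Definition measurable_complex (f : ST -> R[i]) : Prop :=
  measurable_fun [set: ST] (fun z => complex.Re (f z)) /\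
  measurable_fun [set: ST] (fun z => complex.Im (f z)).

(** The curve is frozen at the left end of each of finitely many steps, shorter than a modulus of
    uniform continuity. *)
Lemma curve_step (e : R) : 0 < e -> exists2 f : ST -> R[i], measurable_complex f &
  forall t, t \in `]0, T[ -> exists2 s, rnorm (v t - v s) < e & forall x, f (t, x) = v s x.
Proof.
move=> e0; have [r r0 Hr] := segment_uniform 0 T cv e0.
pose n := Num.bound (T / r); pose h := T / n.+1%:R.
have h0 : 0 < h by rewrite divr_gt0.
have hr : h < r.
  rewrite ltr_pdivrMr ?ltr0n// -ltr_pdivrMl// mulrC.
  apply: lt_trans (archi_boundP _) _; first by rewrite divr_ge0 ?ltW.
  by rewrite ltr_nat.
pose a i : R := h * i%:R; pose A i : set GR := `[a i, a i.+1[%classic.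
have mA i : measurable (A i) by exact: measurable_itv.
exists (fun z => \sum_(i < n.+1) (\1_(A i) z.1)%:C * v (a i) z.2).
  have mfst i : measurable_fun [set: ST] (fun z => \1_(A i) z.1 : R).
    by apply: (measurableT_comp (@measurable_indic _ GR R [set: GR] (A i) (mA i))); exact: measurable_fst.
  have [H1 H2] : (forall s, measurable_fun [set: ST] (fun z => complex.Re (v s z.2))) /\
      (forall s, measurable_fun [set: ST] (fun z => complex.Im (v s z.2))).
    by split => s; have [mr mi _] := sqfunP (L2_repr (v s));
      [apply: (measurableT_comp mr)|apply: (measurableT_comp mi)]; exact: measurable_snd.
  split.
    rewrite (_ : (fun z => _) = (fun z => \sum_(i < n.+1) \1_(A i) z.1 * complex.Re (v (a i) z.2))).
      by apply: measurable_sum => i; apply: measurable_funM.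
    by apply/funext => z; rewrite Re_sum; apply: eq_bigr => i _; case: (v _ _) => p q /=; rewrite mul0r subr0.
  rewrite (_ : (fun z => _) = (fun z => \sum_(i < n.+1) \1_(A i) z.1 * complex.Im (v (a i) z.2))).
    by apply: measurable_sum => i; apply: measurable_funM.
  apply/funext => z; rewrite (big_morph _ (@ImD R) (erefl _)).
  by apply: eq_bigr => i _; case: (v _ _) => p q /=; rewrite mul0r addr0.
move=> t; rewrite in_itv/= => /andP[t0 tT].
pose i := Num.truncn (t / h).
have /andP[i1 i2] : i%:R <= t / h < i.+1%:R by apply: truncn_itv; rewrite divr_ge0 ?ltW.
have ai : a i <= t by rewrite /a mulrC -ler_pdivlMr.
have ai1 : t < a i.+1 by rewrite /a mulrC -ltr_pdivrMr.
have iN : (i < n.+1)%N.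
  rewrite -(ltr_nat R); apply: le_lt_trans i1 _; rewrite ltr_pdivrMr// mulrC divfK//.
exists (a i).
  apply: Hr; first by rewrite in_itv/= !ltW.
  rewrite ger0_norm ?subr_ge0//; apply: lt_trans hr; rewrite ltrBlDr.
  by move: ai1; rewrite /a -natr1 mulrDr mulr1 addrC.
move=> x; rewrite (bigD1 (Ordinal iN))//= big1 ?addr0 => [|j ji].
  by rewrite indicE mem_set ?mul1r// /A /= in_itv/= ai ai1.
rewrite indicE memNset ?mul0r// /A => /=; rewrite in_itv/= => /andP[j1 j2].
case/eqP: ji; apply/val_inj => /=; apply/eqP; rewrite eqn_leq; apply/andP; split.
  by rewrite -ltnS -(ltr_nat R) -(ltr_pM2l h0); exact: le_lt_trans j1 ai1.
by rewrite -ltnS -(ltr_nat R) -(ltr_pM2l h0); exact: le_lt_trans ai j2.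
Qed.

(** The representatives of the [v t] are chosen independently, so they need not be jointly
    measurable. Step approximations with summable squared errors converge almost everywhere in
    space, for each time of the interval. *)
Lemma curve_measurable : exists2 f : ST -> R[i], measurable_complex f &
  forall t, t \in `]0, T[ -> {ae torus_measure R d, forall x, f (t, x) = v t x}.
Proof.
have e0 n : 0 < Num.sqrt (1 / (2 ^ n.+1)%:R) :> R by rewrite sqrtr_gt0 divr_gt0// ltr0n expn_gt0.
have /choice[F HF] n : exists f : ST -> R[i], measurable_complex f /\
    forall t, t \in `]0, T[ -> exists2 s, rnorm (v t - v s) < Num.sqrt (1 / (2 ^ n.+1)%:R) &
      forall x, f (t, x) = v s x.
  by have [f mf Hf] := curve_step (e0 n); exists f.
(* An upper limit is measurable and defined everywhere; it is the limit wherever one exists. *)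
pose L (p : R[i] -> R) z := fine (limn_esup (fun n => (p (F n z))%:E)).
have mL (p : R[i] -> R) : (forall n, measurable_fun [set: ST] (fun z => p (F n z))) ->
    measurable_fun [set: ST] (L p).
  move=> mp; apply: (measurableT_comp (fine_measurable measurableT)).
  by apply: measurable_fun_limn_esup => n; exact/measurable_EFinP.
exists (fun z => L (@complex.Re R) z +i* L (@complex.Im R) z).
  by split; apply: mL => n; have [[]] := HF n.
move=> t tT.
have /choice[s Hs] n : exists s, rnorm (v t - v s) ^+ 2 <= 1 / (2 ^ n.+1)%:R /\ forall x, F n (t, x) = v s x.
  have [_ /(_ _ tT)[s st Fs]] := HF n; exists s; split => //.
  by rewrite -[leRHS]sqr_sqrtr ?divr_ge0// ler_pXn2r ?nnegrE ?rnorm_ge0 ?sqrtr_ge0// ltW.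
have := ae_cvg0_summable (mu := torus_measure R d) (g := fun n x => normc (L2_fun (v t - v (s n)) x) ^+ 2).
have H0 n : {ae torus_measure R d, forall x, L2_fun (v t - v (s n)) x = v t x - v (s n) x}.
  rewrite -scaleN1r.
  apply: filterS2 (L2_addr (v t) (-1 *: v (s n))) (L2_scaler (-1) (v (s n))) => x -> ->.
  by rewrite mulN1r.
have {}H0 := ae_foralln H0.
move=> H1; apply: filterS2 H0 (H1 _ _ _) => [x Ex vx|n|n x|n].
- have {}vx : normc (v t x - F n (t, x)) ^+ 2 @[n --> \oo] --> 0.
    by under eq_fun do rewrite (Hs _).2 -Ex.
  have Lp (p : R[i] -> R) : (forall z w, `|p z - p w| <= normc (z - w)) -> L p (t, x) = p (v t x).
    move=> pL; rewrite /L; suff pc : (p (F n (t, x)))%:E @[n --> \oo] --> (p (v t x))%:E.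
      by rewrite is_cvg_limn_esupE ?(cvg_lim _ pc)//; apply/cvg_ex; eexists; exact: pc.
    apply/fine_cvgP; split; first exact: nearW.
    apply/cvgrPdist_lt => e e1.
    have /cvgrPdist_lt/(_ _ (exprn_gt0 2 e1)) := vx; apply: filterS => n.
    rewrite sub0r normrN ger0_norm ?sqr_ge0// ltr_pXn2r ?nnegrE ?normc_ge0 ?ltW//.
    exact/le_lt_trans/pL.
  rewrite !Lp; first by case: (v t x).
  + move=> z w; rewrite (_ : complex.Im z - complex.Im w = complex.Re (- 'i%C * (z - w))).
      by apply: le_trans (normRe_le _) _; rewrite normcM normcN /= !expr0n expr1n add0r sqrtr1 mul1r.
    by case: z w => [? ?] [? ?]; simpc.
  + move=> z w; rewrite (_ : complex.Re z - complex.Re w = complex.Re (z - w)) ?normRe_le//.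
    by case: z w => [? ?] [? ?]; simpc.
- by apply: measurable_funX; exact: L2_measurable.
- exact: sqr_ge0.
- by rewrite L2_norm_sqr lee_fin; case: (Hs n).
Qed.

Lemma measurable_section (N : set ST) t : measurable N -> measurable [set x | N (t, x)].
Proof. by move=> mN; have := measurable_time_slice t measurableT mN; rewrite setTI. Qed.

Lemma section_ae (N : set ST) : measurable N -> spacetime_measure d T N = 0%E ->
  {ae leb, forall t, t \in `]0, T[ -> torus_measure R d [set x | N (t, x)] = 0%E}.
Proof.
move=> mN; have -> : spacetime_measure d T N = (\int[spacetime_measure d T]_z (\1_N z)%:E)%E.
  by rewrite integral_indic// setIT.
have mN1 : measurable_fun [set: ST] (fun z => (\1_N z)%:E : \bar R).
  by apply/measurable_EFinP; exact: measurable_indic.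
have N0 z : (0 <= (\1_N z)%:E :> \bar R)%E by rewrite lee_fin.
rewrite spacetime_fubini//.
have mF := @measurable_fun_fubini_tonelli_F _ _ _ _ R (torus_measure R d) _ mN1 N0.
have F0 t : (0 <= \int[torus_measure R d]_x (\1_N (t, x))%:E)%E by apply: integral_ge0 => x _.
move=> H.
have mD : measurable (`]0, T[ : set GR) by exact: measurable_itv.
have := (ae_eq_integral_abs leb mD (measurable_funTS mF)).1.
move=> H1; have /H1 {H1} : (\int[leb]_(t in `]0%R, T[) `|fubini_F (torus_measure R d)
    (fun z : ST => (\1_N z)%:E) t| = 0)%E.
  by rewrite -[RHS]H; apply: eq_integral => t _; rewrite /fubini_F gee0_abs//; exact: F0.
apply: (@filterS _ _ (ae_filter_ringOfSetsType leb)) => t /= tN tT.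
rewrite -[[set x | N (t, x)]]setIT -integral_indic//; last exact: measurable_section.
exact: tN.
Qed.

(** The last clause computes the density against a weight from the curve itself, time by time. *)
Lemma curve_class (C : R) : (forall t, 0 <= t <= T -> rnorm (v t) <= C) ->
  exists w : L2 (spacetime_measure d T), [/\ spacetime_class v w,
    rnorm w ^+ 2 <= T * C ^+ 2 &
    forall phi : ST -> R, measurable_fun [set: ST] phi -> (forall z, 0 <= phi z) ->
      (density_test w phi = \int[leb]_(t in `]0%R, T[) \int[torus_measure R d]_x
          (phi (t, x) * normc (v t x) ^+ 2)%:E)%E].
Proof.
move=> vC; have [f [mr mi] fv] := curve_measurable.
have mf := measurable_normc mr mi.
have fubini (phi : ST -> R) : measurable_fun [set: ST] phi -> (forall z, 0 <= phi z) ->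
   (\int[spacetime_measure d T]_z (phi z * normc (f z) ^+ 2)%:E =
    \int[leb]_(t in `]0%R, T[) \int[torus_measure R d]_x (phi (t, x) * normc (v t x) ^+ 2)%:E)%E.
  move=> mphi phi0.
  have mp : measurable_fun [set: ST] (fun z => (phi z * normc (f z) ^+ 2)%:E).
    by apply/measurable_EFinP; apply: measurable_funM => //; apply: measurable_funX.
  rewrite spacetime_fubini//; last by move=> z; rewrite lee_fin mulr_ge0// sqr_ge0.
  apply: eq_integral => t; rewrite inE => tT; apply: ge0_ae_eq_integral => //.
  - exact: (measurableT_comp mp (measurable_time_slice t)).
  - apply/measurable_EFinP; apply: measurable_funM.
      exact: (measurableT_comp mphi (measurable_time_slice t)).
    by apply: measurable_funX; exact: L2_measurable.
  - by move=> x _; rewrite lee_fin mulr_ge0// sqr_ge0.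
  - by move=> x _; rewrite lee_fin mulr_ge0// sqr_ge0.
  - by apply: filterS (fv t tT) => x -> _.
have fbound : (\int[spacetime_measure d T]_z (normc (f z) ^+ 2)%:E <= (T * C ^+ 2)%:E)%E.
  have := fubini (cst 1) (measurable_cst _) (fun=> ler01).
  under eq_integral do rewrite mul1r.
  move=> ->; under eq_integral do [under eq_integral do rewrite mul1r; rewrite L2_norm_sqr].
  apply: (@le_trans _ _ (\int[leb]_(t in `]0%R, T[) (C ^+ 2)%:E)%E).
    apply: ge0_le_lower_integral => t; first by rewrite lee_fin sqr_ge0.
    rewrite /= in_itv/= => /andP[t0 tT]; rewrite lee_fin ler_pXn2r ?nnegrE ?rnorm_ge0//.
      by apply: vC; rewrite !ltW.
    by apply: le_trans (vC 0 _); rewrite ?rnorm_ge0// lexx ltW.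
  by rewrite integral_cst//= lebesgue_measure_itv/= lte_fin T0 sube0 -EFinM mulrC.
have fsq : sqint (spacetime_measure d T) f.
  by apply: sqint_of_sqr => //; apply: le_lt_trans fbound _; rewrite ltry.
pose F : sqfun (spacetime_measure d T) := SqFun (introT (asboolP _) fsq).
have wf := L2_class_funE F.
exists (L2_class F); split.
- have [N [mN N0 sN]] := wf.
  apply: (@filterS _ _ (ae_filter_ringOfSetsType leb)) (section_ae mN N0) => t tN tT.
  apply: filterS2 (fv t tT) _ => [x|]; last first.
    exists [set x | N (t, x)]; split; [exact: measurable_section|exact: tN|].
    move=> x /= H; apply: sN => /= H'; apply: H; exact: H'.
  by move=> <- <-.
- by rewrite -lee_fin -L2_class_norm_sqr.
move=> phi mphi phi0; rewrite -fubini// /density_test.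
apply: ge0_ae_eq_integral => //.
- apply/measurable_EFinP; apply: measurable_funM => //.
  by apply: measurable_funX; exact: L2_measurable.
- by apply/measurable_EFinP; apply: measurable_funM => //; apply: measurable_funX.
- by move=> x _; rewrite lee_fin mulr_ge0// sqr_ge0.
- by move=> x _; rewrite lee_fin mulr_ge0// sqr_ge0.
by apply: filterS wf => z -> _.
Qed.

End curves.

(** * Absolute continuity *)

Lemma compact_torus (R : realType) (d : nat) : compact [set: torus R d].
Proof.
have c := @rV_compact R d (fun=> `[0, 1]%classic) (fun=> @segment_compact R 0 1).
have := continuous_compact (continuous_subspaceT (@pi_continuous _ {eq_quot (@congr_int R d)}%qT)) c.
congr compact; apply/seteqP; split => // x _.
exists (\row_i (repr x 0 i - (Num.floor (repr x 0 i))%:~R)) => /=.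
  by move=> i; rewrite !mxE in_itv/= subr_ge0 floor_le_tmp lerBlDl ltW// -intrD1 floorD1_gt.
rewrite -[RHS](reprK x); apply/eqquotP/forallP => i.
by rewrite !mxE addrAC subrr sub0r rpredN intr_int.
Qed.

Section cutoff.
Context {R : realType}.

Definition pospart (t : R) : R := 2%:R^-1 * (t + `|t|).

Lemma pospart_ge0 t : 0 <= pospart t.
Proof. by rewrite /pospart mulr_ge0// -lerBlDl sub0r -normrN ler_norm. Qed.

Lemma pospart_le0 t : t <= 0 -> pospart t = 0.
Proof. by move=> t0; rewrite /pospart ler0_norm// subrr mulr0. Qed.

Lemma pospart_id t : 0 <= t -> pospart t = t.
Proof. by move=> t0; rewrite /pospart ger0_norm//; lra. Qed.

Lemma continuous_pospart : continuous pospart.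
Proof.
move=> t; apply: cvgM; first exact: cvg_cst.
by apply: cvgD; [exact: cvg_id|exact: norm_continuous].
Qed.

(** Piecewise linear in [t]: for r > 0 and a <= b it is 1 on [a, b] and descends to 0 over a length
    [r] on either side. *)
Definition cutoff (a b r t : R) : R := pospart (1 - (pospart (a - t) + pospart (t - b)) / r).

Lemma continuous_cutoff a b r : continuous (cutoff a b r).
Proof.
move=> t; apply: (@continuous_comp _ _ _ (fun t => 1 - (pospart (a - t) + pospart (t - b)) / r) pospart).
  apply: cvgB; first exact: cvg_cst.
  apply: cvgM; last exact: cvg_cst.
  apply: cvgD.
    apply: (@continuous_comp _ _ _ (fun t => a - t) pospart); last exact: continuous_pospart.
    by apply: cvgB; [exact: cvg_cst|exact: cvg_id].
  apply: (@continuous_comp _ _ _ (fun t => t - b) pospart); last exact: continuous_pospart.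
  by apply: cvgB; [exact: cvg_id|exact: cvg_cst].
exact: continuous_pospart.
Qed.

Lemma cutoff_eq1 a b r t : a <= t <= b -> cutoff a b r t = 1.
Proof.
move=> /andP[at_ tb]; rewrite /cutoff (@pospart_le0 (a - t)) ?(@pospart_le0 (t - b)) ?subr_le0//.
by rewrite addr0 mul0r subr0 pospart_id.
Qed.

Lemma cutoff_le1 a b r t : 0 < r -> 0 <= cutoff a b r t <= 1.
Proof.
move=> r0; rewrite pospart_ge0/= /cutoff; set s := _ / r.
have s0 : 0 <= s by rewrite divr_ge0 ?addr_ge0 ?pospart_ge0// ltW.
have [s1|s1] := leP 0 (1 - s); first by rewrite pospart_id//; lra.
by rewrite pospart_le0// ltW.
Qed.

Lemma cutoff_support a b r t : 0 < r -> cutoff a b r t != 0 -> a - r <= t <= b + r.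
Proof.
move=> r0; apply: contraNT; rewrite negb_and -!ltNge => H.
apply/eqP/pospart_le0; rewrite subr_le0 ler_pdivlMr// mul1r.
case/orP: H => H; [rewrite (@pospart_id (a - t))|rewrite (@pospart_id (t - b))]; try lra.
  by have := pospart_ge0 (t - b); lra.
by have := pospart_ge0 (a - t); lra.
Qed.
End cutoff.

(** * Mass of a solution against a weight of small energy *)

Section test_bound.
Context {R : realType} {d : nat}.
Local Notation E := (L2_torus R d).
Local Notation leb := (@lebesgue_measure R).
Local Notation GR := (measurableTypeR R).
Local Notation ST := (measurableTypeR R * torus R d)%type.
Variable U : R -> bop E.
Hypothesis hU : schrodinger_group U.
Variables (om T : R) (m : nat).
Hypotheses (T0 : 0 < T) (omT : om * T = pi *+ 2) (omm : om * m%:R = (pi *+ 2) ^+ 2).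

Variables (Q : R * torus R d -> R) (e : R).
Hypotheses (uQ : unit_trig om Q) (e0 : 0 <= e)
  (energyQ : forall (I : finType) (kappa : I -> 'rV[int]_d) (c : I -> R[i]), injective kappa ->
    energy om T m Q kappa c <= e * \sum_i normc (c i) ^+ 2).

Definition section_mass (v : E) (t : R) : \bar R :=
  (\int[torus_measure R d]_x (Q (t, x) * normc (v x) ^+ 2)%:E)%E.

Lemma section_massD (u v : E) t : (section_mass (u + v)%R t <=
  2%:E * section_mass u t + (2 * rnorm v ^+ 2)%:E)%E.
Proof.
have [tQ Q01] := uQ.
have mQ : measurable_fun [set: torus R d] (fun x => Q (t, x)).
  exact: (measurableT_comp (trig_poly_measurable tQ) (measurable_time_slice t)).
have mq (w : E) : measurable_fun [set: torus R d] (fun x => (Q (t, x) * normc (w x) ^+ 2)%:E).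
  apply/measurable_EFinP; apply: measurable_funM => //.
  by apply: measurable_funX; exact: L2_measurable.
have mv : measurable_fun [set: torus R d] (fun x => (normc (v x) ^+ 2)%:E).
  by apply/measurable_EFinP; apply: measurable_funX; exact: L2_measurable.
have q0 (w : E) x : (0 <= (Q (t, x) * normc (w x) ^+ 2)%:E)%E.
  by rewrite lee_fin mulr_ge0 ?sqr_ge0//; case/andP: (Q01 (t, x)).
have v0 x : (0 <= (normc (v x) ^+ 2)%:E)%E by rewrite lee_fin sqr_ge0.
rewrite EFinM -L2_norm_sqr /section_mass -!ge0_integralZl_EFin//.
rewrite -ge0_integralD//; last 4 first.
- by move=> x _; rewrite mule_ge0.
- exact: measurable_funeM.
- by move=> x _; rewrite mule_ge0.
- exact: measurable_funeM.
apply: ae_ge0_le_integral => //.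
- by move=> x _; rewrite adde_ge0 ?mule_ge0.
- by apply: emeasurable_funD; exact: measurable_funeM.
apply: filterS (L2_addr u v) => x -> _; rewrite -!EFinM -EFinD lee_fin.
have /andP[Q0 Q1] := Q01 (t, x).
have := normcD_sqr (u x) (v x); have := sqr_ge0 (normc (u x)); have := sqr_ge0 (normc (v x)).
by nra.
Qed.

(** [H] is the mass of a finite free wave within [r] of [y], of norm at most [C + 1]. A vector
    within [r] of the flow of [y] is within [2 r] of this wave, whence 2 (2r)^2 = 8 r^2. The
    measurable majorant [H] is needed since the mass of a moving vector need not be measurable in
    time. *)
Lemma packet_bound (y : E) (C r : R) : rnorm y <= C -> 0 < r -> r <= 1 ->
  exists H : R -> \bar R, [/\ measurable_fun [set: GR] H, forall t, (0 <= H t)%E,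
    (\int[leb]_(t in `]0%R, T[) H t <= (e * (C + 1) ^+ 2)%:E)%E &
    forall t v, rnorm (v - U t y) <= r ->
      (section_mass v t <= 2%:E * H t + (8 * r ^+ 2)%:E)%E].
Proof.
move=> yC r0 r1; have [tQ Q01] := uQ.
have [I [kappa [c [kI yp]]]] := char_sum_dense y r0.
set p := char_sum_class kappa c in yp.
exists (fun t => section_mass (U t p) t); split.
- have tW := trig_polyM tQ (trig_wave_sqr om m kappa c).
  have mW : measurable_fun [set: ST] (fun z => (Q z * normc (wave om m kappa c z) ^+ 2)%:E).
    by apply/measurable_EFinP; exact: trig_poly_measurable tW.
  have W0 z : (0 <= (Q z * normc (wave om m kappa c z) ^+ 2)%:E)%E.
    by rewrite lee_fin mulr_ge0 ?sqr_ge0//; case/andP: (Q01 z).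
  have := @measurable_fun_fubini_tonelli_F _ _ _ _ R (torus_measure R d) _ mW W0.
  congr measurable_fun; apply/funext => t; rewrite /fubini_F; apply/esym.
  by apply: (flow_wave_section hU) => // z; case/andP: (Q01 z).
- move=> t; apply: integral_ge0 => x _; rewrite lee_fin mulr_ge0 ?sqr_ge0//.
  by case/andP: (Q01 (t, x)).
- rewrite /section_mass (energy_flowE hU kappa c T0 omT omm)//; last by move=> z; case/andP: (Q01 z).
  rewrite lee_fin; apply: le_trans (energyQ c kI) _; apply: ler_wpM2l => //.
  rewrite -(rnorm_char_sum hU c T0 omT omm kI) -/p ler_pXn2r ?nnegrE ?rnorm_ge0//.
    have := rnormB y (y - p); rewrite opprB addrCA subrr addr0 => /le_trans; apply.
    by apply: lerD yC _; exact: le_trans (ltW yp) r1.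
  by rewrite addr_ge0//; apply: le_trans yC; exact: rnorm_ge0.
move=> t v vy; rewrite -{1}(subrK (U t p) v) addrC.
apply: le_trans (section_massD _ _ _) _; apply: leeD => //; rewrite lee_fin.
have : rnorm (v - U t p) <= r + r.
  rewrite -(subrKA (U t y)); apply: le_trans (rnormD _ _) _; apply: lerD vy _.
  by rewrite -bopB (U_iso hU) ltW.
by have := rnorm_ge0 (v - U t p); nra.
Qed.

(** [S] is the time span of the solution, [T] a period of the free waves. On each of the [K] steps
    the solution follows the free wave through its value at the start of the step, whose value at
    time 0 is [U (- a k) (v (a k))]. *)
Lemma mass_bound (v : R -> E) (S C r : R) (K : nat) : 0 < S -> S <= T -> (0 < K)%N ->
  0 < r -> r <= 1 -> (forall t, 0 <= t <= S -> rnorm (v t) <= C) ->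
  (forall a t, 0 <= a -> a <= t -> t <= S -> t - a <= S / K%:R ->
    rnorm (v t - U (t - a) (v a)) <= r) ->
  (\int[leb]_(t in `]0%R, S[) section_mass (v t) t <=
   (2 * (K%:R * (e * (C + 1) ^+ 2)) + 8 * r ^+ 2 * T)%:E)%E.
Proof.
move=> S0 ST_ K0 r0 r1 vC vU; have [[U0 UD _ _] _] := hU.
pose h := S / K%:R; have h0 : 0 < h by rewrite divr_gt0// ltr0n.
pose a (k : nat) : R := h * k%:R.
have a0 k : 0 <= a k by rewrite mulr_ge0// ltW.
have aS (k : 'I_K) : a k <= S.
  by rewrite /a /h mulrAC ler_pdivrMr ?ltr0n// ler_pM2l// ler_nat ltnW.
have /choice[H HH] (k : 'I_K) : exists H : R -> \bar R, [/\ measurable_fun [set: GR] H,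
    forall t, (0 <= H t)%E, (\int[leb]_(t in `]0%R, T[) H t <= (e * (C + 1) ^+ 2)%:E)%E &
    forall t w, rnorm (w - U t (U (- a k) (v (a k)))) <= r ->
      (section_mass w t <= 2%:E * H t + (8 * r ^+ 2)%:E)%E].
  by apply: packet_bound => //; rewrite (U_iso hU) vC// a0 aS.
have mD : measurable (`]0, T[ : set GR) by exact: measurable_itv.
have mH k : measurable_fun [set: GR] (H k) by case: (HH k).
have H0 k t : (0 <= H k t)%E by case: (HH k).
have G0 t : (0 <= \sum_(k < K) 2%:E * H k t)%E by apply: sume_ge0 => k _; rewrite mule_ge0.
(* At each time a single packet is enough; the sum of all of them is a majorant that does not refer
   to the step containing [t]. *)
apply: (@le_trans _ _ (\int[leb]_(t in `]0%R, T[) (\sum_(k < K) 2%:E * H k t + (8 * r ^+ 2)%:E))%E).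
  rewrite [leLHS]integral_mkcond [leRHS]integral_mkcond; apply: ge0_le_lower_integral => t _; rewrite !patchE.
    case: ifP => // _; apply: integral_ge0 => x _; rewrite lee_fin mulr_ge0 ?sqr_ge0//.
    by have [_ Q01] := uQ; case/andP: (Q01 (t, x)).
  have c0 : (0 <= (8 * r ^+ 2)%:E)%E by rewrite lee_fin mulr_ge0 ?sqr_ge0.
  case: ifP => [|_]; last by case: ifP => // _; rewrite adde_ge0.
  rewrite inE/= in_itv/= => /andP[t0 tS].
  rewrite mem_set/=; last by rewrite /= in_itv/= t0 (lt_le_trans tS).
  pose i := Num.truncn (t / h).
  have /andP[i1 i2] : i%:R <= t / h < i.+1%:R by apply: truncn_itv; rewrite divr_ge0 ?ltW.
  have ai : a i <= t by rewrite /a mulrC -ler_pdivlMr.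
  have ai1 : t < a i.+1 by rewrite /a mulrC -ltr_pdivrMr.
  have iK : (i < K)%N.
    rewrite -(ltr_nat R); apply: le_lt_trans i1 _; rewrite ltr_pdivrMr// mulrC divfK//.
    by rewrite pnatr_eq0 -lt0n.
  have [_ _ _ /(_ t (v t))] := HH (Ordinal iK).
  rewrite -UD => /(_ _)/le_trans; apply.
    apply: vU => //; first exact: ltW.
    by rewrite lerBlDr; move: (ltW ai1); rewrite /a -natr1 mulrDr mulr1 addrC.
  apply: leeD => //; rewrite (bigD1 (Ordinal iK))//= leeDl//.
  by apply: sume_ge0 => k _; rewrite mule_ge0.
rewrite ge0_integralD//; last 2 first.
- by apply: measurable_funTS; apply: emeasurable_sum => k _; exact: measurable_funeM.
- by move=> t _; rewrite lee_fin mulr_ge0 ?sqr_ge0.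
rewrite [leRHS]EFinD; apply: (@leeD R); last first.
  by rewrite integral_cst//= lebesgue_measure_itv/= lte_fin T0 sube0.
rewrite ge0_integral_sum//; last 2 first.
- by move=> k; apply: measurable_funTS; exact: measurable_funeM.
- by move=> k t _; rewrite mule_ge0.
apply: (@le_trans _ _ (\sum_(k < K) (2 * (e * (C + 1) ^+ 2))%:E)%E); last first.
  by rewrite sumEFin lee_fin sumr_const card_ord -[leLHS]mulr_natl; lra.
apply: lee_sum => k _; rewrite ge0_integralZl//; last exact: measurable_funTS.
by rewrite EFinM; apply: lee_wpmul2l => //; case: (HH k).
Qed.

End test_bound.

(** * Null sets under a limit measure *)

Section absolute_continuity.
Context {R : realType} {d : nat}.
Local Notation E := (L2_torus R d).
Local Notation leb := (@lebesgue_measure R).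
Local Notation GR := (measurableTypeR R).
Local Notation ST := (measurableTypeR R * torus R d)%type.

Lemma spacetime_measure_slabC (T : R) : spacetime_measure d T (~` slab T) = 0%E.
Proof.
have mS : measurable (slab T : set ST) by apply: measurableX => //; exact: measurable_itv.
rewrite -[X in spacetime_measure d T X]setIT -integral_indic//; last exact: measurableC.
rewrite spacetime_fubini; last 2 first.
- by apply/measurable_EFinP; apply: measurable_indic; exact: measurableC.
- by move=> z; rewrite lee_fin.
apply: integral0_eq => t tT; apply: integral0_eq => x _.
by rewrite indicE memNset//; apply; split.
Qed.

Lemma spacetime_null_extend (T P : R) (A : set ST) : measurable A -> A `<=` slab T -> T <= P ->
  spacetime_measure d T A = 0%E -> spacetime_measure d P A = 0%E.
Proof.
move=> mA AT TP.
have E1 Q : spacetime_measure d Q A =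
    (\int[leb]_(t in `]0%R, Q[) \int[torus_measure R d]_x (\1_A (t, x))%:E)%E.
  rewrite -[X in spacetime_measure d Q X]setIT -integral_indic// spacetime_fubini//.
  by apply/measurable_EFinP; exact: measurable_indic.
rewrite !E1 => <-; rewrite [LHS]integral_mkcond [RHS]integral_mkcond; apply: eq_integral => t _; rewrite !patchE.
have [tT|tT] := boolP (t \in `]0, T[).
  rewrite !mem_set//=; move: tT; rewrite !in_itv/= => /andP[-> tT] //.
  by rewrite (lt_le_trans tT).
rewrite [in RHS]memNset; last exact/negP.
case: ifP => // _; apply: integral0_eq => x _.
by rewrite indicE memNset// => /AT[/= tT']; rewrite tT' in tT.
Qed.

(** The indicator of [A] is approximated in L^1 of the sum of [nu] on [S] and of space-time Lebesgue
    measure. As [A] is null for the latter, the same estimate bounds both the loss on [A] and the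
    mean of [Q]. *)
Lemma approx_null_set (P om : R) (nu : {measure set ST -> \bar R}) (A S : set ST) (e : R) :
  0 < P -> om * P = pi *+ 2 -> measurable A -> measurable S -> A `<=` S -> (nu S < +oo)%E ->
  S `<=` slab P -> spacetime_measure d P A = 0%E -> 0 < e ->
  exists Q, [/\ unit_trig om Q, (\int[nu]_(z in A) (1 - Q z)%:E <= e%:E)%E & mean P Q <= e].
Proof.
move=> P0 omP mA mS AS Soo SP A0 e0.
pose nuS : {measure set ST -> \bar R} := mrestr nu mS; pose lam := spacetime_measure d P.
pose mu0 : {measure set ST -> \bar R} := measure_add nuS lam.
have mu0E B : mu0 B = (nuS B + lam B)%E by exact: measure_addE.
have nuSE B : nuS B = nu (B `&` S) by [].
have foo : (mu0 [set: ST] < +oo)%E.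
  rewrite mu0E [lam _](spacetime_measureT P0 omP) nuSE setTI lte_add_pinfty//; exact: ltry.
pose mu : {finite_measure set ST -> \bar R} := mfrestr measurableT foo.
have muE (f : ST -> \bar R) : measurable_fun [set: ST] f -> (forall z, 0 <= f z)%E ->
    (\int[mu]_z f z = \int[nu]_(z in S) f z + \int[lam]_z f z)%E.
  move=> mf f0; transitivity (\int[mu0]_z f z)%E.
    by apply: eq_measure_integral => B mB _; rewrite /= /mfrestr /mrestr setIT.
  by rewrite ge0_integral_measure_add// ge0_integral_mrestr.
have mu_slab : mu (~` slab P) = 0%E.
  have -> : mu (~` slab P) = mu0 (~` slab P `&` [set: ST]) by [].
  rewrite setIT mu0E /lam spacetime_measure_slabC.
  rewrite nuSE [_ `&` S](_ : _ = set0) ?measure0 ?adde0//.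
  by apply/seteqP; split => // z [nz /SP].
have [_ [_ _ /(_ _ e0)[Q uQ QA]]] := appr_measurable P0 omP mu_slab mA.
have [tQ Q01] := uQ; have mQ := trig_poly_measurable tQ.
have mf : measurable_fun [set: ST] (fun z => `|Q z - (z \in A)%:R|%:E).
  apply/measurable_EFinP; apply: measurableT_comp => //; apply: measurable_funB => //.
  exact: (measurable_indic mA).
have f0 z : (0 <= `|Q z - (z \in A)%:R|%:E)%E by rewrite lee_fin.
rewrite (muE _ mf f0) in QA.
exists Q; split => //.
- apply: le_trans (ltW QA).
  apply: (@le_trans _ _ (\int[nu]_(z in S) `|Q z - (z \in A)%:R|%:E)%E); last first.
    by rewrite leeDl//; apply: integral_ge0.
  apply: (@le_trans _ _ (\int[nu]_(z in A) `|Q z - (z \in A)%:R|%:E)%E); last first.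
    by apply: ge0_subset_integral => //; exact: measurable_funTS.
  apply: ge0_le_lower_integral => z Az; rewrite lee_fin.
    by rewrite subr_ge0; case/andP: (Q01 z).
  by rewrite mem_set// -normrN opprB ler_norm.
rewrite -lee_fin; apply: le_trans (ltW QA).
have -> : (mean P Q)%:E = (\int[lam]_z (Q z)%:E)%E.
  by rewrite /mean /Rintegral fineK//; apply: integrable_fin_num => //; exact: (trig_integrable P0 omP tQ).
apply: (@le_trans _ _ (\int[lam]_z `|Q z - (z \in A)%:R|%:E)%E); last first.
  by rewrite leeDr//; apply: integral_ge0 => z _; rewrite lee_fin.
apply: ae_ge0_le_integral => //.
- by move=> z _; rewrite lee_fin; case/andP: (Q01 z).
- exact/measurable_EFinP.
exists A; split => // z /= H; apply: contrapT => nA; apply: H => _.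
by rewrite memNset// subr0 lee_fin ler_norm.
Qed.

(** The strip keeps away from the ends of ]0, T[: there [nu] is finite, and a test function can
    coincide with [Q]. *)
Lemma null_set_strip (U : R -> bop E) (T C : R) (v : nat -> R -> E)
    (w : nat -> L2 (spacetime_measure d T)) (nu : {measure set ST -> \bar R}) (A : set ST) (a b : R) :
  schrodinger_group U -> 0 < T -> (forall n t, 0 <= t <= T -> rnorm (v n t) <= C) ->
  (forall e, 0 < e -> exists2 K : nat, (0 < K)%N & forall n a t, 0 <= a -> a <= t -> t <= T ->
    t - a <= T / K%:R -> rnorm (v n t - U (t - a) (v n a)) <= e) ->
  (forall n (phi : ST -> R), measurable_fun [set: ST] phi -> (forall z, 0 <= phi z) ->
    (density_test (w n) phi = \int[leb]_(t in `]0%R, T[) \int[torus_measure R d]_x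
      (phi (t, x) * normc (v n t x) ^+ 2)%:E)%E) ->
  radon_on_slab T nu -> weak_star_limit w nu ->
  0 < a -> a <= b -> b < T -> measurable A -> A `<=` `[a, b] `*` [set: torus R d] ->
  spacetime_measure d T A = 0%E -> nu A = 0%E.
Proof.
move=> hU T0 vC vU wv [nu_slab nuK] [s sh ws] a0 ab bT mA AS A0.
set S := `[a, b] `*` [set: torus R d] in AS.
have mS : measurable (S : set ST) by apply: measurableX => //; exact: measurable_itv.
have cS : compact S by apply: compact_setX; [exact: segment_compact|exact: compact_torus].
have ST_ : S `<=` slab T.
  move=> z [/= + _]; rewrite /slab /= !in_itv/= => /andP[az zb]; split => //.
  by rewrite (lt_le_trans a0 az) (le_lt_trans zb bT).
have Soo := nuK _ cS ST_.
have pi2 : 0 < pi *+ 2 :> R by rewrite mulrn_wgt0// pi_gt0.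
(* All free waves have period 1/(2 pi); [P] is [m] times this period and at least [T], and [om] is 2
   pi / P. *)
pose m := Num.bound (pi *+ 2 * T).
have mT : pi *+ 2 * T < m%:R by apply: archi_boundP; rewrite mulr_ge0// ltW.
have m0R : 0 < m%:R :> R by apply: lt_trans mT; rewrite mulr_gt0.
have m0 : (0 < m)%N by rewrite -(ltr_nat R).
pose P : R := m%:R / (pi *+ 2); pose om : R := (pi *+ 2) ^+ 2 / m%:R.
have TP : T <= P by rewrite ler_pdivlMr// mulrC ltW.
have P0 : 0 < P by exact: lt_le_trans TP.
have omP : om * P = pi *+ 2.
  by rewrite /om /P mulrA divfK ?gt_eqF// expr2 mulfK ?gt_eqF.
have omm : om * m%:R = (pi *+ 2) ^+ 2 by rewrite /om divfK// gt_eqF.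
have SP : S `<=` slab P.
  move=> z /ST_[/=]; rewrite /slab /= !in_itv/= => /andP[-> zT] _.
  by rewrite (lt_le_trans zT).
have AP := spacetime_null_extend mA (subset_trans AS ST_) TP A0.
pose loss e (Q : R * torus R d -> R) := (\int[nu]_(z in A) (1 - Q z)%:E <= e%:E)%E.
have mQ1 Q : unit_trig om Q -> measurable_fun A (fun z : ST => (1 - Q z)%:E).
  move=> [tQ _]; apply: measurable_funTS; apply/measurable_EFinP; apply: measurable_funB => //.
  exact: trig_poly_measurable tQ.
have loss_mono x y Q : x <= y -> loss x Q -> loss y Q.
  by move=> xy /le_trans; apply; rewrite lee_fin.
have lossM x y Q Q' : unit_trig om Q -> unit_trig om Q' -> loss x Q -> loss y Q' ->
    loss (x + y) (fun z => Q z * Q' z).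
  move=> hQ hQ' lx ly; have [_ Q01] := hQ; have [_ Q01'] := hQ'.
  rewrite /loss EFinD; apply: le_trans (leeD lx ly).
  rewrite -ge0_integralD//; last 4 first.
  - by move=> z _; rewrite lee_fin subr_ge0; case/andP: (Q01 z).
  - exact: mQ1.
  - by move=> z _; rewrite lee_fin subr_ge0; case/andP: (Q01' z).
  - exact: mQ1.
  apply: ge0_le_lower_integral => z _.
    rewrite lee_fin subr_ge0; have /andP[? ?] := Q01 z; have /andP[? ?] := Q01' z.
    by rewrite mulr_ile1.
  by rewrite -EFinD lee_fin; have /andP[? ?] := Q01 z; have /andP[? ?] := Q01' z; nra.
have loss_mean e : 0 < e -> exists Q, [/\ unit_trig om Q, loss e Q & mean P Q <= e].
  by move=> e0; exact: (approx_null_set P0 omP mA mS AS Soo SP AP e0).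
have C0 : 0 <= C by apply: le_trans (vC 0%N 0 _); rewrite ?rnorm_ge0// lexx ltW.
apply/eqP; rewrite -measure_le0; apply/lee_addgt0Pr => y y0; rewrite add0e.
(* Since r^2 <= r, the error [8 * r ^+ 2 * P] of [mass_bound] is at most [y / 2]. *)
pose r := Num.min 1 (y / 2 / (8 * P)).
have r0 : 0 < r by rewrite lt_min ltr01/= !divr_gt0// mulr_gt0.
have r1 : r <= 1 by rewrite ge_min lexx.
have rP : 8 * r ^+ 2 * P <= y / 2.
  have rr : r <= y / 2 / (8 * P) by rewrite ge_min lexx orbT.
  have : r ^+ 2 <= y / 2 / (8 * P).
    by apply: le_trans rr; rewrite expr2 ler_piMl// ltW.
  have P8 : 0 < 8 * P by rewrite mulr_gt0.
  by move=> H; rewrite mulrAC -(ler_pdivlMl _ _ P8) mulrC.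
have [K K0 vUK] := vU _ r0.
(* [K] is already fixed, so [e] may depend on it; [e * M], which is [y / 2], adds the loss [e] to
   the energy of [K] packets. *)
pose M : R := 2 * (K%:R * (C + 1) ^+ 2) + 1.
have M0 : 0 < M by rewrite ltr_wpDl// mulr_ge0// mulr_ge0// exprn_ge0// addr_ge0.
pose e := y / 2 / M; have e0 : 0 < e by rewrite !divr_gt0.
have [Q [uQ lQ Qe]] := small_energy P0 omP m0 loss_mono lossM loss_mean d.+1 e0.
have {}Qe (I : finType) (kappa : I -> 'rV[int]_d) (c : I -> R[i]) : injective kappa ->
    energy om P m Q kappa c <= e * \sum_i normc (c i) ^+ 2.
  move=> kI; apply: (Qe I kappa c 0 fullv kI); last by move=> i _; rewrite memvf.
  by rewrite dimvf /dim /= mul1n.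
have [tQ Q01] := uQ.
(* Half of the distance to the ends of ]0, T[, so that the enlarged strip is still inside. *)
pose q := Num.min a (T - b) / 2.
have q0 : 0 < q by rewrite divr_gt0// lt_min a0 subr_gt0.
have qa : q < a.
  have : Num.min a (T - b) <= a by rewrite ge_min lexx.
  by rewrite /q; lra.
have qb : b + q < T.
  have : Num.min a (T - b) <= T - b by rewrite ge_min lexx orbT.
  by rewrite /q; lra.
(* [phi] is at most [Q] everywhere and equal to [Q] on [A]. *)
pose phi (z : ST) := cutoff a b q z.1 * Q z.
have phiQ z : 0 <= phi z <= Q z.
  have /andP[? ?] := Q01 z; have /andP[? ?] := cutoff_le1 a b z.1 q0.
  by rewrite /phi mulr_ge0//= ler_piMl.
have cphi : continuous phi.
  move=> z; apply: cvgM; last exact: (trig_poly_continuous tQ).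
  by apply: (@continuous_comp _ _ _ fst (cutoff a b q)); [exact: cvg_fst|exact: continuous_cutoff].
have mphi : measurable_fun [set: ST] phi.
  apply: measurable_funM; last exact: trig_poly_measurable tQ.
  apply: (measurableT_comp (continuous_measurable_fun (@continuous_cutoff R a b q))).
  exact: measurable_fst.
have tphi : test_function T phi.
  split => //; exists (`[a - q, b + q] `*` [set: torus R d]); split.
  - by apply: compact_setX; [exact: segment_compact|exact: compact_torus].
  - move=> z [/= + _]; rewrite /slab /= !in_itv/= => /andP[az zb]; split => //.
    by rewrite (le_lt_trans zb qb) andbT; apply: lt_le_trans az; rewrite subr_gt0.
  move=> z; apply: contra_notP => /eqP; rewrite mulf_eq0 negb_or => /andP[cz _].
  by split => //=; rewrite in_itv/=; exact: cutoff_support cz.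
have test_le : (\int[nu]_z (phi z)%:E <= (2 * (K%:R * (e * (C + 1) ^+ 2)) + 8 * r ^+ 2 * P)%:E)%E.
  apply: (cvge_to_le (ws _ tphi)); apply: nearW => k.
  rewrite wv//; last by move=> z; case/andP: (phiQ z).
  have := mass_bound hU P0 omP omm uQ (ltW e0) Qe T0 TP K0 r0 r1 (vC (s k)) (vUK (s k)).
  apply: le_trans; apply: ge0_le_lower_integral => t _.
    apply: integral_ge0 => x _; rewrite lee_fin mulr_ge0 ?sqr_ge0//; by case/andP: (phiQ (t, x)).
  apply: ge0_le_lower_integral => x _; rewrite lee_fin.
    by rewrite mulr_ge0 ?sqr_ge0//; case/andP: (phiQ (t, x)).
  by rewrite ler_wpM2r ?sqr_ge0//; case/andP: (phiQ (t, x)).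
have nuAE : (\int[nu]_(z in A) (1 - Q z)%:E + \int[nu]_(z in A) (Q z)%:E)%E = nu A.
  rewrite -ge0_integralD//; last 4 first.
  - by move=> z _; rewrite lee_fin subr_ge0; case/andP: (Q01 z).
  - exact: mQ1.
  - by move=> z _; rewrite lee_fin; case/andP: (Q01 z).
  - by apply: measurable_funTS; apply/measurable_EFinP; exact: trig_poly_measurable tQ.
  by under eq_integral do rewrite -EFinD subrK; rewrite integral_cst// mul1e.
apply: (@le_trans _ _ (\int[nu]_(z in A) (1 - Q z)%:E + \int[nu]_(z in A) (Q z)%:E)%E).
  by rewrite nuAE.
apply: (@le_trans _ _ (e%:E + (2 * (K%:R * (e * (C + 1) ^+ 2)) + 8 * r ^+ 2 * P)%:E)%E).
  apply: (@leeD R); first exact: lQ.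
  apply: le_trans test_le; rewrite [leLHS]integral_mkcond.
  apply: ge0_le_lower_integral => z _; rewrite patchE; case: ifP => //.
  - by move=> _; rewrite lee_fin; case/andP: (Q01 z).
  - rewrite inE => /AS[/= + _]; rewrite in_itv/= => zab.
    by rewrite lee_fin /phi cutoff_eq1// mul1r.
  by move=> _; rewrite lee_fin; case/andP: (phiQ z).
rewrite -EFinD lee_fin.
have : e * M = y / 2 by rewrite /e divfK// gt_eqF.
by rewrite /M; lra.
Qed.

(** Countably many strips exhaust the slab; the shift by 3 gives T/(n + 3) <= T/2, so each time
    interval is nonempty. *)
Lemma null_set_slab (T : R) (nu : {measure set ST -> \bar R}) (A : set ST) : 0 < T ->
  measurable A -> nu (~` slab T) = 0%E ->
  (forall a b, 0 < a -> a <= b -> b < T -> nu (A `&` (`[a, b] `*` [set: torus R d])) = 0%E) ->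
  nu A = 0%E.
Proof.
move=> T0 mA nuC nuA.
pose B n : set ST := A `&` (`[T / n.+3%:R, T - T / n.+3%:R] `*` [set: torus R d]).
have mB n : measurable (B n).
  by apply: measurableI => //; apply: measurableX => //; exact: measurable_itv.
have h n : 0 < T / n.+3%:R by rewrite divr_gt0.
have B0 n : nu (B n) = 0%E.
  apply: nuA => //; last by rewrite gtrBl.
  have : T / n.+3%:R <= T / 2%:R by rewrite ler_pM2l// lef_pV2 ?posrE ?ltr0n// ler_nat.
  by move: (T / n.+3%:R) => y; lra.
have mC : measurable (~` slab T : set ST).
  by apply: measurableC; apply: measurableX => //; exact: measurable_itv.
have mU : measurable (\bigcup_n B n) by exact: bigcup_measurable.
apply/eqP; rewrite -measure_le0.
apply: (@le_trans _ _ (nu (~` slab T `|` \bigcup_n B n))).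
  apply: le_measure; rewrite ?inE//; first exact: measurableU.
  move=> z Az; have [zT|zT] := pselect (slab T z); last by left.
  right; have [/=] := zT; rewrite in_itv/= => /andP[z0 zT'] _.
  pose x := Num.min z.1 (T - z.1); have x0 : 0 < x by rewrite lt_min z0 subr_gt0.
  pose n := Num.bound (T / x).
  have hx : T / n.+3%:R <= x.
    rewrite ler_pdivrMr// mulrC -ler_pdivrMr//; apply: le_trans (ltW (archi_boundP _)) _.
      by rewrite divr_ge0 ?ltW.
    by rewrite ler_nat -/n; lia.
  exists n => //; split => //; split => //=; rewrite in_itv/=.
  by move: hx; rewrite /x le_min => /andP[-> ]; rewrite lerBrDr addrC -lerBrDr => ->.
apply: (@le_trans _ _ (nu (~` slab T) + nu (\bigcup_n B n))%E); first exact: measureU2.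
rewrite nuC add0e.
apply: (@le_trans _ _ (\sum_(n <oo) nu (B n))%E); first exact: measure_sigma_subadditive.
by rewrite eseries0// => n _ _; exact: B0.
Qed.

End absolute_continuity.

Theorem corollary2p2 (R : realType) (d : nat) (hd : (1 <= d)%N)
    (U : R -> bop (L2_torus R d)) (hU : schrodinger_group U)
    (V : R -> bop (L2_torus R d)) (hV : locally_bochner_integrable V)
    (u0 : nat -> L2_torus R d) (hu0 : bounded_seq u0)
    (u : nat -> R -> L2_torus R d)
    (hu : forall n, duhamel_solution U V (u0 n) (u n))
    (T : R) (hT : 0 < T) :
  exists2 w : nat -> L2 (spacetime_measure d T),
    forall n, spacetime_class (u n) (w n) & AC_property w.
Proof.
have [m [mm m0 Vm im]] := operator_norm_profile T hV.
have [C uC umod] := solutions_modulus hU hT mm m0 Vm im hu0 hu.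
have /choice[w Hw] n := curve_class hT (proj1 (hu n)) (uC n).
exists w => [n|]; first by case: (Hw n).
split.
  (* x <= x^2 + 1 spares a square root. *)
  exists (T * C ^+ 2 + 1) => n; have [_ wC _] := Hw n.
  by have := rnorm_ge0 (w n); nra.
move=> nu radon wlim; apply/null_content_dominatesP => A mA A0.
apply: (null_set_slab hT mA (proj1 radon)) => a b a0 ab bT.
have mS : measurable (`[a, b] `*` [set: torus R d] : set (measurableTypeR R * torus R d)).
  by apply: measurableX => //; exact: measurable_itv.
apply: (null_set_strip hU hT uC umod _ radon wlim a0 ab bT).
- by move=> n; case: (Hw n).
- exact: measurableI.
- by move=> z [].
by apply/eqP; rewrite -measure_le0 -A0; apply: measureIl.
Qed.
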